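(* Consider a sequence of data sets for the random effects model indexed by $p$ (with $r=r(p)$), and the associated sequence of marginal Gibbs chains on $\mathbb{R}^{p+1}$ with transition functions $K$ and stationary distributions $\Pi$ (see context). Let $\psi$ be the Euclidean distance on $\mathbb{R}^{p+1}$. Suppose that: (E1) there exists a constant $\delta>0$ such that $r^2/p^{3+\delta}\to\infty$ as $p\to\infty$; (E2) there exist positive constants $\ell_1,\ell_2$ such that, for large enough $p$, $$\frac1p\sum_{i=1}^p(\bar y_i-\bar y)^2<\ell_1,\qquad \frac1{rp}\sum_{i=1}^p\sum_{j=1}^r(y_{ij}-\bar y_i)^2<\ell_2 .$$ Then for $p$ large enough, there exist a constant $L_0>0$ (independent of $p$) and some $\rho<1$ (depending on $p$) such that $$\mathrm{W}_\psi(K_\eta^m,\Pi)\le4\left[\sum_{i=1}^p(\eta_i+\bar y-\bar y_i)^2+(\eta_0-\sqrt p\,\bar y)^2+L_0p\right]\rho^m,\qquad \eta=(\eta_0,\dots,\eta_p)^T\in\mathbb{R}^{p+1},\ m\ge0 .$$ Moreover, $\limsup_{p\to\infty}\rho=0$.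
   Context: $a_1,a_2,b_1,b_2>0$ are fixed constants (independent of $p$). For given positive integers $p,r$ and data $y=(y_{ij})_{1\le i\le p,1\le j\le r}$, let $\bar y_i=r^{-1}\sum_jy_{ij}$ and $\bar y=(rp)^{-1}\sum_{i,j}y_{ij}$. $\mathrm{Gamma}(a,b)$ has density proportional to $x^{a-1}e^{-bx}1_{x>0}$. The target is the posterior on $(\eta,\lambda_\theta,\lambda_e)\in\mathbb{R}^{p+1}\times(0,\infty)^2$ with density $$\pi^*(\eta,\lambda_\theta,\lambda_e|y)\propto\lambda_e^{rp/2}\exp\Bigl[-\tfrac{\lambda_e}{2}\sum_{i=1}^p\sum_{j=1}^r(y_{ij}-\eta_0/\sqrt p-\eta_i)^2\Bigr]\lambda_\theta^{p/2}\exp\Bigl(-\tfrac{\lambda_\theta}{2}\sum_{i=1}^p\eta_i^2\Bigr)\lambda_\theta^{a_1-1}e^{-b_1\lambda_\theta}\lambda_e^{a_2-1}e^{-b_2\lambda_e},$$ which is proper; $\Pi$ is its $\eta$-marginal. From state $\eta$, the marginal Gibbs chain moves to $\tilde\eta$ as follows: (1) draw, independently, $\lambda_\theta\sim\mathrm{Gamma}(p/2+a_1,\,b_1+\sum_{i=1}^p\eta_i^2/2)$ and $\lambda_e\sim\mathrm{Gamma}(rp/2+a_2,\,b_2+\sum_{i=1}^p\sum_{j=1}^r(y_{ij}-\eta_0/\sqrt p-\eta_i)^2/2)$; (2) draw $\tilde\eta_0\sim\mathrm{N}(\sqrt p\,\bar y,\,(\lambda_\theta+r\lambda_e)/(r\lambda_e\lambda_\theta))$;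 (3) independently for $i=1,\dots,p$ draw $\tilde\eta_i\sim\mathrm{N}\left(\frac{r\lambda_e(\bar y_i-\tilde\eta_0/\sqrt p)}{\lambda_\theta+r\lambda_e},\,\frac1{\lambda_\theta+r\lambda_e}\right)$. $K$ is the transition function of this chain (stationary distribution $\Pi$), and $K_\eta^m$ the $m$-step law from $\eta$ ($K_\eta^0$ is the point mass at $\eta$). $\mathrm{W}_\psi(\mu,\nu)$ is the infimum of $\int\psi\,d\upsilon$ over couplings $\upsilon$ of $\mu,\nu$. *)

(* Defs.v *)
From HB Require Import structures.
From mathcomp Require Import all_boot all_order all_algebra.
From mathcomp Require Import all_classical all_reals all_analysis.
From mathcomp Require Import measurable_realfun.
Set Implicit Arguments.
Unset Strict Implicit.
Unset Printing Implicit Defensive.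
Import Order.TTheory GRing.Theory Num.Theory.
Import numFieldNormedType.Exports.
Local Open Scope classical_set_scope.
Local Open Scope ring_scope.

Section density_lemmas.
Context d (Y : measurableType d) (R : realType).
Local Open Scope ereal_scope.

Definition density_measure (mu : {measure set Y -> \bar R}) (f : Y -> R) :
  set Y -> \bar R := fun A => \int[mu]_(y in A) (f y)%:E.

Lemma density_measure0 mu f : density_measure mu f set0 = 0.
Proof. by rewrite /density_measure integral_set0. Qed.

Lemma density_measure_ge0 mu (f : Y -> R) A :
  (forall y, 0 <= f y)%R -> 0 <= density_measure mu f A.
Proof. by move=> f0; apply: integral_ge0 => y _; rewrite lee_fin. Qed.

Lemma density_measure_sigma_additive mu (f : Y -> R) :
  (forall y, 0 <= f y)%R -> measurable_fun setT f ->
  semi_sigma_additive (density_measure mu f).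
Proof.
move=> f0 mf F mF tF mUF; rewrite /density_measure ge0_integral_bigcup//=.
- apply: is_cvg_ereal_nneg_natsum_cond => n _ _.
  by apply: integral_ge0 => y _; rewrite lee_fin.
- by apply/measurable_EFinP/measurable_funTS.
- by move=> y _; rewrite lee_fin.
Qed.

Lemma measurable_density_measure d' (X : measurableType d')
    (mu : {sigma_finite_measure set Y -> \bar R}) (f : X -> Y -> R) A :
  (forall x y, 0 <= f x y)%R ->
  measurable_fun setT (fun z : X * Y => f z.1 z.2) ->
  measurable A -> measurable_fun setT (fun x => density_measure mu (f x) A).
Proof.
move=> f0 mf mA.
pose g (z : X * Y) := (f z.1 z.2)%:E * (\1_A z.2)%:E.
have -> : (fun x => density_measure mu (f x) A) = fubini_F mu g.
  apply/funext => x; rewrite /density_measure integral_mkcond.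
  apply: eq_integral => y _.
  by rewrite /g/= patchE indicE; case: ifPn; rewrite ?mule1 ?mule0.
apply: measurable_fun_fubini_tonelli_F => [|z].
  apply: emeasurable_funM; first exact/measurable_EFinP.
  apply/measurable_EFinP.
  by apply: (measurableT_comp (measurable_indic mA)).
by rewrite /g mule_ge0// lee_fin.
Qed.

End density_lemmas.

Section gamma.
Context (R : realType).
Local Notation RB := (measurableTypeR R).

Definition gamma_fun (a b x : R) : R :=
  if 0 < x then x `^ (a - 1) * expR (- b * x) else 0.

Lemma gamma_fun_ge0 a b x : 0 <= gamma_fun a b x.
Proof.
by rewrite /gamma_fun; case: ifP => // _; rewrite mulr_ge0 ?powR_ge0 ?expR_ge0.
Qed.

Lemma measurable_gamma_fun2 a :
  measurable_fun setT (fun z : RB * RB => gamma_fun a z.1 z.2).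
Proof.
apply: measurable_fun_ifT => //.
  by apply: measurable_fun_ltr => //; exact: measurable_snd.
apply: measurable_funM.
  by apply: (measurableT_comp (measurable_powR (a - 1))); exact: measurable_snd.
apply: measurableT_comp => //.
by apply: measurable_funM => //; apply: measurableT_comp.
Qed.

Lemma measurable_gamma_fun a b : measurable_fun setT (gamma_fun a b : RB -> R).
Proof.
exact: (measurableT_comp (measurable_gamma_fun2 a) (pair1_measurable b)).
Qed.

Definition gamma_weight (a b : R) : set RB -> \bar R :=
  density_measure lebesgue_measure (gamma_fun a b).

Let gamma_weight0 a b : gamma_weight a b set0 = 0%E.
Proof. exact: density_measure0. Qed.

Let gamma_weight_ge0 a b A : (0 <= gamma_weight a b A)%E.
Proof. by apply: density_measure_ge0; exact: gamma_fun_ge0. Qed.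

Let gamma_weight_sigma_additive a b : semi_sigma_additive (gamma_weight a b).
Proof.
apply: density_measure_sigma_additive; first exact: gamma_fun_ge0.
exact: measurable_gamma_fun.
Qed.

HB.instance Definition _ a b := isMeasure.Build _ _ _ (gamma_weight a b)
  (gamma_weight0 a b) (gamma_weight_ge0 a b)
  (@gamma_weight_sigma_additive a b).

(* [mnormalize] divides by the total mass, which is in ]0, +oo[ as soon as
   a, b > 0; the Dirac mass is only used when it is not. *)
Definition gamma_prob (a b : R) : probability RB R :=
  mnormalize (gamma_weight a b) (\d_(0 : RB)).

Definition gamma_weight_kernel a : RB -> {measure set RB -> \bar R} :=
  gamma_weight a.

Lemma measurable_gamma_weight a A : measurable A ->
  measurable_fun setT (fun b : RB => gamma_weight_kernel a b A).
Proof.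
move=> mA; apply: measurable_density_measure => //.
- by move=> *; exact: gamma_fun_ge0.
- exact: measurable_gamma_fun2.
Qed.

HB.instance Definition _ a := isKernel.Build _ _ _ _ _ (gamma_weight_kernel a)
  (@measurable_gamma_weight a).

End gamma.

Section gamma_kernel.
Context (R : realType).
Local Notation RB := (measurableTypeR R).

Definition gamma_kernel (a : R) : RB -> {measure set RB -> \bar R} :=
  gamma_prob a.

Let gamma_kernelE a :
  gamma_kernel a = knormalize (gamma_weight_kernel a) (\d_(0 : RB)).
Proof. by []. Qed.

Let measurable_gamma_kernel a A : measurable A ->
  measurable_fun setT (gamma_kernel a ^~ A).
Proof. by rewrite gamma_kernelE; exact: measurable_kernel. Qed.

HB.instance Definition _ a := isKernel.Build _ _ _ _ _ (gamma_kernel a)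
  (@measurable_gamma_kernel a).

Let gamma_kernel1 a b : gamma_kernel a b setT = 1%E.
Proof. exact: probability_setT. Qed.

HB.instance Definition _ a := Kernel_isProbability.Build _ _ _ _ _
  (gamma_kernel a) (gamma_kernel1 a).

End gamma_kernel.

Section normal_kernel.
Context (R : realType).
Local Notation RB := (measurableTypeR R).

Lemma measurable_invr : measurable_fun setT (GRing.inv : R -> R).
Proof.
have -> : (GRing.inv : R -> R) = (fun x => if x == 0 then 0 else x^-1).
  by apply/funext => x; case: eqP => // ->; rewrite invr0.
apply: measurable_fun_if => //.
  by apply: measurable_fun_eqr.
rewrite setTI.
apply: (@measurable_funS _ _ _ _ [set r : R | r != 0]) => //.
- exact: open_measurable.
- by move=> x /negbT.
- apply: open_continuous_measurable_fun => //; apply/in_setP => x /= x0.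
  exact: inv_continuous.
Qed.

Lemma measurable_sqrtr : measurable_fun setT (Num.sqrt : R -> R).
Proof. by apply: continuous_measurable_fun; exact: sqrt_continuous. Qed.

Definition normal_kernel (z : RB * RB) : {measure set RB -> \bar R} :=
  normal_prob z.1 z.2.

Let measurable_normal_pdf2 :
  measurable_fun setT (fun z : (RB * RB) * RB => normal_pdf z.1.1 z.1.2 z.2).
Proof.
pose m (z : (RB * RB) * RB) : R := z.1.1.
pose s (z : (RB * RB) * RB) : R := z.1.2.
pose x (z : (RB * RB) * RB) : R := z.2.
have mm : measurable_fun setT m by exact: measurableT_comp.
have ms : measurable_fun setT s by exact: measurableT_comp.
have mx : measurable_fun setT x by exact: measurable_snd.
have -> : (fun z : RB * RB * RB => normal_pdf z.1.1 z.1.2 z.2) =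
    (fun z => if s z == 0 then \1_`[0, 1]%classic (x z)
              else (Num.sqrt (s z ^+ 2 * pi *+ 2))^-1 *
                   expR (- (x z - m z) ^+ 2 / (s z ^+ 2 *+ 2))).
  by apply/funext.
apply: measurable_fun_ifT.
- by apply: measurable_fun_eqr.
- exact: measurableT_comp.
- apply: measurable_funM.
    apply: (measurableT_comp measurable_invr).
    apply: (measurableT_comp measurable_sqrtr).
    under eq_fun do rewrite -mulr_natr.
    by do 2 apply: measurable_funM => //; exact: measurable_funX.
  apply: measurableT_comp => //.
  apply: measurable_funM.
    by apply: measurableT_comp => //; apply: measurable_funX; exact: measurable_funB.
  apply: (measurableT_comp measurable_invr).
  under eq_fun do rewrite -mulr_natr.
  by apply: measurable_funM => //; exact: measurable_funX.
Qed.

Let measurable_normal_kernel A : measurable A ->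
  measurable_fun setT (normal_kernel ^~ A).
Proof.
move=> mA; apply: (@measurable_density_measure _ _ _ _ _ lebesgue_measure
  (fun z : RB * RB => normal_pdf z.1 z.2)) => //.
by move=> z x; exact: normal_pdf_ge0.
Qed.

HB.instance Definition _ := isKernel.Build _ _ _ _ _ normal_kernel
  measurable_normal_kernel.

Let normal_kernel1 z : normal_kernel z setT = 1%E.
Proof. exact: probability_setT. Qed.

HB.instance Definition _ := Kernel_isProbability.Build _ _ _ _ _
  normal_kernel normal_kernel1.

End normal_kernel.

Section tuple_product.
Context (R : realType).
Local Notation RB := (measurableTypeR R).

Definition cons_pt n (z : RB * n.-tuple RB) : n.+1.-tuple RB :=
  [the n.+1.-tuple RB of z.1 :: z.2].

Lemma measurable_cons_pt n : measurable_fun setT (@cons_pt n).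
Proof. exact: measurable_cons. Qed.

(* Product measure of the [mu i].  [m1 \x^ m2] integrates the m1-mass of the
   sections against m2, so that only the factors [mu i] have to be
   sigma-finite; in dimension 0 it is the unit mass on the empty tuple. *)
Fixpoint tuple_prod n : ('I_n -> set RB -> \bar R) -> set (n.-tuple RB) -> \bar R :=
  match n with
  | 0 => fun=> \d_([tuple] : 0.-tuple RB)
  | m.+1 => fun mu => pushforward
      (mu ord0 \x^ tuple_prod (fun i => mu (lift ord0 i)))%E (@cons_pt m)
  end.

Section sigma_finite.
Lemma tuple_prod_measure n (mu : 'I_n -> {sigma_finite_measure set RB -> \bar R}) :
  exists m : {measure set (n.-tuple RB) -> \bar R}, tuple_prod mu = m.
Proof.
elim: n mu => [|n ih] mu /=; first by exists (\d_([tuple] : 0.-tuple RB)).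
have [m ->] := ih (fun i => mu (lift ord0 i)).
pose mf := @measurable_cons_pt n.
by exists (measure_function_pushforward__canonical__measure_function_Measure (mu ord0 \x^ m)%E mf).
Qed.

Context n (mu : 'I_n -> {sigma_finite_measure set RB -> \bar R}).

Let tuple_prod0 : tuple_prod mu set0 = 0%E.
Proof. by have [m ->] := tuple_prod_measure mu; exact: measure0. Qed.

Let tuple_prod_ge0 A : (0 <= tuple_prod mu A)%E.
Proof. by have [m ->] := tuple_prod_measure mu; exact: measure_ge0. Qed.

Let tuple_prod_sigma_additive : semi_sigma_additive (tuple_prod mu).
Proof.
by have [m ->] := tuple_prod_measure mu; exact: measure_semi_sigma_additive.
Qed.

HB.instance Definition _ := isMeasure.Build _ _ _ (tuple_prod mu)
  tuple_prod0 tuple_prod_ge0 tuple_prod_sigma_additive.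

End sigma_finite.

Definition tuple_lebesgue n : {measure set (n.-tuple RB) -> \bar R} :=
  tuple_prod (fun=> lebesgue_measure).

End tuple_product.

Section kernel_constructions.
Context d d' d'' (X : measurableType d) (Y : measurableType d')
  (Z : measurableType d'') (R : realType).

Section reindex.
Variables (k : R.-pker X ~> Y) (f : Z -> X).

Definition kreindex (mf : measurable_fun setT f) : Z -> {measure set Y -> \bar R} :=
  fun z => k (f z).

Hypothesis mf : measurable_fun setT f.

Let measurable_kreindex A : measurable A ->
  measurable_fun setT (kreindex mf ^~ A).
Proof. by move=> mA; exact: (measurableT_comp (measurable_kernel k _ mA)). Qed.

HB.instance Definition _ := isKernel.Build _ _ _ _ _ (kreindex mf)
  measurable_kreindex.

Let kreindex1 z : kreindex mf z setT = 1%E.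
Proof. exact: prob_kernel. Qed.

HB.instance Definition _ := Kernel_isProbability.Build _ _ _ _ _ (kreindex mf)
  kreindex1.

End reindex.

Section image.
Variables (k : R.-pker X ~> Y) (f : X * Y -> Z).

Definition kimage (mf : measurable_fun setT f) (x : X) (A : set Z) : \bar R :=
  k x [set y | A (f (x, y))].

Hypothesis mf : measurable_fun setT f.

Let mfx x : measurable_fun setT (fun y => f (x, y)).
Proof. exact: (measurableT_comp mf (pair1_measurable x)). Qed.

Let kimage0 x : kimage mf x set0 = 0%E.
Proof. by rewrite /kimage [X in k x X](_ : _ = set0) ?measure0. Qed.

Let kimage_ge0 x A : (0 <= kimage mf x A)%E.
Proof. exact: measure_ge0. Qed.

Let kimage_sigma_additive x : semi_sigma_additive (kimage mf x).
Proof.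
pose m := measure_function_pushforward__canonical__measure_function_Measure
  (k x) (mfx x).
exact: (@measure_semi_sigma_additive _ _ _ m).
Qed.

HB.instance Definition _ x := isMeasure.Build _ _ _ (kimage mf x)
  (kimage0 x) (kimage_ge0 x) (@kimage_sigma_additive x).

Definition mkimage : X -> {measure set Z -> \bar R} := kimage mf.

Let measurable_kimage A : measurable A -> measurable_fun setT (mkimage ^~ A).
Proof.
move=> mA; rewrite /mkimage /kimage.
have -> : (fun x => k x [set y | A (f (x, y))]) =
    (fun x => k x (xsection (f @^-1` A) x)).
  by apply/funext => x; rewrite xsectionE.
apply: measurable_fun_xsection_finite_kernel; rewrite inE.
by rewrite -[X in measurable X]setTI; exact: mf.
Qed.

HB.instance Definition _ := isKernel.Build _ _ _ _ _ mkimage measurable_kimage.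

Let kimage1 x : mkimage x setT = 1%E.
Proof. exact: prob_kernel. Qed.

HB.instance Definition _ := Kernel_isProbability.Build _ _ _ _ _ mkimage
  kimage1.

End image.
End kernel_constructions.

Section kernel_composition.
Context d d' d'' (X : measurableType d) (Y : measurableType d')
  (Z : measurableType d'') (R : realType).

Section dependent.
Variables (l : R.-pker X ~> Y) (k : R.-pker (X * Y) ~> Z).

Definition pkcomp : X -> {measure set Z -> \bar R} := (l \; k)%E.

Let measurable_pkcomp A : measurable A -> measurable_fun setT (pkcomp ^~ A).
Proof. by move=> mA; exact: (@measurable_fun_mkcomp_sfinite _ _ _ _ _ _ _ l k). Qed.

HB.instance Definition _ := isKernel.Build _ _ _ _ _ pkcomp measurable_pkcomp.

Let pkcomp1 x : pkcomp x setT = 1%E.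
Proof.
rewrite /pkcomp/= /kcomp.
under eq_integral do rewrite prob_kernel.
by rewrite integral_cst// mul1e prob_kernel.
Qed.

HB.instance Definition _ := Kernel_isProbability.Build _ _ _ _ _ pkcomp pkcomp1.

End dependent.
End kernel_composition.

Section tuple_prod_kernel.
Context (R : realType) d (X : measurableType d).
Local Notation RB := (measurableTypeR R).

Lemma tuple_prod_kernel n (k : 'I_n -> R.-pker X ~> RB) :
  exists K : R.-pker X ~> n.-tuple RB,
    forall x, tuple_prod (fun i => k i x) = K x.
Proof.
elim: n k => [|n ih] k /=.
  by exists (kdirac (measurable_cst ([tuple] : 0.-tuple RB))).
have [K KE] := ih (fun i => k (lift ord0 i)).
have mc : measurable_fun setT
    (fun z : (X * n.-tuple RB) * RB => cons_pt (z.2, z.1.2)).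
  apply: (measurableT_comp (@measurable_cons_pt R n)).
  apply: measurable_fun_pair; first exact: measurable_snd.
  by apply: (measurableT_comp measurable_snd); exact: measurable_fst.
have mfst : measurable_fun setT (fst : X * n.-tuple RB -> X).
  exact: measurable_fst.
exists (pkcomp K (mkimage (kreindex (k ord0) mfst) mc)) => x.
apply/funext => A; rewrite KE /pkcomp/= /kcomp /pushforward /product_measure2.
apply: eq_integral => t _ /=.
by rewrite ysectionE.
Qed.

End tuple_prod_kernel.

Section random_effects_model.
Context (R : realType) (a1 a2 b1 b2 : R) (p r : nat) (y : 'M[R]_(p, r)).
Local Notation RB := (measurableTypeR R).

(* states are indexed from 0: [intercept eta] is eta_0, and [effect eta i]
   is the coordinate eta_(i+1) attached to the row [i] of [y] *)
Definition intercept (eta : p.+1.-tuple RB) : R := tnth eta ord0.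
Definition effect (eta : p.+1.-tuple RB) (i : 'I_p) : R :=
  tnth eta (lift ord0 i).

Definition row_mean (i : 'I_p) : R := r%:R^-1 * \sum_(j < r) y i j.
Definition grand_mean : R :=
  (r * p)%:R^-1 * \sum_(i < p) \sum_(j < r) y i j.

Definition effect_sqr (eta : p.+1.-tuple RB) : R :=
  \sum_(i < p) effect eta i ^+ 2.
Definition residual_sqr (eta : p.+1.-tuple RB) : R :=
  \sum_(i < p) \sum_(j < r)
    (y i j - intercept eta / Num.sqrt p%:R - effect eta i) ^+ 2.

(* Unnormalized posterior density in (lambda_theta, lambda_e, eta); eta_0 has a
   flat (improper) prior, hence no prior factor of its own. *)
Definition posterior_fun (z : RB * (RB * p.+1.-tuple RB)) : R :=
  let lt : R := z.1 in let le : R := z.2.1 in let eta := z.2.2 in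
  if (0 < lt) && (0 < le) then
    le `^ ((r * p)%:R / 2) * expR (- (le / 2) * residual_sqr eta) *
    (lt `^ (p%:R / 2) * expR (- (lt / 2) * effect_sqr eta)) *
    (lt `^ (a1 - 1) * expR (- b1 * lt)) *
    (le `^ (a2 - 1) * expR (- b2 * le))
  else 0.

Lemma posterior_fun_ge0 z : 0 <= posterior_fun z.
Proof.
rewrite /posterior_fun; case: ifP => // _.
by rewrite !mulr_ge0// ?powR_ge0 ?expR_ge0.
Qed.

Lemma measurable_intercept : measurable_fun setT intercept.
Proof. exact: measurable_tnth. Qed.

Lemma measurable_effect i : measurable_fun setT (effect ^~ i).
Proof. exact: measurable_tnth. Qed.

Lemma measurable_effect_sqr : measurable_fun setT effect_sqr.
Proof.
apply: measurable_sum => i; apply: measurable_funX; exact: measurable_effect.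
Qed.

Lemma measurable_residual_sqr : measurable_fun setT residual_sqr.
Proof.
apply: measurable_sum => i; apply: measurable_sum => j.
apply: measurable_funX; apply: measurable_funB; last exact: measurable_effect.
apply: measurable_funB => //; apply: measurable_funM => //.
exact: measurable_intercept.
Qed.

Lemma measurable_posterior_fun : measurable_fun setT posterior_fun.
Proof.
pose T := (RB * (RB * p.+1.-tuple RB))%type.
have mlt : measurable_fun setT (fun z : T => z.1 : R) by exact: measurable_fst.
have mle : measurable_fun setT (fun z : T => z.2.1 : R).
  by apply: (measurableT_comp measurable_fst); exact: measurable_snd.
have meta : measurable_fun setT (fun z : T => z.2.2).
  by apply: (measurableT_comp measurable_snd); exact: measurable_snd.
apply: measurable_fun_ifT => //.
  by apply: measurable_and; apply: measurable_fun_ltr.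
repeat (apply: measurable_funM).
- exact: (measurableT_comp (measurable_powR _) mle).
- apply: measurableT_comp => //; apply: measurable_funM.
    by apply: measurable_funN; apply: measurable_funM.
  exact: (measurableT_comp measurable_residual_sqr meta).
- exact: (measurableT_comp (measurable_powR _) mlt).
- apply: measurableT_comp => //; apply: measurable_funM.
    by apply: measurable_funN; apply: measurable_funM.
  exact: (measurableT_comp measurable_effect_sqr meta).
- exact: (measurableT_comp (measurable_powR _) mlt).
- by apply: measurableT_comp => //; apply: measurable_funM.
- exact: (measurableT_comp (measurable_powR _) mle).
- by apply: measurableT_comp => //; apply: measurable_funM.
Qed.

Definition posterior_weight : set (RB * (RB * p.+1.-tuple RB)) -> \bar R :=
  density_measure
    (lebesgue_measure \x^ (lebesgue_measure \x^ tuple_lebesgue R p.+1))%E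
    posterior_fun.

Let posterior_weight0 : posterior_weight set0 = 0%E.
Proof. exact: density_measure0. Qed.

Let posterior_weight_ge0 A : (0 <= posterior_weight A)%E.
Proof. by apply: density_measure_ge0; exact: posterior_fun_ge0. Qed.

Let posterior_weight_sigma_additive : semi_sigma_additive posterior_weight.
Proof.
apply: density_measure_sigma_additive; first exact: posterior_fun_ge0.
exact: measurable_posterior_fun.
Qed.

HB.instance Definition _ := isMeasure.Build _ _ _ posterior_weight
  posterior_weight0 posterior_weight_ge0 posterior_weight_sigma_additive.

(* as for [gamma_prob], the Dirac mass is only used when the total mass is 0
   or infinite, i.e. never when the posterior is proper *)
Definition posterior :
    probability (RB * (RB * p.+1.-tuple RB))%type R :=
  mnormalize posterior_weight
    (\d_((0, (0, [tuple of nseq p.+1 0])) : RB * (RB * p.+1.-tuple RB))).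

Definition eta_posterior : set (p.+1.-tuple RB) -> \bar R :=
  pushforward posterior (fun z => z.2.2).

Let measurable_eta_proj :
  measurable_fun setT (fun z : RB * (RB * p.+1.-tuple RB) => z.2.2).
Proof.
by apply: (measurableT_comp measurable_snd); exact: measurable_snd.
Qed.

Let eta_posterior0 : eta_posterior set0 = 0%E.
Proof. by rewrite /eta_posterior /pushforward preimage_set0 measure0. Qed.

Let eta_posterior_ge0 A : (0 <= eta_posterior A)%E.
Proof. exact: measure_ge0. Qed.

Let eta_posterior_sigma_additive : semi_sigma_additive eta_posterior.
Proof.
exact: (@measure_semi_sigma_additive _ _ _
  (measure_function_pushforward__canonical__measure_function_Measure
    posterior measurable_eta_proj)).
Qed.

HB.instance Definition _ := isMeasure.Build _ _ _ eta_posterior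
  eta_posterior0 eta_posterior_ge0 eta_posterior_sigma_additive.

Let eta_posterior1 : eta_posterior setT = 1%E.
Proof. exact: probability_setT. Qed.

HB.instance Definition _ := Measure_isProbability.Build _ _ _ eta_posterior
  eta_posterior1.

Definition theta_rate eta : R := b1 + effect_sqr eta / 2.
Definition e_rate eta : R := b2 + residual_sqr eta / 2.

(* [normal_prob] takes a standard deviation, whence the square roots *)
Definition intercept_mean : R := Num.sqrt p%:R * grand_mean.
Definition intercept_sd (lt le : R) : R :=
  Num.sqrt ((lt + r%:R * le) / (r%:R * le * lt)).
Definition effect_mean (lt le eta0 : R) (i : 'I_p) : R :=
  r%:R * le * (row_mean i - eta0 / Num.sqrt p%:R) / (lt + r%:R * le).
Definition effect_sd (lt le : R) : R := Num.sqrt (1 / (lt + r%:R * le)).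

Definition gibbs (eta : p.+1.-tuple RB) (A : set (p.+1.-tuple RB)) : \bar R :=
  (\int[gamma_prob (p%:R / 2 + a1) (theta_rate eta)]_lt
   \int[gamma_prob ((r * p)%:R / 2 + a2) (e_rate eta)]_le
   \int[normal_prob intercept_mean (intercept_sd lt le)]_eta0
     tuple_prod
       (fun i => normal_prob (effect_mean lt le eta0 i) (effect_sd lt le))
       [set t | A (cons_pt (eta0, t))])%E.

Lemma gibbs_pkernel : exists K : R.-pker p.+1.-tuple RB ~> p.+1.-tuple RB,
  forall eta, gibbs eta = K eta.
Proof.
pose T := p.+1.-tuple RB; pose W := (T * RB * RB * RB)%type.
have mt : measurable_fun setT (theta_rate : T -> RB).
  by apply: measurable_funD => //; apply: measurable_funM => //;
    exact: measurable_effect_sqr.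
have me : measurable_fun setT (fun z : T * RB => e_rate z.1 : RB).
  apply: (@measurableT_comp _ _ _ _ _ _ (e_rate : T -> RB)) => //.
  by apply: measurable_funD => //; apply: measurable_funM => //;
    exact: measurable_residual_sqr.
have mi : measurable_fun setT (fun z : T * RB * RB =>
    (intercept_mean : RB, intercept_sd z.1.2 z.2 : RB)).
  have mlt : measurable_fun setT (fun z : T * RB * RB => z.1.2 : R).
    by apply: (measurableT_comp measurable_snd); exact: measurable_fst.
  have mle : measurable_fun setT (fun z : T * RB * RB => z.2 : R).
    exact: measurable_snd.
  apply: measurable_fun_pair => //.
  apply: (measurableT_comp (@measurable_sqrtr R)); apply: measurable_funM.
    by apply: measurable_funD => //; apply: measurable_funM.
  apply: (measurableT_comp (@measurable_invr R)).
  by apply: measurable_funM => //; apply: measurable_funM.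
have mf i : measurable_fun setT (fun z : W =>
    (effect_mean z.1.1.2 z.1.2 z.2 i : RB, effect_sd z.1.1.2 z.1.2 : RB)).
  have mlt : measurable_fun setT (fun z : W => z.1.1.2 : R).
    apply: (measurableT_comp measurable_snd).
    by apply: (measurableT_comp measurable_fst); exact: measurable_fst.
  have mle : measurable_fun setT (fun z : W => z.1.2 : R).
    by apply: (measurableT_comp measurable_snd); exact: measurable_fst.
  have m0 : measurable_fun setT (fun z : W => z.2 : R).
    exact: measurable_snd.
  have mD : measurable_fun setT (fun z : W => z.1.1.2 + r%:R * z.1.2 : R).
    by apply: measurable_funD => //; apply: measurable_funM.
  have mV : measurable_fun setT (fun z : W => (z.1.1.2 + r%:R * z.1.2 : R)^-1).
    exact: (measurableT_comp (@measurable_invr R)).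
  apply: measurable_fun_pair.
    apply: measurable_funM => //; apply: measurable_funM.
      exact: measurable_funM.
    by apply: measurable_funB => //; exact: measurable_funM.
  by apply: (measurableT_comp (@measurable_sqrtr R)); exact: measurable_funM.
have [Kt KtE] := tuple_prod_kernel
  (fun i => kreindex (@normal_kernel R) (mf i)).
have mc : measurable_fun setT (fun z : W * p.-tuple RB => cons_pt (z.1.2, z.2)).
  apply: (measurableT_comp (@measurable_cons_pt R p)).
  apply: measurable_fun_pair; last exact: measurable_snd.
  by apply: (measurableT_comp measurable_snd); exact: measurable_fst.
exists (pkcomp (kreindex (gamma_kernel (p%:R / 2 + a1)) mt)
  (pkcomp (kreindex (gamma_kernel ((r * p)%:R / 2 + a2)) me)
    (pkcomp (kreindex (@normal_kernel R) mi) (mkimage Kt mc)))) => eta.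
apply/funext => A; rewrite /gibbs.
apply: eq_integral => lt _; apply: eq_integral => le _.
apply: eq_integral => e0 _.
by rewrite /mkimage/= /kimage -KtE.
Qed.

Let gibbs0 eta : gibbs eta set0 = 0%E.
Proof. by have [K ->] := gibbs_pkernel; exact: measure0. Qed.

Let gibbs_ge0 eta A : (0 <= gibbs eta A)%E.
Proof. by have [K ->] := gibbs_pkernel; exact: measure_ge0. Qed.

Let gibbs_sigma_additive eta : semi_sigma_additive (gibbs eta).
Proof. by have [K ->] := gibbs_pkernel; exact: measure_semi_sigma_additive. Qed.

HB.instance Definition _ eta := isMeasure.Build _ _ _ (gibbs eta)
  (gibbs0 eta) (gibbs_ge0 eta) (@gibbs_sigma_additive eta).

Definition gibbs_kernel : p.+1.-tuple RB -> {measure set (p.+1.-tuple RB) -> \bar R} :=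
  gibbs.

Let measurable_gibbs A : measurable A ->
  measurable_fun setT (gibbs_kernel ^~ A).
Proof.
move=> mA; have [K KE] := gibbs_pkernel.
have -> : gibbs_kernel ^~ A = K ^~ A.
  by apply/funext => eta; rewrite /gibbs_kernel/= KE.
exact: measurable_kernel.
Qed.

HB.instance Definition _ := isKernel.Build _ _ _ _ _ gibbs_kernel
  measurable_gibbs.

Let gibbs1 eta : gibbs_kernel eta setT = 1%E.
Proof.
by have [K KE] := gibbs_pkernel; rewrite /gibbs_kernel/= KE prob_kernel.
Qed.

HB.instance Definition _ := Kernel_isProbability.Build _ _ _ _ _ gibbs_kernel
  gibbs1.

End random_effects_model.

Section markov.
Context d (T : measurableType d) (R : realType).

Fixpoint kiter (K : R.-spker T ~> T) (m : nat) : R.-spker T ~> T :=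
  match m with
  | 0 => kdirac (@measurable_id _ T setT)
  | n.+1 => mkcomp_noparam K (kiter K n)
  end.

Definition coupling (mu nu : {measure set T -> \bar R}) :
    set (probability (T * T)%type R) :=
  [set u | forall A, measurable A ->
    pushforward u fst A = mu A /\ pushforward u snd A = nu A].

Definition wasserstein (psi : T -> T -> R) (mu nu : {measure set T -> \bar R}) :
    \bar R :=
  ereal_inf [set (\int[u]_z (psi z.1 z.2)%:E)%E | u in coupling mu nu].

End markov.

Definition euclidean_dist (R : realType) n (x y : n.-tuple (measurableTypeR R)) : R :=
  Num.sqrt (\sum_(i < n) ((tnth x i : R) - tnth y i) ^+ 2).

(* Main.v *)
Require Import Defs.
From HB Require Import structures.
From mathcomp Require Import all_boot all_order all_algebra.
From mathcomp Require Import all_classical all_reals all_analysis.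
From mathcomp Require Import measurable_realfun ring lra.
Import Order.TTheory GRing.Theory Num.Theory.
Import numFieldNormedType.Exports.
Set Implicit Arguments.
Unset Strict Implicit.
Unset Printing Implicit Defensive.
Local Open Scope classical_set_scope.
Local Open Scope ring_scope.

(** Two copies of the chain are driven by the same randomness, and the distance
    between them is weighted by a Lyapunov function.

    A step from [eta] is a function [gibbs_map eta w] of a noise [w], made of two
    gamma variables of rate [1] and of [p + 1] standard normal variables, whose
    law does not depend on [eta] ([gibbs_noiseE]).  The state enters this function
    through two standard deviations only, that of an effect and that of a row mean
    given its effect.  These are norms of affine functions of the state, up to
    factors that belong to the noise, and hence Lipschitz.  So one step multiplies
    the squared distance by at most a random factor ([gibbs_map_dist_le]).  Its
    mean is always [O(p)], and it is [O(p G ^ 2 / r ^ 2 + p / r + 1 / p)], where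
    [G] has the order of [p] plus the Lyapunov functions of the two states: when
    every group has many observations, the new effects are nearly the centred
    group means, whatever the old state was.

    That factor is small except in the tail of [V eta], the squared distance from
    [eta] to the least squares fit ([lyapunov]).  In that tail [V] itself is
    multiplied by [O(1 / p)] ([gibbs_map_lyapunov_le]).  The two facts combine in
    the cost [sqrt (dist * (V + V' + p))], which dominates the Euclidean distance:
    by the inequality between geometric and arithmetic means, its expectation after
    one step is at most [rho] times its value before, with
    [rho ^ 4 = C (p ^ 3 / r ^ 2 + p / r + 1 / p)] ([gibbs_map_cost_le],
    [contraction_constants]).  This tends to [0] by the assumption on the sample
    sizes ([rate_cvg0]).

    Running the coupled pair from [eta] and a draw of the stationary law bounds the
    Wasserstein distance after [m] steps by [rho ^ m] times the stationary mean of
    the cost ([wasserstein_kiter_le]).  This mean is at most [V eta + p] plus the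
    stationary mean of [V], which is [O(p)] because one step maps [V] to at most
    [V / 2 + O(p)] on average ([stationary_moment_le], [lyapunov_mean_drift]).

    The stationary law is the state marginal of the posterior: each half of the
    sampler redraws one block of variables from its conditional law
    ([eta_posterior_stationary]).  The posterior is proper because, once the state
    is integrated out, its density in the two precisions is dominated by a product
    of gamma densities ([posterior_weight_lty]). *)

(** * Coupling a Markov chain with its stationary law *)

Lemma probability_of_mass1 d (T : measurableType d) (R : realType)
    (m : {measure set T -> \bar R}) : m setT = 1%E ->
  exists P : probability T R, forall A, P A = m A.
Proof.
move=> m1; exists (mnormalize m \d_point) => A.
transitivity (m A * (fine (m setT))^-1%:E)%E; last by rewrite m1/= invr1 mule1.
by rewrite -[LHS]/(mnormalize m \d_point A) /mnormalize m1 onee_eq0.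
Qed.

Section coupling.
Context d (T : measurableType d) (R : realType).
Local Open Scope ereal_scope.

Lemma ge0_integral_kcomp_noparam d1 d2 (X : measurableType d1)
    (Y : measurableType d2) (k1 : R.-spker X ~> Y) (k2 : R.-spker Y ~> T) (x : X)
    (f : T -> \bar R) :
  (forall z, 0 <= f z) -> measurable_fun setT f ->
  \int[mkcomp_noparam k1 k2 x]_z f z = \int[k1 x]_y \int[k2 y]_z f z.
Proof.
move=> f0 mf.
by rewrite -(@integral_kcomp _ _ _ _ _ _ _ k1 (@kernel.kernel_snd _ _ _ X Y T R k2)).
Qed.

Definition kconst d1 (X : measurableType d1) (P : probability T R) :
  X -> {measure set T -> \bar R} := fun=> P.

Section kconst_kernel.
Context d1 (X : measurableType d1) (P : probability T R).

Let measurable_kconst A : measurable A ->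
  measurable_fun setT ((@kconst _ X P) ^~ A).
Proof. by move=> mA; exact: measurable_cst. Qed.

HB.instance Definition _ := isKernel.Build _ _ _ _ _ (@kconst _ X P)
  measurable_kconst.

Let kconst1 x : @kconst _ X P x setT = 1.
Proof. exact: probability_setT. Qed.

HB.instance Definition _ := Kernel_isProbability.Build _ _ _ _ _
  (@kconst _ X P) kconst1.

End kconst_kernel.
End coupling.

Section image_of_law.
Context d d1 d2 (X : measurableType d1) (Y : measurableType d2)
  (T : measurableType d) (R : realType) (P : probability Y R) (f : X * Y -> T)
  (mf : measurable_fun setT f).
Local Open Scope ereal_scope.

Lemma ge0_integral_mkimage (x : X) (g : T -> \bar R) :
  (forall z, 0 <= g z) -> measurable_fun setT g ->
  \int[mkimage (@kconst _ Y R _ X P) mf x]_z g z = \int[P]_y g (f (x, y)).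
Proof.
move=> g0 mg.
have mfx : measurable_fun setT (fun y => f (x, y)).
  exact: (measurableT_comp mf (pair1_measurable x)).
rewrite -[RHS](ge0_integral_pushforward mfx P measurableT)//.
Qed.

End image_of_law.

(** [Q] is a coupling of two steps of [K], under which the mean of the cost [c]
    decreases by the factor [rho]. *)
Section wasserstein_contraction.
Context d (T : measurableType d) (R : realType).
Variables (K : R.-pker T ~> T) (Q : R.-pker (T * T)%type ~> (T * T)%type).
Variables (psi c : T -> T -> R) (rho : R) (Pi : probability T R).
Local Open Scope ereal_scope.

Hypothesis mpsi : measurable_fun setT (fun z : T * T => psi z.1 z.2).
Hypothesis mc : measurable_fun setT (fun z : T * T => c z.1 z.2).
Hypothesis psi_ge0 : forall x y, (0 <= psi x y)%R.
Hypothesis psi_le : forall x y, (psi x y <= c x y)%R.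
Hypothesis rho_ge0 : (0 <= rho)%R.
Hypothesis Q_fst : forall z A, measurable A -> Q z (fst @^-1` A) = K z.1 A.
Hypothesis Q_snd : forall z A, measurable A -> Q z (snd @^-1` A) = K z.2 A.
Hypothesis Q_contract : forall z,
  \int[Q z]_z' (c z'.1 z'.2)%:E <= (rho * c z.1 z.2)%:E.
Hypothesis Pi_stationary : forall A, measurable A ->
  \int[Pi]_y K y A = Pi A.

Let c_ge0 x y : (0 <= c x y)%R.
Proof. exact: le_trans (psi_le x y). Qed.

Lemma kiter_marginal (f : T * T -> T) : measurable_fun setT f ->
  (forall z A, measurable A -> Q z (f @^-1` A) = K (f z) A) ->
  forall m z A, measurable A -> kiter Q m z (f @^-1` A) = kiter K m (f z) A.
Proof.
move=> mf QK; elim=> [|m ih] z A mA; first by [].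
have mfA B : measurable B -> measurable (f @^-1` B).
  by move=> mB; rewrite -[X in measurable X]setTI; exact: mf.
transitivity (\int[Q z]_z' kiter Q m z' (f @^-1` A)); first by [].
under eq_integral do rewrite ih//.
transitivity (\int[K (f z)]_y kiter K m y A); last by [].
have mk : measurable_fun setT (fun y => kiter K m y A).
  exact: measurable_kernel.
transitivity (\int[pushforward (Q z) f]_y kiter K m y A).
  by rewrite (ge0_integral_pushforward mf).
apply: eq_measure_integral => B mB _.
exact: QK.
Qed.

Lemma kiter_setT m z : kiter Q m z setT = 1.
Proof.
elim: m z => [z|m ih z]; first by rewrite /= /kdirac diracT.
transitivity (\int[Q z]_z' kiter Q m z' setT); first by [].
under eq_integral do rewrite ih.
by rewrite integral_cst// mul1e prob_kernel.
Qed.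

Lemma kiter_contract m z :
  \int[kiter Q m z]_z' (c z'.1 z'.2)%:E <= (rho ^+ m * c z.1 z.2)%:E.
Proof.
have mcE : measurable_fun setT (fun z : T * T => (c z.1 z.2)%:E).
  exact/measurable_EFinP.
elim: m z => [z|m ih z].
  rewrite /= /kdirac integral_dirac//= diracT mul1e.
  by rewrite expr0 mul1r.
rewrite ge0_integral_kcomp_noparam//; last by move=> z'; rewrite lee_fin.
apply: (@le_trans _ _ (\int[Q z]_z' ((rho ^+ m)%:E * (c z'.1 z'.2)%:E))).
  apply: ge0_le_integral => //.
  - by move=> z' _; apply: integral_ge0 => z'' _; rewrite lee_fin.
  - apply: (measurable_fun_integral_kernel (measurable_kernel (kiter Q m))) => //.
    by move=> z'; rewrite lee_fin.
  - by apply: measurable_funeM.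
rewrite ge0_integralZl//; last 2 first.
  by move=> z' _; rewrite lee_fin.
  by rewrite lee_fin exprn_ge0.
rewrite exprSr -mulrA EFinM lee_wpmul2l// lee_fin exprn_ge0//.
Qed.

Lemma kiter_stationary m A : measurable A -> \int[Pi]_y kiter K m y A = Pi A.
Proof.
elim: m A => [|m ih] A mA.
  by rewrite /= /kdirac/= /dirac integral_indic// setIT.
rewrite -[RHS]ih//.
transitivity (\int[Pi]_y \int[K y]_x kiter K m x A); first by [].
have mk : measurable_fun setT (fun y => kiter K m y A).
  exact: measurable_kernel.
pose k0 : R.-pker unit ~> T := @kconst _ T R _ unit Pi.
transitivity (\int[mkcomp_noparam k0 K tt]_x kiter K m x A).
  by rewrite ge0_integral_kcomp_noparam.
by apply: eq_measure_integral => B mB _; exact: Pi_stationary.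
Qed.

(** Iterating [Q] from the product of the point mass at [x] and of [Pi] gives a
    coupling of the law after [m] steps with [Pi], because the second component
    starts in the stationary law and stays there. *)
Lemma wasserstein_kiter_le x m :
  wasserstein psi (kiter K m x) Pi <= (rho ^+ m)%:E * \int[Pi]_y (c x y)%:E.
Proof.
have mid : measurable_fun setT (fun z : T * T => z) by exact: measurable_id.
pose S : R.-pker T ~> (T * T)%type := mkimage (@kconst _ T R _ T Pi) mid.
have mcE : measurable_fun setT (fun z : T * T => (c z.1 z.2)%:E).
  exact/measurable_EFinP.
pose u := mkcomp_noparam S (kiter Q m) x.
have uE (f : T * T -> \bar R) : (forall z, 0 <= f z) -> measurable_fun setT f ->
    \int[u]_z f z = \int[Pi]_y \int[kiter Q m (x, y)]_z f z.
  move=> f0 mf; rewrite ge0_integral_kcomp_noparam// ge0_integral_mkimage//.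
    by move=> z; apply: integral_ge0.
  exact: (measurable_fun_integral_kernel (measurable_kernel (kiter Q m))).
have uA A : measurable A -> u A = \int[Pi]_y kiter Q m (x, y) A.
  move=> mA; rewrite -[LHS]/(\int[S x]_z kiter Q m z A) ge0_integral_mkimage//.
  exact: measurable_kernel.
have u1 : u setT = 1.
  rewrite uA//; under eq_integral do rewrite kiter_setT.
  by rewrite integral_cst//= mul1e -[RHS](@probability_setT _ _ _ Pi).
have [P PE] := probability_of_mass1 u1.
apply: (@le_trans _ _ (\int[P]_z (psi z.1 z.2)%:E)).
  apply: ereal_inf_lbound; exists P => // A mA; split.
    rewrite -[LHS]/(P _) PE uA; last first.
      by rewrite -[X in measurable X]setTI; exact: measurable_fst.
    under eq_integral do rewrite (@kiter_marginal fst)//.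
    rewrite /= integral_cst//= -[RHS]mule1; congr (_ * _).
    exact: probability_setT.
  rewrite -[LHS]/(P _) PE uA; last first.
    by rewrite -[X in measurable X]setTI; exact: measurable_snd.
  under eq_integral do rewrite (@kiter_marginal snd)//.
  exact: kiter_stationary.
rewrite (_ : \int[P]_z (psi z.1 z.2)%:E = \int[u]_z (psi z.1 z.2)%:E); last first.
  by apply: eq_measure_integral => B _ _; exact: PE.
apply: (@le_trans _ _ (\int[u]_z (c z.1 z.2)%:E)).
  apply: ge0_le_integral => //.
  - by move=> z _; rewrite lee_fin.
  - exact/measurable_EFinP.
  - by move=> z _; rewrite lee_fin.
rewrite uE//; last by move=> z; rewrite lee_fin.
rewrite -ge0_integralZl//; last 3 first.
  exact: (measurableT_comp mcE (pair1_measurable x)).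
  by move=> y _; rewrite lee_fin.
  by rewrite lee_fin exprn_ge0.
apply: ge0_le_integral => //.
- by move=> y _; apply: integral_ge0 => z _; rewrite lee_fin.
- have := measurable_fun_integral_kernel (measurable_kernel (kiter Q m)) _ mcE.
  move=> /(_ (fun z => _)) h.
  apply: (measurableT_comp (h _) (pair1_measurable x)).
  by move=> z; rewrite lee_fin.
- apply: measurable_funeM; exact: (measurableT_comp mcE (pair1_measurable x)).
- by move=> y _; rewrite -EFinM; exact: kiter_contract.
Qed.

End wasserstein_contraction.

(** * Densities, product measures and affine changes of variable *)

Section integral_density.
Context d (T : measurableType d) (R : realType).
Variables (mu nu : {measure set T -> \bar R}) (f : T -> R).
Local Open Scope ereal_scope.
Import HBNNSimple.

Hypothesis f0 : forall x, (0 <= f x)%R.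
Hypothesis mf : measurable_fun setT f.
Hypothesis nuE : forall A, measurable A -> nu A = \int[mu]_(x in A) (f x)%:E.

(** Both sides agree on simple functions and are continuous along the increasing
    sequence of simple functions that approximates [g]. *)
Lemma ge0_integral_density (g : T -> \bar R) :
  (forall x, 0 <= g x) -> measurable_fun setT g ->
  \int[nu]_x g x = \int[mu]_x (g x * (f x)%:E).
Proof.
move=> g0 mg; pose g_ := nnsfun_approx measurableT mg.
have mfE : measurable_fun setT (fun x => (f x)%:E) by exact/measurable_EFinP.
have mgE n : measurable_fun setT (fun x => (g_ n x)%:E).
  exact/measurable_EFinP.
have indicE (r : R) n : \int[mu]_x ((r * \1_(g_ n @^-1` [set r]) x)%:E * (f x)%:E) =
    r%:E * nu (g_ n @^-1` [set r]).
  have [r0|r0] := ltP r 0%R.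
    rewrite preimage_nnfun0// measure0 mule0.
    by apply: integral0_eq => x _; rewrite indic0 mulr0 mul0e.
  under eq_integral do rewrite EFinM -muleA.
  rewrite ge0_integralZl//=.
  - congr (_ * _); rewrite nuE// [RHS]integral_mkcond.
    apply: eq_integral => x _; rewrite patchE indicE.
    by case: ifPn; rewrite ?mul1e ?mul0e.
  - by apply: emeasurable_funM => //; exact/measurable_EFinP.
  - by move=> x _; rewrite mule_ge0// lee_fin.
transitivity (limn (fun n => \int[nu]_x (g_ n x)%:E)).
  rewrite -monotone_convergence//.
  - by apply: eq_integral => x _; apply/esym/cvg_lim => //; exact: cvg_nnsfun_approx.
  - by move=> n x _; rewrite lee_fin.
  - by move=> x _ m n mn; rewrite lee_fin; exact/lefP/nd_nnsfun_approx.
transitivity (limn (fun n => \int[mu]_x ((g_ n x)%:E * (f x)%:E))).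
  congr (limn _); apply/funext => n.
  under eq_integral do rewrite fimfunE -fsumEFin//.
  rewrite ge0_integral_fsum//; last 2 first.
  - by move=> r; exact/measurable_EFinP/measurable_funM.
  - by move=> r x _; rewrite EFinM nnfun_muleindic_ge0.
  transitivity (\sum_(r \in range (g_ n)) r%:E * nu (g_ n @^-1` [set r])).
    apply: eq_fsbigr => r _.
    rewrite (integralZl_indic _ (fun r => g_ n @^-1` [set r]))//; last first.
      by move=> r0; rewrite preimage_nnfun0.
    by rewrite integral_indic// setIT.
  under eq_fsbigr do rewrite -indicE.
  rewrite -ge0_integral_fsum//.
  - apply: eq_integral => x _; rewrite [in RHS]fimfunE -fsumEFin//.
    by rewrite ge0_mule_fsuml// => r; exact: nnfun_muleindic_ge0.
  - move=> r; apply: emeasurable_funM => //.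
    exact/measurable_EFinP/measurable_funM.
  - move=> r x _; apply: mule_ge0; last by rewrite lee_fin.
    by rewrite EFinM nnfun_muleindic_ge0.
rewrite -monotone_convergence//.
- apply: eq_integral => x _; apply/cvg_lim => //.
  by apply: cvgeZr => //; exact: cvg_nnsfun_approx.
- by move=> n; exact: emeasurable_funM.
- by move=> n x _; rewrite mule_ge0// lee_fin.
- move=> x _ m n mn; rewrite lee_wpmul2r// lee_fin//.
  exact/lefP/nd_nnsfun_approx.
Qed.

End integral_density.

Lemma mnormalizeE d (T : measurableType d) (R : realType)
    (mu : {measure set T -> \bar R}) (P : probability T R) (c : R) A :
  mu setT = c%:E -> 0 < c -> mnormalize mu P A = ((c^-1)%:E * mu A)%E.
Proof.
by move=> muT c0; rewrite /mnormalize muT eqe gt_eqF//= muleC.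
Qed.

Lemma integral_indic_setT d (T : measurableType d) (R : realType)
    (mu : {measure set T -> \bar R}) (A : set T) : measurable A ->
  (\int[mu]_x (\1_A x : R)%:E = mu A)%E.
Proof. by move=> mA; rewrite integral_indic// setIT. Qed.

Section product_integral.
Context d1 d2 (T1 : measurableType d1) (T2 : measurableType d2) (R : realType).
Variables (m1 : {sigma_finite_measure set T1 -> \bar R})
  (m2 : {sigma_finite_measure set T2 -> \bar R}).
Local Open Scope ereal_scope.

Lemma product_measure21 A : measurable A -> (m1 \x^ m2) A = (m1 \x m2) A.
Proof.
move=> mA; apply/esym/product_measure_unique => // B C mB mC /=.
by rewrite product_measure2E.
Qed.

Lemma ge0_integral_product_measure2 (f : T1 * T2 -> \bar R) :
  (forall z, 0 <= f z) -> measurable_fun setT f ->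
  \int[m1 \x^ m2]_z f z = \int[m2]_y \int[m1]_x f (x, y).
Proof.
move=> f0 mf; rewrite -fubini_tonelli2//.
by apply: eq_measure_integral => A mA _; exact: product_measure21.
Qed.

Lemma product_measure2_sigma_finite : sigma_finite setT (m1 \x^ m2).
Proof.
have /sigma_finiteP[F [TF ndF Foo]] := sigma_finiteT m1.
have /sigma_finiteP[G [TG ndG Goo]] := sigma_finiteT m2.
exists (fun n => F n `*` G n) => [|n]; last first.
  have [mF Fy] := Foo n; have [mG Gy] := Goo n; split; first exact: measurableX.
  by rewrite /= product_measure2E// lte_mul_pinfty// ge0_fin_numE.
apply/esym; rewrite -subTset => -[x y] _.
have [i _ Fx] : (\bigcup_i F i) x by rewrite -TF.
have [j _ Gy] : (\bigcup_i G i) y by rewrite -TG.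
exists (maxn i j) => //; split.
  by move: x Fx; exact/subsetPset/ndF/leq_maxl.
by move: y Gy; exact/subsetPset/ndG/leq_maxr.
Qed.

(** A name of its own lets the product carry its sigma-finiteness, so that it can
    be a factor of a further product. *)
Definition product2 : set (T1 * T2)%type -> \bar R := m1 \x^ m2.

HB.instance Definition _ := Measure.copy product2 (m1 \x^ m2).

HB.instance Definition _ := Measure_isSigmaFinite.Build _ _ _ product2
  product_measure2_sigma_finite.

Lemma ge0_integral_product2 (f : T1 * T2 -> \bar R) :
  (forall z, 0 <= f z) -> measurable_fun setT f ->
  \int[product2]_z f z = \int[m2]_y \int[m1]_x f (x, y).
Proof. exact: ge0_integral_product_measure2. Qed.

Lemma ge0_integral_product2C (f : T1 * T2 -> \bar R) :
  (forall z, 0 <= f z) -> measurable_fun setT f ->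
  \int[product2]_z f z = \int[m1]_x \int[m2]_y f (x, y).
Proof.
move=> f0 mf; apply: (etrans (ge0_integral_product_measure2 f0 mf)).
by apply/esym; exact: (@fubini_tonelli _ _ _ _ _ m1 m2 f).
Qed.

End product_integral.

Section lebesgue_line.
Context (R : realType).
Local Notation RB := (measurableTypeR R).
Local Notation mu := (@lebesgue_measure R).
Local Open Scope ereal_scope.

(** The pushforward of Lebesgue measure by the affine map, scaled by its slope,
    has the right value on every interval, which characterizes Lebesgue measure. *)
Lemma ge0_integral_affine (m s : R) (f : RB -> \bar R) : (0 < s)%R ->
  (forall x, 0 <= f x) -> measurable_fun setT f ->
  \int[mu]_x f (m + s * x)%R = (s^-1)%:E * \int[mu]_x f x.
Proof.
move=> s0 f0 mf; pose phi (x : RB) : RB := (m + s * x)%R.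
have mphi : measurable_fun setT phi.
  by apply: measurable_funD => //; exact: measurable_funM.
pose s' := NngNum (ltW s0).
pose nu := measure_function_pushforward__canonical__measure_function_Measure
  mu mphi.
have E A : measurable A -> mu A = mscale s' nu A.
  apply: lebesgue_measure_unique => //= _ [[a b]] _ <-.
  rewrite /mscale/= /pushforward.
  have -> : phi @^-1` [set` `]a, b]] = [set` `](a - m) / s, (b - m) / s]]%R.
    apply/seteqP; split => x /=; rewrite !in_itv/= ltr_pdivrMr// ler_pdivlMr//;
    by rewrite ltrBlDl lerBrDl mulrC.
  rewrite !lebesgue_measure_itv/= !lte_fin ltr_pM2r ?invr_gt0// ltrD2r.
  case: ifPn => _; last by rewrite mule0.
  by rewrite -!EFinB -EFinM; congr (_%:E); field; rewrite gt_eqF.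
transitivity (\int[nu]_x f x).
  by rewrite (ge0_integral_pushforward mphi).
have -> : \int[mu]_x f x = \int[mscale s' nu]_x f x.
  by apply: eq_measure_integral => A mA _; exact: E.
rewrite ge0_integral_mscale// muleA -EFinM mulVf ?mul1e//.
by rewrite gt_eqF.
Qed.

Lemma integral_gt0 (f : RB -> \bar R) : (forall x, 0 <= f x) ->
  measurable_fun setT f -> (forall x, (0 < x)%R -> 0 < f x) ->
  0 < \int[mu]_x f x.
Proof.
move=> f0 mf fpos; rewrite lt_neqAle integral_ge0 ?andbT//.
apply/eqP => I0.
have aeq : ae_eq mu setT f (cst 0).
  apply/ae_eq_integral_abs => //.
  transitivity (\int[mu]_x f x); last by rewrite -I0.
  by apply: eq_integral => x _; rewrite gee0_abs.
have [N [mN N0 subN]] := aeq.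
have : mu `]0%R, 1%R] <= mu N.
  apply: le_measure; rewrite ?inE//.
  apply: subset_trans subN => x /=; rewrite in_itv/= => /andP[x0 _].
  by move=> /(_ I) fx0; have := fpos x x0; rewrite fx0 ltxx.
by rewrite N0 lebesgue_measure_itv/= lte_fin ltr01 sube0 lee_fin ler10.
Qed.

End lebesgue_line.

(** * Gamma laws and their moments *)

Section gamma_law.
Context (R : realType).
Local Notation RB := (measurableTypeR R).
Local Notation mu := (@lebesgue_measure R).
Local Open Scope ereal_scope.

Lemma gamma_fun_gt0 (a b x : R) : (0 < x)%R -> (0 < gamma_fun a b x)%R.
Proof. by move=> x0; rewrite /gamma_fun x0 mulr_gt0 ?powR_gt0 ?expR_gt0. Qed.

Lemma gamma_funM_id (a b x : R) :
  (x * gamma_fun a b x = gamma_fun (a + 1) b x)%R.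
Proof.
rewrite /gamma_fun; case: ifPn => [x0|_]; last by rewrite mulr0.
rewrite mulrA; congr (_ * _)%R.
by rewrite -{1}(powRr1 (ltW x0)) -powRD ?(gt_eqF x0) ?implybT//; congr (_ `^ _)%R; ring.
Qed.

Lemma gamma_funM_exp (a b c x : R) :
  (expR (- c * x) * gamma_fun a b x = gamma_fun a (b + c) x)%R.
Proof.
rewrite /gamma_fun; case: ifPn => [x0|_]; last by rewrite mulr0.
by rewrite mulrCA -expRD; congr (_ * expR _)%R; ring.
Qed.

Lemma gamma_fun_scale (a b x : R) : (0 < b)%R ->
  (gamma_fun a b (0 + b^-1 * x) = b `^ (1 - a) * gamma_fun a 1 x)%R.
Proof.
move=> b0; rewrite add0r /gamma_fun pmulr_rgt0 ?invr_gt0//.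
case: ifPn => [x0|_]; last by rewrite mulr0.
rewrite powRM ?invr_ge0 ?ltW// -powR_inv1 ?ltW// -powRrM mulrA.
congr (_ `^ _ * _ * expR _)%R; first by ring.
by rewrite powR_inv1 ?ltW//; field; rewrite gt_eqF.
Qed.

Lemma measurable_gamma_funE (a b : R) :
  measurable_fun setT (fun x : RB => (gamma_fun a b x)%:E).
Proof. by apply/measurable_EFinP; exact: measurable_gamma_fun. Qed.

Lemma gamma_weight_setT (a b : R) :
  gamma_weight a b setT = \int[mu]_x (gamma_fun a b x)%:E.
Proof. by []. Qed.

Lemma gamma_weight_gt0 (a b : R) : 0 < gamma_weight a b setT.
Proof.
apply: integral_gt0 => [x||x x0].
- by rewrite lee_fin gamma_fun_ge0.
- exact: measurable_gamma_funE.
- by rewrite lte_fin gamma_fun_gt0.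
Qed.

(** The power is absorbed by half of the exponential: [ln x <= c * x - ln c], and
    [c = b / (2 * a)] makes [(a - 1) * (c * x)] at most [b / 2 * x]. What is left is
    an exponential density. *)
Lemma gamma_weight_lty (a b : R) : (1 <= a)%R -> (0 < b)%R ->
  gamma_weight a b setT < +oo.
Proof.
move=> a1 b0; have a0 : (0 < a)%R by exact: lt_le_trans a1.
pose c : R := (b / (2 * a))%R.
have c0 : (0 < c)%R by rewrite divr_gt0// mulr_gt0.
pose k : R := (expR (- (a - 1) * ln c) * (2 / b))%R.
have k0 : (0 <= k)%R by rewrite mulr_ge0 ?expR_ge0// divr_ge0// ltW.
have b20 : (0 < b / 2)%R by rewrite divr_gt0.
apply: (@le_lt_trans _ _ (\int[mu]_x (k%:E * (exponential_pdf (b / 2) x)%:E))).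
  apply: ge0_le_integral => //.
  - by move=> x _; rewrite lee_fin gamma_fun_ge0.
  - exact: measurable_gamma_funE.
  - apply: measurable_funeM; apply/measurable_EFinP.
    exact: measurable_exponential_pdf.
  - move=> x _; rewrite -EFinM lee_fin /gamma_fun; case: ifPn => [x0|_]; last first.
      by rewrite mulr_ge0// exponential_pdf_ge0// ltW.
    rewrite exponential_pdfE ?(ltW x0)// /k /powR (gt_eqF x0).
    rewrite mulrA -(mulrA _ (2 / b)%R).
    have -> : (2 / b * (b / 2) = 1)%R by field; rewrite gt_eqF.
    rewrite mulr1 -!expRD ler_expR.
    have lnx : (ln x <= c * x - ln c)%R.
      have := le_ln1Dx (x := c * x - 1)%R.
      rewrite addrCA subrr addr0 lnM ?posrE// => h.
      have {h} : (ln c + ln x <= c * x - 1)%R.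
        by apply: h; rewrite ltrBrDl subrr mulr_gt0.
      by lra.
    have h1 : ((a - 1) * ln x <= (a - 1) * (c * x - ln c))%R.
      by rewrite ler_wpM2l// subr_ge0.
    have h2 : ((a - 1) * (c * x) <= a * (c * x))%R.
      by apply: ler_wpM2r; [rewrite mulr_ge0// ltW|lra].
    have h3 : (a * (c * x) = b / 2 * x)%R by rewrite /c; field; rewrite gt_eqF.
    lra.
rewrite ge0_integralZl//=.
- by rewrite integral_exponential_pdf// mule1 ltry.
- by apply/measurable_EFinP; exact: measurable_exponential_pdf.
- by move=> x _; rewrite lee_fin exponential_pdf_ge0// ltW.
Qed.

Lemma ln_ge_1BV (x : R) : (0 < x)%R -> (1 - x^-1 <= ln x)%R.
Proof.
move=> x0; have := le_ln1Dx (x := x^-1 - 1)%R.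
rewrite addrCA subrr addr0 lnV ?posrE// => L.
have {L} : (- ln x <= x^-1 - 1)%R by apply: L; rewrite ltrBrDl subrr invr_gt0.
by rewrite lerNl opprB.
Qed.

Lemma powR_onemV_le (a : R) : (1 <= a)%R ->
  ((1 - (2 * a)^-1) `^ (- a) <= expR 1)%R.
Proof.
move=> a1; have a0 : (0 < a)%R by exact: lt_le_trans a1.
have d0 : (0 < 2 * a - 1)%R by lra.
have -> : (1 - (2 * a)^-1 = (2 * a - 1) / (2 * a))%R.
  by field; rewrite gt_eqF.
have b0 : (0 < (2 * a - 1) / (2 * a))%R by rewrite divr_gt0// mulr_gt0.
rewrite /powR (gt_eqF b0) ler_expR.
have := ln_ge_1BV b0; set l := ln _ => L.
have E : (1 - ((2 * a - 1) / (2 * a))^-1 = - (2 * a - 1)^-1)%R.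
  by field; rewrite ?gt_eqF.
rewrite {}E in L.
apply: (@le_trans _ _ (a / (2 * a - 1)))%R.
  rewrite mulNr -mulrN; apply: ler_wpM2l; first exact: ltW.
  by rewrite lerNl.
by rewrite ler_pdivrMr// mul1r; clear -a1; lra.
Qed.

Lemma powR_addV_le (a : R) : (1 <= a)%R -> ((1 + a^-1) `^ (- a) <= 2 / 3)%R.
Proof.
move=> a1; have a0 : (0 < a)%R by exact: lt_le_trans a1.
have -> : (1 + a^-1 = (a + 1) / a)%R by field; rewrite gt_eqF.
have d0 : (0 < a + 1)%R by exact: addr_gt0.
have b0 : (0 < (a + 1) / a)%R by rewrite divr_gt0.
rewrite /powR (gt_eqF b0).
have := ln_ge_1BV b0; set l := ln _ => L.
have E : (1 - ((a + 1) / a)^-1 = (a + 1)^-1)%R by field; rewrite ?gt_eqF.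
rewrite {}E in L.
have h : (2^-1 <= a * l)%R.
  apply: (@le_trans _ _ (a / (a + 1)))%R; last by apply: ler_wpM2l => //; exact: ltW.
  by rewrite ler_pdivlMr//; clear -a1; lra.
rewrite mulNr expRN; have -> : (2 / 3 = (3 / 2)^-1 :> R)%R by field.
rewrite lef_pV2 ?posrE ?expR_gt0//.
apply: le_trans (expR_ge1Dx _); clear -h; lra.
Qed.

(** Euler's Gamma function at [a], which is the integral of
    [x `^ (a - 1) * expR (- x)]. *)
Definition Gamma (a : R) : R := fine (gamma_weight a 1 setT).

Lemma GammaE (a : R) : (1 <= a)%R -> gamma_weight a 1 setT = (Gamma a)%:E.
Proof.
by move=> a1; rewrite fineK// ge0_fin_numE// gamma_weight_lty.
Qed.

Lemma Gamma_gt0 (a : R) : (1 <= a)%R -> (0 < Gamma a)%R.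
Proof. by move=> a1; rewrite -lte_fin -GammaE// gamma_weight_gt0. Qed.

(** The change of variable [x = t / b]. *)
Lemma gamma_weightE (a b : R) : (1 <= a)%R -> (0 < b)%R ->
  gamma_weight a b setT = (b `^ (- a) * Gamma a)%:E.
Proof.
move=> a1 b0; have bV0 : (0 < b^-1)%R by rewrite invr_gt0.
have mg := measurable_gamma_funE a b.
have g0 x : 0 <= (gamma_fun a b x)%:E by rewrite lee_fin gamma_fun_ge0.
have := ge0_integral_affine 0 bV0 g0 mg.
rewrite invrK -gamma_weight_setT.
under eq_integral do rewrite gamma_fun_scale// EFinM.
rewrite ge0_integralZl//; last 3 first.
- exact: measurable_gamma_funE.
- by move=> x _; rewrite lee_fin gamma_fun_ge0.
- by rewrite lee_fin powR_ge0.
rewrite -gamma_weight_setT GammaE// => h.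
have -> : gamma_weight a b setT = (b^-1)%:E * (b%:E * gamma_weight a b setT).
  by rewrite muleA -EFinM mulVf ?mul1e// gt_eqF.
rewrite -h -!EFinM mulrA; congr (_ * _)%:E.
rewrite -{1}powR_inv1 ?ltW// -powRD ?(gt_eqF b0) ?implybT//.
by congr (_ `^ _)%R; ring.
Qed.

(** With [h = 1 / (2 * a)], the inequality [h * x <= expR (h * x)] bounds the mass
    of shape [a + 1] by that of shape [a] and rate [1 - h], which the scaling
    formula evaluates as [(1 - h) `^ (- a) * Gamma a]. *)
Lemma GammaS_le (a : R) : (1 <= a)%R ->
  (Gamma (a + 1) <= 2 * expR 1 * a * Gamma a)%R.
Proof.
move=> a1; have a0 : (0 < a)%R by exact: lt_le_trans a1.
pose h : R := ((2 * a)^-1)%R.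
have h0 : (0 < h)%R by rewrite invr_gt0 mulr_gt0.
have h1 : (h <= 2^-1)%R.
  by rewrite lef_pV2 ?posrE ?mulr_gt0// ler_peMr.
have b0 : (0 < 1 - h)%R by lra.
have a11 : (1 <= a + 1)%R by lra.
have H : h%:E * gamma_weight (a + 1) 1 setT <= gamma_weight a (1 - h) setT.
  rewrite !gamma_weight_setT -ge0_integralZl//; last 3 first.
  - exact: measurable_gamma_funE.
  - by move=> x _; rewrite lee_fin gamma_fun_ge0.
  - by rewrite lee_fin ltW.
  apply: ge0_le_integral => //.
  - by move=> x _; rewrite mule_ge0// lee_fin ?gamma_fun_ge0 ?ltW.
  - by apply: measurable_funeM; exact: measurable_gamma_funE.
  - exact: measurable_gamma_funE.
  - move=> x _; rewrite -EFinM lee_fin -gamma_funM_id -gamma_funM_exp mulrA.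
    rewrite ler_wpM2r ?gamma_fun_ge0// opprK.
    by apply: le_trans (expR_ge1Dx _); rewrite lerDr.
move: H; rewrite (GammaE a11) (gamma_weightE a1 b0) -EFinM lee_fin => H.
have H2 : ((1 - h) `^ (- a) <= expR 1)%R by exact: powR_onemV_le.
have G0 := Gamma_gt0 a1.
have -> : (Gamma (a + 1) = 2 * a * (h * Gamma (a + 1)))%R.
  by rewrite /h; field; rewrite gt_eqF.
have -> : (2 * expR 1 * a * Gamma a = 2 * a * (expR 1 * Gamma a))%R by ring.
apply: ler_wpM2l; first by rewrite mulr_ge0// ltW.
by apply: le_trans H _; apply: ler_wpM2r => //; exact: ltW.
Qed.

(** With [h = 1 / a], the inequality [1 <= expR (- h * x) + h * x] bounds the mass of
    shape [a] by the mass of shape [a] and rate [1 + h], which is at most two thirds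
    of it, plus [h] times the mass of shape [a + 1]. *)
Lemma Gamma_leS (a : R) : (1 <= a)%R ->
  (Gamma a <= 3 / a * Gamma (a + 1))%R.
Proof.
move=> a1; have a0 : (0 < a)%R by exact: lt_le_trans a1.
pose h : R := (a^-1)%R.
have h0 : (0 < h)%R by rewrite invr_gt0.
have h1 : (h <= 1)%R by rewrite invf_le1.
have b0 : (0 < 1 + h)%R by lra.
have a11 : (1 <= a + 1)%R by lra.
have G0 := Gamma_gt0 a1.
have H : gamma_weight a 1 setT <=
    gamma_weight a (1 + h) setT + h%:E * gamma_weight (a + 1) 1 setT.
  rewrite !gamma_weight_setT -ge0_integralZl//; last 3 first.
  - exact: measurable_gamma_funE.
  - by move=> x _; rewrite lee_fin gamma_fun_ge0.
  - by rewrite lee_fin ltW.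
  rewrite -ge0_integralD//; last 4 first.
  - by move=> x _; rewrite lee_fin gamma_fun_ge0.
  - exact: measurable_gamma_funE.
  - by move=> x _; rewrite mule_ge0// lee_fin ?gamma_fun_ge0 ?ltW.
  - by apply: measurable_funeM; exact: measurable_gamma_funE.
  apply: ge0_le_integral => //.
  - by move=> x _; rewrite lee_fin gamma_fun_ge0.
  - exact: measurable_gamma_funE.
  - apply: emeasurable_funD; first exact: measurable_gamma_funE.
    by apply: measurable_funeM; exact: measurable_gamma_funE.
  - move=> x _; rewrite -EFinM -EFinD lee_fin -gamma_funM_id -gamma_funM_exp mulrA.
    rewrite -mulrDl ler_peMl ?gamma_fun_ge0//.
    by have := expR_ge1Dx (- h * x)%R; lra.
move: H; rewrite (GammaE a11) (GammaE a1) (gamma_weightE a1 b0).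
rewrite -EFinM -EFinD lee_fin => H.
have H2 : ((1 + h) `^ (- a) <= 2 / 3)%R by exact: powR_addV_le.
have H3 : ((1 + h) `^ (- a) * Gamma a <= 2 / 3 * Gamma a)%R.
  by apply: ler_wpM2r => //; exact: ltW.
rewrite -/h -mulrA; move: H H3; set u := (_ `^ _ * _)%R; set v := (h * _)%R.
by move: (Gamma a) u v => G u v; clear; lra.
Qed.

Lemma gamma_probE (a b : R) A : (1 <= a)%R -> (0 < b)%R ->
  gamma_prob a b A =
  ((b `^ (- a) * Gamma a)^-1)%:E * gamma_weight a b A.
Proof.
move=> a1 b0; apply: mnormalizeE; first exact: gamma_weightE.
by rewrite mulr_gt0 ?powR_gt0 ?Gamma_gt0.
Qed.

Lemma ge0_integral_gamma_prob (a b : R) (g : RB -> \bar R) :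
  (1 <= a)%R -> (0 < b)%R ->
  (forall x, 0 <= g x) -> measurable_fun setT g ->
  \int[gamma_prob a b]_x g x =
  ((b `^ (- a) * Gamma a)^-1)%:E * \int[mu]_x (g x * (gamma_fun a b x)%:E).
Proof.
move=> a1 b0 g0 mg.
have k0 : (0 <= (b `^ (- a) * Gamma a)^-1)%R.
  by rewrite invr_ge0 mulr_ge0 ?powR_ge0 ?ltW ?Gamma_gt0.
transitivity (\int[mscale (NngNum k0) (gamma_weight a b)]_x g x).
  by apply: eq_measure_integral => A mA _; rewrite -[RHS]gamma_probE.
rewrite ge0_integral_mscale//; congr (_ * _).
apply: ge0_integral_density => //.
- by move=> x; exact: gamma_fun_ge0.
- exact: measurable_gamma_fun.
Qed.

(** A gamma law is carried by the positive half-line, the only place where the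
    estimates below hold. *)
Lemma le_integral_gamma_prob (a b : R) (f g : RB -> \bar R) :
  (1 <= a)%R -> (0 < b)%R ->
  (forall x, 0 <= f x) -> measurable_fun setT f ->
  (forall x, 0 <= g x) -> measurable_fun setT g ->
  (forall x, (0 < x)%R -> f x <= g x) ->
  \int[gamma_prob a b]_x f x <= \int[gamma_prob a b]_x g x.
Proof.
move=> a1 b0 f0 mf g0 mg fg; rewrite (ge0_integral_gamma_prob a1 b0 f0 mf).
rewrite (ge0_integral_gamma_prob a1 b0 g0 mg).
rewrite lee_wpmul2l//.
  by rewrite lee_fin invr_ge0 mulr_ge0 ?powR_ge0 ?ltW ?Gamma_gt0.
apply: ge0_le_integral => //.
- by move=> x _; rewrite mule_ge0// lee_fin gamma_fun_ge0.
- by apply: emeasurable_funM => //; exact: measurable_gamma_funE.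
- by apply: emeasurable_funM => //; exact: measurable_gamma_funE.
- move=> x _; have [x0|x0] := ltP 0%R x.
    by rewrite lee_wpmul2r ?fg// lee_fin gamma_fun_ge0.
  by rewrite /gamma_fun ltNge x0/= !mule0.
Qed.

Lemma eq_integral_gamma_prob (a b : R) (f g : RB -> \bar R) :
  (1 <= a)%R -> (0 < b)%R ->
  (forall x, 0 <= f x) -> measurable_fun setT f ->
  (forall x, 0 <= g x) -> measurable_fun setT g ->
  (forall x, (0 < x)%R -> f x = g x) ->
  \int[gamma_prob a b]_x f x = \int[gamma_prob a b]_x g x.
Proof.
move=> a1 b0 f0 mf g0 mg fg; apply/eqP; rewrite eq_le.
by rewrite !le_integral_gamma_prob// => x x0; rewrite fg.
Qed.

Lemma ge0_integral_gamma_prob_rate (a b : R) (f : RB -> \bar R) :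
  (1 <= a)%R -> (0 < b)%R ->
  (forall x, 0 <= f x) -> measurable_fun setT f ->
  \int[gamma_prob a b]_x f x = \int[gamma_prob a 1]_x f (b^-1 * x)%R.
Proof.
move=> a1 b0 f0 mf; have bV0 : (0 < b^-1)%R by rewrite invr_gt0.
have mfb : measurable_fun setT (fun x : RB => f (b^-1 * x)%R).
  by apply: (measurableT_comp mf); exact: measurable_funM.
have mfg : measurable_fun setT (fun x : RB => f x * (gamma_fun a b x)%:E).
  by apply: emeasurable_funM => //; exact: measurable_gamma_funE.
have maff : measurable_fun setT (fun x : RB => (0 + b^-1 * x)%R : RB).
  by apply: measurable_funD => //; exact: measurable_funM.
have fg0 x : 0 <= f x * (gamma_fun a b x)%:E.
  by rewrite mule_ge0// lee_fin gamma_fun_ge0.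
have fb0 x : 0 <= f (b^-1 * x)%R by [].
apply: (etrans (ge0_integral_gamma_prob a1 b0 f0 mf)).
apply/esym; apply: (etrans (ge0_integral_gamma_prob a1 ltr01 fb0 mfb)).
apply/esym; rewrite powR1 mul1r.
transitivity (((Gamma a)^-1)%:E * \int[mu]_x ((b `^ (a - 1))%:E *
    (f (0 + b^-1 * x)%R * (gamma_fun a b (0 + b^-1 * x)%R)%:E))).
  rewrite ge0_integralZl//=; last 2 first.
  - exact: (measurableT_comp mfg maff).
  - by rewrite lee_fin powR_ge0.
  rewrite (ge0_integral_affine _ bV0 fg0 mfg) invrK !muleA -!EFinM.
  congr (_%:E * _); rewrite invfM mulrC -mulrA; congr (_ * _)%R.
  rewrite -powRN opprK -{3}(powRr1 (ltW b0)) -powRD ?(gt_eqF b0) ?implybT//.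
  by congr (_ `^ _)%R; ring.
congr (_ * _); apply: eq_integral => x _.
rewrite gamma_fun_scale// add0r muleCA; congr (_ * _).
rewrite -EFinM mulrA -powRD ?(gt_eqF b0) ?implybT//.
by rewrite (_ : (a - 1 + (1 - a) = 0)%R) ?powRr0 ?mul1r//; ring.
Qed.

Lemma integral_gamma_prob_moment (a a' : R) (g : RB -> R) :
  (1 <= a)%R -> (1 <= a')%R ->
  (forall x, 0 <= g x)%R -> measurable_fun setT g ->
  (forall x, (0 < x)%R -> g x * gamma_fun a 1 x = gamma_fun a' 1 x)%R ->
  \int[gamma_prob a 1]_x (g x)%:E = (Gamma a' / Gamma a)%:E.
Proof.
move=> a1 a'1 g0 mg gE; rewrite ge0_integral_gamma_prob//; last first.
  exact/measurable_EFinP.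
rewrite powR1 mul1r.
have -> : \int[mu]_x ((g x)%:E * (gamma_fun a 1 x)%:E) =
    \int[mu]_x (gamma_fun a' 1 x)%:E.
  apply: eq_integral => x _; rewrite -EFinM; congr (_%:E); have [x0|x0] := ltP 0%R x.
    exact: gE.
  by rewrite /gamma_fun ltNge x0/= mulr0.
by rewrite -gamma_weight_setT GammaE// -EFinM mulrC.
Qed.

Lemma measurable_normV : measurable_fun setT (fun x : RB => `|x|^-1 : R)%R.
Proof. by apply: (measurableT_comp (@measurable_invr R)). Qed.

(** One constant serves for the moments of orders [1], [2], [-1] and [-2]. They are
    taken of the absolute value, so that the integrands are nonnegative on the whole
    line. *)
Definition gamma_cst : R := (8 * expR 1 ^+ 2 + 24)%R.

Lemma gamma_cst_gt0 : (0 < gamma_cst)%R.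
Proof. by rewrite /gamma_cst; have := expR_gt0 (1 : R); nra. Qed.

Lemma expR1_ge2 : (2 <= expR 1 :> R)%R.
Proof. by have := expR_ge1Dx (1 : R); lra. Qed.

Lemma gamma_cst_ge24 : (24 <= gamma_cst)%R.
Proof. by rewrite /gamma_cst lerDr mulr_ge0// sqr_ge0. Qed.

Lemma gamma_cst_ge4 : (4 <= gamma_cst)%R.
Proof. by apply: le_trans gamma_cst_ge24; rewrite ler_nat. Qed.

Lemma gamma_prob_moment1 (a : R) : (4 <= a)%R ->
  \int[gamma_prob a 1]_x (`|x|)%:E <= (gamma_cst * a)%:E.
Proof.
move=> a4; rewrite (@integral_gamma_prob_moment _ (a + 1))//; [|lra|lra|]; last first.
  by move=> x x0; rewrite gtr0_norm// gamma_funM_id.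
have G0 : (0 < Gamma a)%R by apply: Gamma_gt0; lra.
rewrite lee_fin ler_pdivrMr//; apply: (le_trans (GammaS_le _)); first by lra.
apply: ler_wpM2r; first exact: ltW.
by apply: ler_wpM2r; [lra|rewrite /gamma_cst; have := expR1_ge2; nra].
Qed.

Lemma gamma_prob_moment2 (a : R) : (4 <= a)%R ->
  \int[gamma_prob a 1]_x (`|x| ^+ 2)%:E <= (gamma_cst * a ^+ 2)%:E.
Proof.
move=> a4; rewrite (@integral_gamma_prob_moment _ (a + 1 + 1))//; [|lra|lra| |]; last 2 first.
- exact: measurable_funX.
- by move=> x x0; rewrite gtr0_norm// expr2 -mulrA !gamma_funM_id.
have G0 : (0 < Gamma a)%R by apply: Gamma_gt0; lra.
rewrite lee_fin ler_pdivrMr//.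
apply: (le_trans (GammaS_le _)); first by lra.
have K0 : (0 <= 2 * expR 1 * (a + 1))%R by have := expR1_ge2; nra.
apply: (@le_trans _ _ (2 * expR 1 * (a + 1) * (2 * expR 1 * a * Gamma a)))%R.
  by apply: ler_wpM2l => //; apply: GammaS_le; lra.
rewrite mulrA; apply: ler_wpM2r; first exact: ltW.
have -> : (2 * expR 1 * (a + 1) * (2 * expR 1 * a) =
  4 * expR 1 ^+ 2 * (a * (a + 1)))%R by ring.
apply: (@le_trans _ _ (4 * expR 1 ^+ 2 * (2 * a ^+ 2)))%R.
  by apply: ler_wpM2l; [rewrite mulr_ge0// sqr_ge0|nra].
have -> : (4 * expR 1 ^+ 2 * (2 * a ^+ 2) = 8 * expR 1 ^+ 2 * a ^+ 2 :> R)%R by ring.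
by apply: ler_wpM2r; [exact: sqr_ge0|rewrite /gamma_cst; lra].
Qed.

Lemma gamma_prob_momentV1 (a : R) : (4 <= a)%R ->
  \int[gamma_prob a 1]_x (`|x|^-1)%:E <= (gamma_cst / a)%:E.
Proof.
move=> a4.
have [a1 aB1 aB0 a0] : [/\ 1 <= a, 1 <= a - 1, 0 < a - 1 & 0 < a]%R by split; lra.
have aa : (3 / (a - 1) <= gamma_cst / a)%R.
  rewrite ler_pdivrMr// mulrAC ler_pdivlMr//.
  by move: gamma_cst gamma_cst_ge4 => k k4; clear -k4 a4; nra.
rewrite (integral_gamma_prob_moment a1 aB1 _ measurable_normV)//; last first.
  move=> x x0; rewrite gtr0_norm// -[in LHS](subrK 1%R a) -gamma_funM_id.
  by rewrite mulrA mulVf ?mul1r// gt_eqF.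
have G0 : (0 < Gamma a)%R by apply: Gamma_gt0.
have := Gamma_leS aB1; rewrite subrK => h.
rewrite lee_fin ler_pdivrMr//; apply: (le_trans h).
by apply: ler_wpM2r => //; exact: ltW.
Qed.

Lemma gamma_prob_momentV2 (a : R) : (4 <= a)%R ->
  \int[gamma_prob a 1]_x (`|x|^-1 ^+ 2)%:E <= (gamma_cst / a ^+ 2)%:E.
Proof.
move=> a4.
have [a1 aB1 aB2] : [/\ 1 <= a, 1 <= a - 1 & 1 <= a - 1 - 1]%R by split; lra.
have [a0 aB10 aB20] : [/\ 0 < a, 0 < a - 1 & 0 < a - 1 - 1]%R by split; lra.
have aa : (3 / (a - 1 - 1) * (3 / (a - 1)) <= gamma_cst / a ^+ 2)%R.
  have -> : (3 / (a - 1 - 1) * (3 / (a - 1)) = 9 / ((a - 1 - 1) * (a - 1)) :> R)%R.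
    by field; rewrite ?gt_eqF.
  rewrite ler_pdivrMr ?mulr_gt0// mulrAC ler_pdivlMr ?exprn_gt0//.
  have h : (3 * a ^+ 2 <= 8 * ((a - 1 - 1) * (a - 1)))%R by clear -a4; nra.
  have h2 : (24 * ((a - 1 - 1) * (a - 1)) <= gamma_cst * ((a - 1 - 1) * (a - 1)))%R.
    by apply: ler_wpM2r; rewrite ?gamma_cst_ge24// ltW// mulr_gt0.
  by apply: le_trans h2; clear -h; lra.
rewrite (integral_gamma_prob_moment a1 aB2)//; last 2 first.
- exact: measurable_funX measurable_normV.
- move=> x x0; rewrite gtr0_norm// -[in LHS](subrK 1%R a) -[in LHS](subrK 1%R (a - 1)%R).
  by rewrite -!gamma_funM_id; field; rewrite gt_eqF.
have G0 : (0 < Gamma a)%R by apply: Gamma_gt0.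
have := Gamma_leS aB1; rewrite subrK => h1.
have := Gamma_leS aB2; rewrite subrK => h2.
rewrite lee_fin (ler_pdivrMr _ _ G0); apply: (le_trans h2).
apply: (@le_trans _ _ (3 / (a - 1 - 1) * (3 / (a - 1) * Gamma a)))%R.
  by apply: ler_wpM2l h1; apply: divr_ge0; [exact: ler0n|exact: ltW].
by rewrite mulrA; apply: ler_wpM2r => //; exact: ltW.
Qed.

End gamma_law.

(** * Normal laws and products over tuples *)

Section normal_law.
Context (R : realType).
Local Notation RB := (measurableTypeR R).
Local Notation mu := (@lebesgue_measure R).
Local Open Scope ereal_scope.

Lemma ge0_integral_normal_prob (m s : R) (g : RB -> \bar R) :
  (forall x, 0 <= g x) -> measurable_fun setT g ->
  \int[normal_prob m s]_x g x = \int[mu]_x (g x * (normal_pdf m s x)%:E).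
Proof.
move=> g0 mg; apply: ge0_integral_density => //.
- by move=> x; exact: normal_pdf_ge0.
- exact: measurable_normal_pdf.
Qed.

Lemma normal_pdf_affine (m s x : R) : (0 < s)%R ->
  (normal_pdf m s (m + s * x) = s^-1 * normal_pdf 0 1 x)%R.
Proof.
move=> s0; rewrite !normal_pdfE ?gt_eqF//= mulrA; congr (_ * _)%R.
  rewrite /normal_peak expr1n mul1r -mulrnAr sqrtrM ?sqr_ge0// sqrtr_sqr gtr0_norm//.
  by rewrite invfM.
rewrite /normal_fun; congr expR; field.
by rewrite gt_eqF.
Qed.

Lemma ge0_integral_normal_affine (m s : R) (f : RB -> \bar R) : (0 < s)%R ->
  (forall x, 0 <= f x) -> measurable_fun setT f ->
  \int[normal_prob m s]_x f x = \int[normal_prob 0 1]_x f (m + s * x)%R.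
Proof.
move=> s0 f0 mf.
have maff : measurable_fun setT (fun x : RB => (m + s * x)%R : RB).
  by apply: measurable_funD => //; exact: measurable_funM.
have mfp : measurable_fun setT (fun x : RB => f x * (normal_pdf m s x)%:E).
  apply: emeasurable_funM => //; apply/measurable_EFinP.
  exact: measurable_normal_pdf.
have fp0 x : 0 <= f x * (normal_pdf m s x)%:E.
  by rewrite mule_ge0// lee_fin normal_pdf_ge0.
have fa0 x : 0 <= f (m + s * x)%R by [].
apply: (etrans (ge0_integral_normal_prob m s f0 mf)); apply/esym.
apply: (etrans (ge0_integral_normal_prob 0 1 fa0 (measurableT_comp mf maff))).
apply/esym.
transitivity (\int[mu]_x (s%:E *
    (f (m + s * x)%R * (normal_pdf m s (m + s * x)%R)%:E))).
  rewrite ge0_integralZl//; last 2 first.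
  - exact: (measurableT_comp mfp maff).
  - by rewrite lee_fin ltW.
  rewrite (ge0_integral_affine _ s0 fp0 mfp) muleA -EFinM mulfV ?mul1e//.
  by rewrite gt_eqF.
apply: eq_integral => x _; rewrite normal_pdf_affine// muleCA; congr (_ * _).
by rewrite -EFinM mulrA mulfV ?mul1r// gt_eqF.
Qed.

(** The factor [x ^+ 2 * expR (- (x ^+ 2 / 4))] is at most [4], and without it
    the integrand is a multiple of the normal density of variance [2]. *)
Lemma normal_prob_moment2 : \int[normal_prob 0 1]_x (x ^+ 2)%:E <= 8%:E :> \bar R.
Proof.
have msq : measurable_fun setT (fun x : RB => (x ^+ 2)%:E).
  by apply/measurable_EFinP; exact: measurable_funX.
have s2 : (0 < Num.sqrt 2 :> R)%R by rewrite sqrtr_gt0.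
have sq2 : (Num.sqrt 2 ^+ 2 = 2 :> R)%R by rewrite sqr_sqrtr.
rewrite ge0_integral_normal_prob//; last by move=> x; rewrite lee_fin sqr_ge0.
apply: (@le_trans _ _ (\int[mu]_x (8%:E * (normal_pdf 0 (Num.sqrt 2) x)%:E))).
  apply: ge0_le_integral => //.
  - by move=> x _; rewrite mule_ge0// lee_fin ?sqr_ge0 ?normal_pdf_ge0.
  - apply: emeasurable_funM => //; apply/measurable_EFinP.
    exact: measurable_normal_pdf.
  - apply: measurable_funeM; apply/measurable_EFinP.
    exact: measurable_normal_pdf.
  - move=> x _; rewrite -!EFinM lee_fin !normal_pdfE ?gt_eqF//=.
    have -> : (normal_peak 1 = Num.sqrt 2 * normal_peak (Num.sqrt 2) :> R)%R.
      rewrite /normal_peak sq2 expr1n mul1r -mulrnAr.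
      rewrite (sqrtrM (pi *+ 2)%R (ltW (ltr0n R 2))).
      by rewrite invfM mulrA mulfV ?mul1r// gt_eqF.
    have -> : (normal_fun 0 1 x = expR (- (x ^+ 2 / 4)) * normal_fun 0 (Num.sqrt 2) x)%R.
      by rewrite /normal_fun sq2 -expRD; congr expR; field.
    set q := normal_peak _; set e := normal_fun _ _ _.
    have qe0 : (0 <= q * e)%R by rewrite mulr_ge0 ?normal_peak_ge0 ?normal_fun_ge0.
    have -> : (x ^+ 2 * (Num.sqrt 2 * q * (expR (- (x ^+ 2 / 4)) * e)) =
      (Num.sqrt 2 * (x ^+ 2 * expR (- (x ^+ 2 / 4)))) * (q * e))%R by ring.
    apply: ler_wpM2r => //.
    have h1 : (Num.sqrt 2 <= 2 :> R)%R.
      by move: sq2 s2; move: (Num.sqrt 2) => t; clear; nra.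
    have h2 : (x ^+ 2 * expR (- (x ^+ 2 / 4)) <= 4)%R.
      rewrite expRN ler_pdivrMr ?expR_gt0//.
      by have := expR_ge1Dx (x ^+ 2 / 4); lra.
    have h3 : (0 <= x ^+ 2 * expR (- (x ^+ 2 / 4)))%R.
      by rewrite mulr_ge0 ?sqr_ge0 ?expR_ge0.
    by move: (Num.sqrt 2) (_ * expR _)%R s2 h1 h2 h3 => t u; clear; nra.
rewrite ge0_integralZl//; last 2 first.
- by apply/measurable_EFinP; exact: measurable_normal_pdf.
- by move=> x _; rewrite lee_fin normal_pdf_ge0.
by rewrite integral_normal_pdf mule1.
Qed.

End normal_law.

Section tuple_measures.
Context (R : realType).
Local Notation RB := (measurableTypeR R).
Local Open Scope ereal_scope.

Section cons_measure.
Context n (m1 : {sigma_finite_measure set RB -> \bar R})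
  (m2 : {sigma_finite_measure set (n.-tuple RB) -> \bar R}).

(** The inductive step of [tuple_prod], for which sigma-finiteness can be proved
    before it is known of [tuple_prod] itself. *)
Definition cons_measure : set (n.+1.-tuple RB) -> \bar R :=
  pushforward (m1 \x^ m2) (@cons_pt R n).

Let mcons := @measurable_cons_pt R n.

HB.instance Definition _ := Measure.copy cons_measure
  (measure_function_pushforward__canonical__measure_function_Measure
    (m1 \x^ m2) mcons).

Let cons_measure_sigma_finite : sigma_finite setT cons_measure.
Proof.
have [F UF Foo] := product_measure2_sigma_finite m1 m2.
pose uncons (t : n.+1.-tuple RB) := (thead t, [tuple of behead t]).
have muncons : measurable_fun setT uncons.
  by apply: measurable_fun_pair; [exact: measurable_tnth|exact: measurable_behead].
have consK z : uncons (cons_pt z) = z.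
  case: z => x t; rewrite /uncons /cons_pt /= theadE; congr pair.
  exact/val_inj.
exists (fun k => uncons @^-1` F k) => [|k]; last first.
  have [mF Fy] := Foo k; split.
    by rewrite -[X in measurable X]setTI; exact: muncons.
  rewrite /cons_measure /pushforward (_ : _ @^-1` _ = F k)//.
  by apply/seteqP; split => z /=; rewrite consK.
by rewrite -preimage_bigcup -UF preimage_setT.
Qed.

HB.instance Definition _ := Measure_isSigmaFinite.Build _ _ _ cons_measure
  cons_measure_sigma_finite.

Lemma ge0_integral_cons_measure (f : n.+1.-tuple RB -> \bar R) :
  (forall t, 0 <= f t) -> measurable_fun setT f ->
  \int[cons_measure]_t f t = \int[m2]_t \int[m1]_x f (cons_pt (x, t)).
Proof.
move=> f0 mf; rewrite /cons_measure (ge0_integral_pushforward mcons)//.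
rewrite ge0_integral_product_measure2//.
  by move=> z; exact: f0.
exact: (measurableT_comp mf mcons).
Qed.

Lemma ge0_integral_cons_measureC (f : n.+1.-tuple RB -> \bar R) :
  (forall t, 0 <= f t) -> measurable_fun setT f ->
  \int[cons_measure]_t f t = \int[m1]_x \int[m2]_t f (cons_pt (x, t)).
Proof.
move=> f0 mf; rewrite ge0_integral_cons_measure//.
apply/esym; apply: (@fubini_tonelli _ _ _ _ _ m1 m2 (f \o @cons_pt R n)).
  exact: (measurableT_comp mf mcons).
by move=> z; exact: f0.
Qed.

End cons_measure.

Lemma tuple_prod_sigma_finite n
    (mu : 'I_n -> {sigma_finite_measure set RB -> \bar R}) :
  exists m : {sigma_finite_measure set (n.-tuple RB) -> \bar R},
    tuple_prod mu = m.
Proof.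
elim: n mu => [|n ih] mu /=; first by exists (\d_([tuple] : 0.-tuple RB)).
have [m ->] := ih (fun i => mu (lift ord0 i)).
by exists (cons_measure (mu ord0) m).
Qed.

Section tuple_prod_instance.
Context n (mu : 'I_n -> {sigma_finite_measure set RB -> \bar R}).

Let sigma_finite_tuple_prod : sigma_finite setT (tuple_prod mu).
Proof. by have [m ->] := tuple_prod_sigma_finite mu; exact: sigma_finiteT. Qed.

HB.instance Definition _ := Measure_isSigmaFinite.Build _ _ _ (tuple_prod mu)
  sigma_finite_tuple_prod.

End tuple_prod_instance.

Definition tuple_leb n : {sigma_finite_measure set (n.-tuple RB) -> \bar R} :=
  tuple_prod (fun=> lebesgue_measure).

Lemma ge0_integral_tuple_prodS n
    (mu : 'I_n.+1 -> {sigma_finite_measure set RB -> \bar R})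
    (f : n.+1.-tuple RB -> \bar R) :
  (forall t, 0 <= f t) -> measurable_fun setT f ->
  \int[tuple_prod mu]_t f t = \int[tuple_prod (fun i => mu (lift ord0 i))]_t
    \int[mu ord0]_x f (cons_pt (x, t)).
Proof.
move=> f0 mf /=.
have [m ->] := tuple_prod_sigma_finite (fun i => mu (lift ord0 i)).
exact: ge0_integral_cons_measure.
Qed.

Lemma ge0_integral_tuple_prodSC n
    (mu : 'I_n.+1 -> {sigma_finite_measure set RB -> \bar R})
    (f : n.+1.-tuple RB -> \bar R) :
  (forall t, 0 <= f t) -> measurable_fun setT f ->
  \int[tuple_prod mu]_t f t = \int[mu ord0]_x
    \int[tuple_prod (fun i => mu (lift ord0 i))]_t f (cons_pt (x, t)).
Proof.
move=> f0 mf /=.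
have [m ->] := tuple_prod_sigma_finite (fun i => mu (lift ord0 i)).
exact: ge0_integral_cons_measureC.
Qed.

Lemma measurable_integral_tuple_prodS n
    (m1 : {sigma_finite_measure set RB -> \bar R})
    (f : n.+1.-tuple RB -> \bar R) :
  (forall t, 0 <= f t) -> measurable_fun setT f ->
  measurable_fun setT (fun t : n.-tuple RB => \int[m1]_x f (cons_pt (x, t))).
Proof.
move=> f0 mf.
apply: (@measurable_fun_fubini_tonelli_G _ _ _ _ _ m1 (f \o @cons_pt R n)).
  exact: (measurableT_comp mf (@measurable_cons_pt R n)).
by move=> z; exact: f0.
Qed.

Lemma tuple_prod_setT n (mu : 'I_n -> probability RB R) :
  tuple_prod mu setT = 1.
Proof.
elim: n mu => [|n ih] mu; first by rewrite /= diracT.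
rewrite -[LHS]mul1e -integral_cst// ge0_integral_tuple_prodS//.
rewrite (eq_integral (fun=> 1)) => [|t _].
  by rewrite integral_cst// mul1e; exact: ih.
by rewrite integral_cst// mul1e; exact: probability_setT.
Qed.

End tuple_measures.

Section tuple_normal.
Context (R : realType).
Local Notation RB := (measurableTypeR R).
Local Open Scope ereal_scope.

Definition std_normal n : set (n.-tuple RB) -> \bar R :=
  tuple_prod (fun=> normal_prob 0 1).
Arguments std_normal n A : clear implicits.

HB.instance Definition _ n := Measure.copy (std_normal n)
  (tuple_prod (fun _ : 'I_n => (normal_prob (0 : R) 1))).

Let std_normal1 n : std_normal n setT = 1.
Proof. exact: tuple_prod_setT. Qed.

HB.instance Definition _ n := Measure_isProbability.Build _ _ _ (std_normal n)
  (std_normal1 n).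

Definition affine_tuple n (m : 'I_n -> R) (s : R) (z : n.-tuple RB) : n.-tuple RB :=
  [tuple (m i + s * tnth z i)%R | i < n].

Lemma measurable_affine_tuple n (m : 'I_n -> R) (s : R) :
  measurable_fun setT (affine_tuple m s).
Proof.
apply/measurable_fun_tnthP => i.
rewrite (_ : _ \o _ = fun z : n.-tuple RB => (m i + s * tnth z i)%R); last first.
  by apply/funext => z; rewrite /= tnth_mktuple.
by apply: measurable_funD => //; apply: measurable_funM => //; exact: measurable_tnth.
Qed.

Lemma affine_tuple_cons n (m : 'I_n.+1 -> R) s x (z : n.-tuple RB) :
  affine_tuple m s (cons_pt (x, z)) =
  cons_pt ((m ord0 + s * x)%R, affine_tuple (fun i => m (lift ord0 i)) s z).
Proof.
apply: eq_from_tnth => i; rewrite tnth_mktuple.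
case: (unliftP ord0 i) => [j ->|->]; last by rewrite !tnth0.
by rewrite !tnthS tnth_mktuple.
Qed.

Lemma tuple_normal_affine n (m : 'I_n -> R) (s : R) (f : n.-tuple RB -> \bar R) :
  (0 < s)%R -> (forall t, 0 <= f t) -> measurable_fun setT f ->
  \int[tuple_prod (fun i => normal_prob (m i) s)]_t f t =
  \int[std_normal n]_z f (affine_tuple m s z).
Proof.
move=> s0; elim: n m f => [|n ih] m f f0 mf.
  apply: eq_integral => z _; by rewrite (tuple0 (affine_tuple m s z)) (tuple0 z).
have mfa := measurableT_comp mf (measurable_affine_tuple m s).
have fa0 t : 0 <= f (affine_tuple m s t) by [].
apply: (etrans (ge0_integral_tuple_prodS _ f0 mf)).
apply: (@etrans _ _ _ _ (ih (fun i => m (lift ord0 i)) _ _ _)).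
- by move=> t; exact: integral_ge0.
- exact: measurable_integral_tuple_prodS.
apply/esym; apply: (etrans (ge0_integral_tuple_prodS _ fa0 mfa)); apply/esym.
apply: eq_integral => z _; rewrite ge0_integral_normal_affine//; last first.
  apply: (measurableT_comp mf).
  apply: (measurableT_comp (@measurable_cons_pt R n)).
  exact: measurable_fun_pair.
by apply: eq_integral => x _; rewrite affine_tuple_cons.
Qed.

Lemma ge0_integral_tuple_normal n (m : 'I_n -> R) (s : R)
    (f : n.-tuple RB -> \bar R) :
  (forall t, 0 <= f t) -> measurable_fun setT f ->
  \int[tuple_prod (fun i => normal_prob (m i) s)]_t f t =
  \int[tuple_lebesgue R n]_t
    (f t * (\prod_(i < n) normal_pdf (m i) s (tnth t i))%:E).
Proof.
elim: n m f => [|n ih] m f f0 mf.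
  by apply: eq_integral => z _; rewrite big_ord0 mule1.
have mpdf k (m' : 'I_k -> R) : measurable_fun setT
    (fun t : k.-tuple RB => (\prod_(i < k) normal_pdf (m' i) s (tnth t i))%:E).
  apply/measurable_EFinP; apply: measurable_prod => i _.
  apply: (measurableT_comp (measurable_normal_pdf _ _)).
  exact: measurable_tnth.
have pdf0 k (m' : 'I_k -> R) (t : k.-tuple RB) :
    (0 <= \prod_(i < k) normal_pdf (m' i) s (tnth t i))%R.
  by apply: prodr_ge0 => i _; exact: normal_pdf_ge0.
have mfp := emeasurable_funM mf (mpdf n.+1 m).
have fp0 t : 0 <= f t * (\prod_(i < n.+1) normal_pdf (m i) s (tnth t i))%:E.
  by rewrite mule_ge0// lee_fin.
apply: (etrans (ge0_integral_tuple_prodS _ f0 mf)).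
apply: (@etrans _ _ _ _ (ih (fun i => m (lift ord0 i)) _ _ _)).
- by move=> t; exact: integral_ge0.
- exact: measurable_integral_tuple_prodS.
apply/esym; apply: (etrans (ge0_integral_tuple_prodS _ fp0 mfp)); apply/esym.
have mfc (t : n.-tuple RB) : measurable_fun setT (fun x : RB => f (cons_pt (x, t))).
  apply: (measurableT_comp mf).
  apply: (measurableT_comp (@measurable_cons_pt R n)).
  exact: measurable_fun_pair.
apply: eq_integral => t _; rewrite ge0_integral_normal_prob//.
rewrite -ge0_integralZr//; last 3 first.
- apply: emeasurable_funM => //; apply/measurable_EFinP.
  exact: measurable_normal_pdf.
- by move=> x _; rewrite mule_ge0// lee_fin normal_pdf_ge0.
- by rewrite lee_fin.
apply: eq_integral => x _; rewrite -muleA -EFinM big_ord_recl tnth0.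
by congr (_ * (_ * _)%:E); apply: eq_bigr => i _; rewrite tnthS.
Qed.

Lemma std_normal_moment2 n :
  \int[std_normal n]_z (\sum_(i < n) tnth z i ^+ 2)%:E <= (8 * n%:R)%:E.
Proof.
have msq k : measurable_fun setT (fun z : k.-tuple RB => (\sum_(i < k) tnth z i ^+ 2)%:E).
  apply/measurable_EFinP; apply: measurable_sum => i.
  by apply: measurable_funX; exact: measurable_tnth.
have sq0 k (z : k.-tuple RB) : (0 <= \sum_(i < k) tnth z i ^+ 2 :> R)%R.
  by apply: sumr_ge0 => i _; exact: sqr_ge0.
elim: n => [|n ih].
  by rewrite integral0_eq ?mulr0// => z _; rewrite big_ord0.
rewrite /std_normal ge0_integral_tuple_prodS//; last by move=> t; rewrite lee_fin.
have mx2 : measurable_fun setT (fun x : RB => (x ^+ 2)%:E).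
  by apply/measurable_EFinP; exact: measurable_funX.
apply: (@le_trans _ _ (\int[std_normal n]_z (8%:E + (\sum_(i < n) tnth z i ^+ 2)%:E))).
  apply: ge0_le_integral => //.
  - by move=> z _; apply: integral_ge0 => x _; rewrite lee_fin.
  - by apply: (measurable_integral_tuple_prodS _ _ (msq n.+1)) => t; rewrite lee_fin; exact: sq0.
  - by apply: emeasurable_funD; [exact: measurable_cst|exact: msq].
  - move=> z _.
    rewrite (eq_integral (fun x : RB => (x ^+ 2)%:E + (\sum_(i < n) tnth z i ^+ 2)%:E)).
      rewrite ge0_integralD//; last 2 first.
      - by move=> x _; rewrite lee_fin sqr_ge0.
      - by move=> x _; rewrite lee_fin; exact: sq0.
      rewrite integral_cst// [X in _ + _ * X](@probability_setT _ _ _ (normal_prob 0 1)).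
      by rewrite mule1 leeD2r//; exact: normal_prob_moment2.
    move=> x _; rewrite big_ord_recl tnth0 EFinD; congr (_ + _%:E).
    by apply: eq_bigr => i _; rewrite tnthS.
rewrite ge0_integralD//; last 2 first.
- by move=> z _; rewrite lee_fin; exact: sq0.
- exact: msq.
rewrite integral_cst// [X in _ * X + _](@probability_setT _ _ _ (std_normal n)) mule1.
have -> : (8 * n.+1%:R = 8 + 8 * n%:R :> R)%R by rewrite -[n.+1]addn1 natrD; ring.
by rewrite [leRHS]EFinD leeD2l.
Qed.

End tuple_normal.
Arguments std_normal R n A : clear implicits.

(** * One Gibbs step as a random map *)

Section gibbs_block.
Context (R : realType) (p r : nat) (y : 'M[R]_(p, r)).
Local Notation RB := (measurableTypeR R).
Local Notation T := (p.+1.-tuple RB).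
Local Open Scope ereal_scope.

(** The second half of the sampler, which draws the state given the precisions. *)
Definition block_law (lt le : R) (A : set T) : \bar R :=
  \int[normal_prob (intercept_mean y) (intercept_sd r lt le)]_eta0
    tuple_prod
      (fun i => normal_prob (effect_mean y lt le eta0 i) (effect_sd r lt le))
      [set t | A (cons_pt (eta0, t))].

Lemma measurable_intercept_sd :
  measurable_fun setT (fun u : RB * RB => intercept_sd r u.1 u.2 : RB).
Proof.
apply: (measurableT_comp (@measurable_sqrtr R)); apply: measurable_funM.
  by apply: measurable_funD => //; exact: measurable_funM.
apply: (measurableT_comp (@measurable_invr R)).
by apply: measurable_funM => //; exact: measurable_funM.
Qed.

Lemma measurable_effect_sd :
  measurable_fun setT (fun u : RB * RB => effect_sd r u.1 u.2 : RB).
Proof.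
apply: (measurableT_comp (@measurable_sqrtr R)); apply: measurable_funM => //.
apply: (measurableT_comp (@measurable_invr R)).
by apply: measurable_funD => //; exact: measurable_funM.
Qed.

Lemma measurable_effect_mean i :
  measurable_fun setT (fun u : (RB * RB) * RB => effect_mean y u.1.1 u.1.2 u.2 i : RB).
Proof.
have mlt : measurable_fun setT (fun u : (RB * RB) * RB => u.1.1 : R).
  by apply: (measurableT_comp measurable_fst); exact: measurable_fst.
have mle : measurable_fun setT (fun u : (RB * RB) * RB => u.1.2 : R).
  by apply: (measurableT_comp measurable_snd); exact: measurable_fst.
have m0 : measurable_fun setT (fun u : (RB * RB) * RB => u.2 : R).
  exact: measurable_snd.
apply: measurable_funM.
  apply: measurable_funM; first exact: measurable_funM.
  by apply: measurable_funB => //; exact: measurable_funM.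
apply: (measurableT_comp (@measurable_invr R)).
by apply: measurable_funD => //; exact: measurable_funM.
Qed.

Lemma block_law_pkernel : exists k : R.-pker (RB * RB)%type ~> T,
  forall lt le, block_law lt le = k (lt, le).
Proof.
have mi : measurable_fun setT (fun u : RB * RB =>
    (intercept_mean y : RB, intercept_sd r u.1 u.2 : RB)).
  by apply: measurable_fun_pair => //; exact: measurable_intercept_sd.
have mf i : measurable_fun setT (fun u : (RB * RB) * RB =>
    (effect_mean y u.1.1 u.1.2 u.2 i : RB, effect_sd r u.1.1 u.1.2 : RB)).
  apply: measurable_fun_pair; first exact: measurable_effect_mean.
  by apply: (measurableT_comp measurable_effect_sd); exact: measurable_fst.
have [k kE] := tuple_prod_kernel (fun i => kreindex (@normal_kernel R) (mf i)).
have mc : measurable_fun setT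
    (fun u : ((RB * RB) * RB) * p.-tuple RB => cons_pt (u.1.2, u.2)).
  apply: (measurableT_comp (@measurable_cons_pt R p)).
  apply: measurable_fun_pair; last exact: measurable_snd.
  by apply: (measurableT_comp measurable_snd); exact: measurable_fst.
exists (pkcomp (kreindex (@normal_kernel R) mi) (mkimage k mc)) => lt le.
apply/funext => A; apply: eq_integral => e0 _.
by rewrite /mkimage/= /kimage -kE.
Qed.

Lemma gibbsE (a1 a2 b1 b2 : R) eta A : gibbs a1 a2 b1 b2 y eta A =
  \int[gamma_prob (p%:R / 2 + a1) (theta_rate b1 eta)]_lt
  \int[gamma_prob ((r * p)%:R / 2 + a2) (e_rate b2 y eta)]_le block_law lt le A.
Proof. by []. Qed.

Lemma block_law_ge0 lt le A : 0 <= block_law lt le A.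
Proof. by have [k ->] := block_law_pkernel; exact: measure_ge0. Qed.

Lemma measurable_block_law A : measurable A ->
  measurable_fun setT (fun u : RB * RB => block_law u.1 u.2 A).
Proof.
move=> mA; have [k kE] := block_law_pkernel.
rewrite (_ : (fun u : RB * RB => _) = k ^~ A); last first.
  by apply/funext => -[lt le] /=; rewrite kE.
exact: measurable_kernel.
Qed.

(** The same draw as a function of standard normal variables, which two states
    with different precisions can share. *)
Definition block_map (lt le : R) (z : RB * p.-tuple RB) : T :=
  let eta0 := (intercept_mean y + intercept_sd r lt le * z.1)%R in
  cons_pt (eta0 : RB,
    affine_tuple (effect_mean y lt le eta0) (effect_sd r lt le) z.2).

Lemma intercept_block_map lt le z : intercept (block_map lt le z) =
  (intercept_mean y + intercept_sd r lt le * z.1)%R.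
Proof. by rewrite /intercept tnth0. Qed.

Lemma effect_block_map lt le z i : effect (block_map lt le z) i =
  (effect_mean y lt le (intercept (block_map lt le z)) i +
   effect_sd r lt le * tnth z.2 i)%R.
Proof. by rewrite intercept_block_map /effect tnthS tnth_mktuple. Qed.

Lemma measurable_block_map : measurable_fun setT
  (fun u : (RB * RB) * (RB * p.-tuple RB) => block_map u.1.1 u.1.2 u.2).
Proof.
pose U := ((RB * RB) * (RB * p.-tuple RB))%type.
have msd : measurable_fun setT (fun u : U => intercept_sd r u.1.1 u.1.2 : R).
  by apply: (measurableT_comp measurable_intercept_sd); exact: measurable_fst.
have mz0 : measurable_fun setT (fun u : U => u.2.1 : R).
  by apply: (measurableT_comp measurable_fst); exact: measurable_snd.
have m0 : measurable_fun setT (fun u : U =>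
    (intercept_mean y + intercept_sd r u.1.1 u.1.2 * u.2.1)%R : R).
  by apply: measurable_funD => //; exact: measurable_funM.
apply: (measurableT_comp (@measurable_cons_pt R p)).
apply: measurable_fun_pair => //.
apply/measurable_fun_tnthP => i.
rewrite (_ : _ \o _ = fun u : U =>
    (effect_mean y u.1.1 u.1.2
      (intercept_mean y + intercept_sd r u.1.1 u.1.2 * u.2.1) i +
     effect_sd r u.1.1 u.1.2 * tnth u.2.2 i)%R); last first.
  by apply/funext => u; rewrite /= tnth_mktuple.
apply: measurable_funD.
  have mg : measurable_fun setT (fun u : U => (u.1, (intercept_mean y +
      intercept_sd r u.1.1 u.1.2 * u.2.1)%R : RB)).
    by apply: measurable_fun_pair => //; exact: measurable_fst.
  exact: (measurableT_comp (measurable_effect_mean i) mg).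
apply: measurable_funM.
  by apply: (measurableT_comp measurable_effect_sd); exact: measurable_fst.
apply: (measurableT_comp (measurable_tnth i)).
by apply: (measurableT_comp measurable_snd); exact: measurable_snd.
Qed.

Definition normal_noise : probability (RB * p.-tuple RB)%type R :=
  (normal_prob 0 1 \x std_normal R p).

Lemma ge0_integral_normal_noise (f : RB * p.-tuple RB -> \bar R) :
  (forall z, 0 <= f z) -> measurable_fun setT f ->
  \int[normal_noise]_z f z =
  \int[normal_prob 0 1]_z0 \int[std_normal R p]_z f (z0, z).
Proof. by move=> f0 mf; exact: (fubini_tonelli1 f mf f0). Qed.

Hypothesis r0 : (0 < r)%N.

Lemma intercept_sd_gt0 (lt le : R) : (0 < lt)%R -> (0 < le)%R ->
  (0 < intercept_sd r lt le)%R.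
Proof.
move=> lt0 le0; rewrite sqrtr_gt0 divr_gt0//.
  by rewrite addr_gt0// mulr_gt0// ltr0n.
by rewrite !mulr_gt0// ltr0n.
Qed.

Lemma effect_sd_gt0 (lt le : R) : (0 < lt)%R -> (0 < le)%R ->
  (0 < effect_sd r lt le)%R.
Proof.
move=> lt0 le0; rewrite sqrtr_gt0 divr_gt0//.
by rewrite addr_gt0// mulr_gt0// ltr0n.
Qed.

Lemma block_lawE (lt le : R) A : (0 < lt)%R -> (0 < le)%R -> measurable A ->
  block_law lt le A = \int[normal_noise]_z (\1_A (block_map lt le z))%:E.
Proof.
move=> lt0 le0 mA.
have mi : measurable_fun setT (fun t : T => (\1_A t : R)%:E).
  by apply/measurable_EFinP; exact: measurable_indic.
have m_block : measurable_fun setT (block_map lt le).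
  exact: (measurableT_comp measurable_block_map (pair1_measurable (lt, le))).
have mcons (e0 : RB) : measurable_fun setT (fun t : p.-tuple RB => cons_pt (e0, t)).
  exact: (measurableT_comp (@measurable_cons_pt R p) (pair1_measurable e0)).
pose h (e0 : RB) := \int[std_normal R p]_z (\1_A (cons_pt (e0,
  affine_tuple (effect_mean y lt le e0) (effect_sd r lt le) z)))%:E.
have mh : measurable_fun setT h.
  have mB : measurable_fun setT (fun u : RB * p.-tuple RB =>
      (\1_A (cons_pt (u.1, affine_tuple (effect_mean y lt le u.1)
        (effect_sd r lt le) u.2)) : R)%:E).
    apply: (measurableT_comp mi); apply: (measurableT_comp (@measurable_cons_pt R p)).
    apply: measurable_fun_pair => //.
    apply/measurable_fun_tnthP => i.
    rewrite (_ : _ \o _ = fun u : RB * p.-tuple RB =>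
        (effect_mean y lt le u.1 i + effect_sd r lt le * tnth u.2 i)%R); last first.
      by apply/funext => u; rewrite /= tnth_mktuple.
    apply: measurable_funD.
      have mg : measurable_fun setT
          (fun u : RB * p.-tuple RB => ((lt : RB, le : RB), u.1)).
        by apply: measurable_fun_pair => //; exact: measurable_fst.
      exact: (measurableT_comp (measurable_effect_mean i) mg).
    apply: measurable_funM => //.
    by apply: (measurableT_comp (measurable_tnth i)); exact: measurable_snd.
  by apply: (measurable_fun_fubini_tonelli_F _ mB) => u; rewrite lee_fin.
have ib0 z : 0 <= (\1_A (block_map lt le z) : R)%:E by rewrite lee_fin.
apply: (etrans _ (esym
  (ge0_integral_normal_noise ib0 (measurableT_comp mi m_block)))).
have h0 e0 : 0 <= h e0 by apply: integral_ge0 => z _; rewrite lee_fin.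
apply: (etrans _ (ge0_integral_normal_affine (intercept_mean y)
  (intercept_sd_gt0 lt0 le0) h0 mh)).
apply: eq_integral => e0 _.
have mie : measurable_fun setT (fun t => (\1_A (cons_pt (e0 : RB, t)) : R)%:E).
  exact: (measurableT_comp mi (mcons e0)).
have i0 (t : p.-tuple RB) : 0 <= (\1_A (cons_pt (e0 : RB, t)) : R)%:E.
  by rewrite lee_fin.
apply: (etrans _ (tuple_normal_affine _ (effect_sd_gt0 lt0 le0) i0 mie)).
have mS : measurable [set t : p.-tuple RB | A (cons_pt (e0 : RB, t))].
  by rewrite -[X in measurable X]setTI; exact: mcons.
by rewrite integral_indic// setIT.
Qed.

End gibbs_block.

Section noise.
Context (R : realType) (p : nat) (c1 c2 : R).
Local Notation RB := (measurableTypeR R).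
Local Notation noiseT := (RB * (RB * (RB * p.-tuple RB)))%type.
Local Open Scope ereal_scope.

Definition error_noise : probability (RB * (RB * p.-tuple RB))%type R :=
  (gamma_prob c2 1 \x normal_noise R p).

Definition noise : probability noiseT R := (gamma_prob c1 1 \x error_noise).

Lemma ge0_integral_noise (f : noiseT -> \bar R) :
  (forall w, 0 <= f w) -> measurable_fun setT f ->
  \int[noise]_w f w = \int[gamma_prob c1 1]_g1 \int[gamma_prob c2 1]_g2
    \int[normal_noise R p]_z f (g1, (g2, z)).
Proof.
move=> f0 mf; apply: (etrans (fubini_tonelli1 f mf f0)).
apply: eq_integral => g1 _; apply: (fubini_tonelli1 (fun w => f (g1, w))) => //.
exact: (measurableT_comp mf (pair1_measurable g1)).
Qed.

Let measurable_section (f : noiseT -> \bar R) g1 : measurable_fun setT f ->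
  measurable_fun setT (fun w => f (g1, w)).
Proof. by move=> mf; exact: (measurableT_comp mf (pair1_measurable g1)). Qed.

Lemma measurable_integral_error_noise (f : noiseT -> \bar R) :
  (forall w, 0 <= f w) -> measurable_fun setT f ->
  measurable_fun setT (fun g1 => \int[gamma_prob c2 1]_g2
    \int[normal_noise R p]_z f (g1, (g2, z))).
Proof.
move=> f0 mf.
rewrite (_ : (fun g1 => _) = fun g1 => \int[error_noise]_w f (g1, w)); last first.
  apply/funext => g1; apply/esym.
  by apply: (fubini_tonelli1 (fun w => f (g1, w))) => //; exact: measurable_section.
exact: (measurable_fun_fubini_tonelli_F f mf f0).
Qed.

Lemma measurable_integral_normal_noise (f : noiseT -> \bar R) (g1 : RB) :
  (forall w, 0 <= f w) -> measurable_fun setT f ->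
  measurable_fun setT (fun g2 => \int[normal_noise R p]_z f (g1, (g2, z))).
Proof.
move=> f0 mf.
apply: (measurable_fun_fubini_tonelli_F (fun w => f (g1, w))) => //.
exact: measurable_section.
Qed.

Hypotheses (c1_ge1 : (1 <= c1)%R) (c2_ge1 : (1 <= c2)%R).

Lemma le_integral_noise (f g : noiseT -> \bar R) :
  (forall w, 0 <= f w) -> measurable_fun setT f ->
  (forall w, 0 <= g w) -> measurable_fun setT g ->
  (forall w, (0 < w.1)%R -> (0 < w.2.1)%R -> f w <= g w) ->
  \int[noise]_w f w <= \int[noise]_w g w.
Proof.
move=> f0 mf g0 mg fg.
rewrite (ge0_integral_noise f0 mf) (ge0_integral_noise g0 mg).
have i0 h : (forall w : noiseT, 0 <= h w) -> forall g1 g2,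
    0 <= \int[normal_noise R p]_z h (g1, (g2, z)).
  by move=> h0 g1 g2; apply: integral_ge0.
apply: (le_integral_gamma_prob c1_ge1 ltr01).
- by move=> g1; apply: integral_ge0 => g2 _; exact: i0.
- exact: measurable_integral_error_noise.
- by move=> g1; apply: integral_ge0 => g2 _; exact: i0.
- exact: measurable_integral_error_noise.
move=> g1 g1_gt0; apply: (le_integral_gamma_prob c2_ge1 ltr01).
- by move=> g2; exact: i0.
- exact: measurable_integral_normal_noise.
- by move=> g2; exact: i0.
- exact: measurable_integral_normal_noise.
move=> g2 g2_gt0; apply: ge0_le_integral => //.
- exact: (measurableT_comp (measurable_section g1 mf) (pair1_measurable g2)).
- exact: (measurableT_comp (measurable_section g1 mg) (pair1_measurable g2)).
- by move=> z _; exact: fg.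
Qed.

(** The four independent sources of randomness enter the bounds through
    products, so that expectations factor. *)
Lemma integral_noise_prod (u v : RB -> R) (h : RB * p.-tuple RB -> R) (A B C : R) :
  (forall x, 0 <= u x)%R -> measurable_fun setT u ->
  (forall x, 0 <= v x)%R -> measurable_fun setT v ->
  (forall x, 0 <= h x)%R -> measurable_fun setT h ->
  \int[gamma_prob c1 1]_x (u x)%:E <= A%:E ->
  \int[gamma_prob c2 1]_x (v x)%:E <= B%:E ->
  \int[normal_noise R p]_z (h z)%:E <= C%:E ->
  \int[noise]_w (u w.1 * v w.2.1 * h w.2.2)%:E <= (A * B * C)%:E.
Proof.
move=> u0 mu v0 mv h0 mh uA vB hC.
have muE : measurable_fun setT (fun x => (u x)%:E) by exact/measurable_EFinP.
have mvE : measurable_fun setT (fun x => (v x)%:E) by exact/measurable_EFinP.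
have mhE : measurable_fun setT (fun x => (h x)%:E) by exact/measurable_EFinP.
have w0 w : 0 <= (u w.1 * v w.2.1 * h w.2.2)%:E.
  by rewrite lee_fin !mulr_ge0.
have mw : measurable_fun setT (fun w : noiseT => (u w.1 * v w.2.1 * h w.2.2)%:E).
  apply/measurable_EFinP; apply: measurable_funM.
    apply: measurable_funM; first exact: (measurableT_comp mu measurable_fst).
    apply: (measurableT_comp mv).
    exact: (measurableT_comp measurable_fst measurable_snd).
  apply: (measurableT_comp mh).
  exact: (measurableT_comp measurable_snd measurable_snd).
have ih0 : 0 <= \int[normal_noise R p]_z (h z)%:E.
  by apply: integral_ge0 => z _; rewrite lee_fin.
have iv0 : 0 <= \int[gamma_prob c2 1]_x (v x)%:E.
  by apply: integral_ge0 => z _; rewrite lee_fin.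
have iu0 : 0 <= \int[gamma_prob c1 1]_x (u x)%:E.
  by apply: integral_ge0 => z _; rewrite lee_fin.
set Ih := \int[normal_noise R p]_z _ in hC ih0.
set Iv := \int[gamma_prob c2 1]_x _ in vB iv0.
set Iu := \int[gamma_prob c1 1]_x _ in uA iu0.
have uE g1 g2 : \int[normal_noise R p]_z (u g1 * v g2 * h z)%:E =
    (u g1)%:E * ((v g2)%:E * Ih).
  transitivity (\int[normal_noise R p]_z ((u g1 * v g2)%:E * (h z)%:E)).
    by apply: eq_integral => z _; rewrite -EFinM.
  rewrite muleA -EFinM; apply: ge0_integralZl => //.
  - by move=> z _; rewrite lee_fin.
  - by rewrite lee_fin mulr_ge0.
have vE g1 : \int[gamma_prob c2 1]_g2 ((u g1)%:E * ((v g2)%:E * Ih)) =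
    (u g1)%:E * (Iv * Ih).
  transitivity ((u g1)%:E * \int[gamma_prob c2 1]_g2 ((v g2)%:E * Ih)).
    apply: ge0_integralZl => //.
    - by apply: emeasurable_funM => //; exact: measurable_cst.
    - by move=> g2 _; rewrite mule_ge0// lee_fin.
    - by rewrite lee_fin.
  by congr (_ * _); apply: ge0_integralZr => // g2 _; rewrite lee_fin.
have -> : \int[noise]_w (u w.1 * v w.2.1 * h w.2.2)%:E = Iu * (Iv * Ih).
  apply: (etrans (ge0_integral_noise w0 mw)).
  transitivity (\int[gamma_prob c1 1]_g1 ((u g1)%:E * (Iv * Ih))).
    apply: eq_integral => g1 _.
    transitivity (\int[gamma_prob c2 1]_g2 ((u g1)%:E * ((v g2)%:E * Ih))).
      by apply: eq_integral => g2 _; exact: uE.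
    exact: vE.
  apply: ge0_integralZr => //; first by move=> g1 _; rewrite lee_fin.
  exact: (mule_ge0 iv0 ih0).
clear uE vE; clearbody Iu Iv Ih; rewrite -mulrA !EFinM.
exact: (lee_pmul iu0 (mule_ge0 iv0 ih0) uA (lee_pmul iv0 ih0 vB hC)).
Qed.

End noise.

Section gibbs_noise.
Context (R : realType) (a1 a2 b1 b2 : R) (p r : nat) (y : 'M[R]_(p, r)).
Local Notation RB := (measurableTypeR R).
Local Notation T := (p.+1.-tuple RB).
Local Notation noiseT := (RB * (RB * (RB * p.-tuple RB)))%type.
Local Open Scope ereal_scope.

Definition theta_shape : R := p%:R / 2 + a1.
Definition e_shape : R := (r * p)%:R / 2 + a2.

Definition gibbs_noise : probability noiseT R := noise p theta_shape e_shape.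

(** A gamma variable of rate [b] is one of rate [1] divided by [b], so that the
    state moves from the law of the noise into the map. *)
Definition gibbs_map (eta : T) (w : noiseT) : T :=
  block_map y ((theta_rate b1 eta)^-1 * w.1)%R ((e_rate b2 y eta)^-1 * w.2.1)%R w.2.2.

Lemma measurable_theta_rate : measurable_fun setT (@theta_rate R b1 p).
Proof.
apply: measurable_funD => //; apply: measurable_funM => //.
exact: measurable_effect_sqr.
Qed.

Lemma measurable_e_rate : measurable_fun setT (e_rate b2 y).
Proof.
apply: measurable_funD => //; apply: measurable_funM => //.
exact: measurable_residual_sqr.
Qed.

Lemma measurable_gibbs_map :
  measurable_fun setT (fun u : T * noiseT => gibbs_map u.1 u.2).
Proof.
pose U := (T * noiseT)%type.
have mt : measurable_fun setT (fun u : U => (theta_rate b1 u.1)^-1 * u.2.1 : R)%R.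
  apply: measurable_funM.
    apply: (measurableT_comp (@measurable_invr R)).
    by apply: (measurableT_comp measurable_theta_rate); exact: measurable_fst.
  by apply: (measurableT_comp measurable_fst); exact: measurable_snd.
have me : measurable_fun setT (fun u : U => (e_rate b2 y u.1)^-1 * u.2.2.1 : R)%R.
  apply: measurable_funM.
    apply: (measurableT_comp (@measurable_invr R)).
    by apply: (measurableT_comp measurable_e_rate); exact: measurable_fst.
  apply: (measurableT_comp measurable_fst).
  by apply: (measurableT_comp measurable_snd); exact: measurable_snd.
have mg : measurable_fun setT (fun u : U =>
    ((((theta_rate b1 u.1)^-1 * u.2.1)%R : RB, ((e_rate b2 y u.1)^-1 * u.2.2.1)%R : RB),
     u.2.2.2)).
  apply: measurable_fun_pair; first exact: measurable_fun_pair.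
  apply: (measurableT_comp measurable_snd).
  by apply: (measurableT_comp measurable_snd); exact: measurable_snd.
exact: (measurableT_comp (measurable_block_map y) mg).
Qed.

Lemma measurable_gibbs_map1 eta : measurable_fun setT (gibbs_map eta).
Proof.
exact: (measurableT_comp measurable_gibbs_map (pair1_measurable eta)).
Qed.

Hypotheses (b1_gt0 : (0 < b1)%R) (b2_gt0 : (0 < b2)%R) (r_gt0 : (0 < r)%N).
Hypotheses (theta_ge1 : (1 <= theta_shape)%R) (e_ge1 : (1 <= e_shape)%R).

Lemma theta_rate_gt0 (eta : T) : (0 < theta_rate b1 eta)%R.
Proof.
rewrite /theta_rate ltr_wpDr// divr_ge0//.
by apply: sumr_ge0 => i _; exact: sqr_ge0.
Qed.

Lemma e_rate_gt0 (eta : T) : (0 < e_rate b2 y eta)%R.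
Proof.
rewrite /e_rate ltr_wpDr// divr_ge0//.
by apply: sumr_ge0 => i _; apply: sumr_ge0 => j _; exact: sqr_ge0.
Qed.

Lemma gibbs_noiseE (eta : T) A : measurable A -> gibbs a1 a2 b1 b2 y eta A =
  \int[gibbs_noise]_w (\1_A (gibbs_map eta w))%:E.
Proof.
move=> mA; rewrite gibbsE -/theta_shape -/e_shape.
have th0 := theta_rate_gt0 eta; have eh0 := e_rate_gt0 eta.
set th := theta_rate b1 eta in th0 *; set eh := e_rate b2 y eta in eh0 *.
pose B (u : RB * RB) := block_law y u.1 u.2 A.
have mB : measurable_fun setT B by exact: measurable_block_law.
have B0 u : 0 <= B u by exact: block_law_ge0.
pose F lt := \int[gamma_prob e_shape eh]_le B (lt, le).
have mF : measurable_fun setT F by exact: (measurable_fun_fubini_tonelli_F B mB B0).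
have F0 lt : 0 <= F lt by exact: integral_ge0.
pose I (w : noiseT) : \bar R := (\1_A (gibbs_map eta w))%:E.
have I0 w : 0 <= I w by rewrite lee_fin.
have mI : measurable_fun setT I.
  apply/measurable_EFinP.
  exact: (measurableT_comp (measurable_indic mA) (measurable_gibbs_map1 eta)).
apply: (etrans (ge0_integral_gamma_prob_rate theta_ge1 th0 F0 mF)).
apply/esym; rewrite /gibbs_noise.
apply: (etrans (@ge0_integral_noise R p theta_shape e_shape I I0 mI)); apply/esym.
apply: (eq_integral_gamma_prob theta_ge1 ltr01).
- by move=> g1; exact: F0.
- by apply: (measurableT_comp mF); exact: measurable_funM.
- by move=> g1; apply: integral_ge0 => g2 _; exact: integral_ge0.
- exact: measurable_integral_error_noise.
move=> g1 g1_gt0; rewrite /F.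
have mB1 : measurable_fun setT (fun le => B (th^-1 * g1, le)%R).
  exact: (measurableT_comp mB (pair1_measurable (th^-1 * g1 : RB)%R)).
apply: (etrans (ge0_integral_gamma_prob_rate e_ge1 eh0 (fun le => B0 _) mB1)).
apply: (eq_integral_gamma_prob e_ge1 ltr01).
- by move=> g2; exact: B0.
- by apply: (measurableT_comp mB1); exact: measurable_funM.
- by move=> g2; exact: integral_ge0.
- exact: measurable_integral_normal_noise.
by move=> g2 g2_gt0; apply: block_lawE => //; rewrite mulr_gt0// invr_gt0.
Qed.

End gibbs_noise.

(** * The posterior law and its invariance *)

Section posterior.
Context (R : realType) (a1 a2 b1 b2 : R) (p r : nat) (y : 'M[R]_(p, r)).
Local Notation RB := (measurableTypeR R).
Local Notation T := (p.+1.-tuple RB).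
Local Notation stateT := (RB * (RB * T))%type.
Local Notation mu := (@lebesgue_measure R).
Local Notation W := (posterior_weight a1 a2 b1 b2 y).
Local Notation theta_shape := (theta_shape a1 p).
Local Notation e_shape := (e_shape a2 p r).
Local Open Scope ereal_scope.

Let h (z : stateT) : R := posterior_fun a1 a2 b1 b2 y z.

Let mh : measurable_fun setT (fun z => (h z)%:E).
Proof. by apply/measurable_EFinP; exact: measurable_posterior_fun. Qed.

Let h0 z : 0 <= (h z)%:E.
Proof. by rewrite lee_fin posterior_fun_ge0. Qed.

Let base : {sigma_finite_measure set stateT -> \bar R} :=
  product2 mu (product2 mu (tuple_leb R p.+1)).

Lemma posterior_fun_gamma (lt le : RB) (eta : T) :
  posterior_fun a1 a2 b1 b2 y (lt, (le, eta)) =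
  (gamma_fun theta_shape (theta_rate b1 eta) lt *
   gamma_fun e_shape (e_rate b2 y eta) le)%R.
Proof.
rewrite /posterior_fun /gamma_fun /=.
case: (ltP 0%R lt) => /= lt0; last by rewrite mul0r.
case: (ltP 0%R le) => /= le0; last by rewrite mulr0.
rewrite /theta_shape /e_shape /theta_rate /e_rate.
rewrite -(addrA _ a1) -(addrA _ a2) !powRD ?(gt_eqF lt0) ?(gt_eqF le0) ?implybT//.
have -> : (- (b1 + effect_sqr eta / 2) * lt =
  - (lt / 2) * effect_sqr eta + - b1 * lt)%R by ring.
have -> : (- (b2 + residual_sqr y eta / 2) * le =
  - (le / 2) * residual_sqr y eta + - b2 * le)%R by ring.
rewrite !expRD; ring.
Qed.

(** The first half of the sampler keeps the state fixed and calls for an outermost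
    integral over the state; the second half keeps the precisions fixed, and is
    served by the opposite order below. *)
Lemma ge0_integral_posterior_weight (g : stateT -> \bar R) :
  (forall z, 0 <= g z) -> measurable_fun setT g ->
  \int[W]_z g z = \int[tuple_leb R p.+1]_eta \int[mu]_le \int[mu]_lt
    (g (lt, (le, eta)) * (h (lt, (le, eta)))%:E).
Proof.
move=> g0 mg.
have gh0 z : 0 <= g z * (h z)%:E by rewrite mule_ge0.
have mgh : measurable_fun setT (fun z => g z * (h z)%:E).
  exact: emeasurable_funM.
transitivity (\int[base]_z (g z * (h z)%:E)).
  apply: ge0_integral_density => //.
  exact: measurable_posterior_fun.
have E := @ge0_integral_product2 _ _ _ _ R mu (product2 mu (tuple_leb R p.+1)) _ gh0 mgh.
apply: (etrans E) => {E}.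
pose G (z : RB * T) := \int[mu]_lt (g (lt, z) * (h (lt, z))%:E).
have mG : measurable_fun setT G.
  exact: (@measurable_fun_fubini_tonelli_G _ _ _ _ _ mu _ mgh gh0).
have G0 z : 0 <= G z by apply: integral_ge0 => lt _; exact: gh0.
exact: (@ge0_integral_product2 _ _ _ _ R mu (tuple_leb R p.+1) G G0 mG).
Qed.

Lemma ge0_integral_posterior_weightC (g : stateT -> \bar R) :
  (forall z, 0 <= g z) -> measurable_fun setT g ->
  \int[W]_z g z = \int[mu]_lt \int[mu]_le \int[tuple_leb R p.+1]_eta
    (g (lt, (le, eta)) * (h (lt, (le, eta)))%:E).
Proof.
move=> g0 mg.
have gh0 z : 0 <= g z * (h z)%:E by rewrite mule_ge0.
have mgh : measurable_fun setT (fun z => g z * (h z)%:E).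
  exact: emeasurable_funM.
transitivity (\int[base]_z (g z * (h z)%:E)).
  apply: ge0_integral_density => //.
  exact: measurable_posterior_fun.
have E := @ge0_integral_product2C _ _ _ _ R mu (product2 mu (tuple_leb R p.+1)) _ gh0 mgh.
apply: (etrans E) => {E}; apply: eq_integral => lt _.
apply: (@ge0_integral_product2C _ _ _ _ R mu (tuple_leb R p.+1)
  (fun z => g (lt, z) * (h (lt, z))%:E)) => [z|]; first exact: gh0.
exact: (measurableT_comp mgh (pair1_measurable lt)).
Qed.

(** The density of the conditional law [block_law] of the state. *)
Definition block_pdf (lt le : R) (eta : T) : R :=
  normal_pdf (intercept_mean y) (intercept_sd r lt le) (intercept eta) *
  \prod_(i < p) normal_pdf (effect_mean y lt le (intercept eta) i)
    (effect_sd r lt le) (effect eta i).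

Lemma block_pdf_ge0 lt le eta : (0 <= block_pdf lt le eta)%R.
Proof.
rewrite mulr_ge0 ?normal_pdf_ge0//; apply: prodr_ge0 => i _.
exact: normal_pdf_ge0.
Qed.

Hypotheses (p_gt0 : (0 < p)%N) (r_gt0 : (0 < r)%N).

Definition within_sqr : R :=
  (\sum_(i < p) \sum_(j < r) (y i j - row_mean y i) ^+ 2)%R.
Definition between_sqr : R :=
  (\sum_(i < p) (row_mean y i - grand_mean y) ^+ 2)%R.

(** The deviations from a row mean add up to zero, which removes the cross term. *)
Lemma residual_sqrE eta : residual_sqr y eta = (within_sqr +
  r%:R * \sum_(i < p) (row_mean y i - intercept eta / Num.sqrt p%:R - effect eta i) ^+ 2)%R.
Proof.
have r0 : (r%:R != 0 :> R)%R by rewrite pnatr_eq0 -lt0n.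
rewrite /residual_sqr /within_sqr mulr_sumr -big_split/=; apply: eq_bigr => i _.
set c := (_ / _)%R; set e := effect eta i; set m := row_mean y i.
transitivity (\sum_(j < r) ((y i j - m) ^+ 2 + (y i j - m) * (2 * (m - c - e)) +
    (m - c - e) ^+ 2))%R; first by apply: eq_bigr => j _; ring.
rewrite !big_split/= -mulr_suml sumrB !sumr_const card_ord.
have -> : (\sum_(j < r) y i j = r%:R * m)%R by rewrite /m /row_mean mulrA mulfV ?mul1r.
rewrite -(mulr_natl m) -(mulr_natl (_ ^+ 2)); ring.
Qed.

Lemma sum_row_mean : (\sum_(i < p) row_mean y i = p%:R * grand_mean y)%R.
Proof.
have r0 : (r%:R != 0 :> R)%R by rewrite pnatr_eq0 -lt0n.
have p0 : (p%:R != 0 :> R)%R by rewrite pnatr_eq0 -lt0n.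
rewrite /row_mean /grand_mean -mulr_sumr natrM; field.
by rewrite r0 p0.
Qed.

Lemma sum_row_mean_sqr (e0 : R) :
  (\sum_(i < p) (row_mean y i - e0 / Num.sqrt p%:R) ^+ 2 =
   between_sqr + (e0 - intercept_mean y) ^+ 2)%R.
Proof.
have p0 : (0 < Num.sqrt p%:R :> R)%R by rewrite sqrtr_gt0 ltr0n.
have sp : (Num.sqrt p%:R ^+ 2 = p%:R :> R)%R by rewrite sqr_sqrtr.
rewrite /between_sqr /intercept_mean; set g := grand_mean y; set s := Num.sqrt _.
transitivity (\sum_(i < p) ((row_mean y i - g) ^+ 2 +
    (row_mean y i - g) * (2 * (g - e0 / s)) + (g - e0 / s) ^+ 2))%R.
  by apply: eq_bigr => i _; ring.
rewrite !big_split/= -mulr_suml sumrB !sumr_const card_ord sum_row_mean -/g.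
rewrite -(mulr_natl g) -(mulr_natl (_ ^+ 2)) subrr mul0r addr0; congr (_ + _)%R.
by rewrite -sp -/s; field; rewrite gt_eqF.
Qed.

Lemma measurable_normal_pdf_comp d (X : measurableType d) (m x : X -> R) (s : R) :
  (0 < s)%R -> measurable_fun setT m -> measurable_fun setT x ->
  measurable_fun setT (fun t => normal_pdf (m t) s (x t)).
Proof.
move=> s0 mm mx.
rewrite (_ : (fun t => _) = fun t => (normal_peak s *
    expR (- (x t - m t) ^+ 2 / (s ^+ 2 *+ 2)))%R); last first.
  by apply/funext => t; rewrite normal_pdfE ?gt_eqF.
apply: measurable_funM => //; apply: measurableT_comp => //.
apply: measurable_funM => //; apply: measurableT_comp => //.
by apply: measurable_funX; exact: measurable_funB.
Qed.

Lemma measurable_block_pdf lt le : (0 < lt)%R -> (0 < le)%R ->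
  measurable_fun setT (block_pdf lt le).
Proof.
move=> lt0 le0; apply: measurable_funM.
  apply: measurable_normal_pdf_comp => //; first exact: intercept_sd_gt0.
  exact: measurable_intercept.
apply: measurable_prod => i _.
apply: measurable_normal_pdf_comp; first exact: effect_sd_gt0.
  have mg : measurable_fun setT (fun eta : T => ((lt : RB, le : RB), intercept eta : RB)).
    by apply: measurable_fun_pair => //; exact: measurable_intercept.
  exact: (measurableT_comp (measurable_effect_mean y i) mg).
exact: measurable_effect.
Qed.

Lemma block_law_pdf lt le A : (0 < lt)%R -> (0 < le)%R -> measurable A ->
  block_law y lt le A =
  \int[tuple_leb R p.+1]_eta ((\1_A eta)%:E * (block_pdf lt le eta)%:E).
Proof.
move=> lt0 le0 mA.
have mi : measurable_fun setT (fun t : T => (\1_A t : R)%:E).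
  by apply/measurable_EFinP; exact: measurable_indic.
have mpdf : measurable_fun setT (fun t => (block_pdf lt le t)%:E).
  by apply/measurable_EFinP; exact: measurable_block_pdf.
pose F (t : T) := (\1_A t : R)%:E * (block_pdf lt le t)%:E.
have F0 t : 0 <= F t by rewrite mule_ge0// lee_fin ?block_pdf_ge0.
have mF : measurable_fun setT F by exact: emeasurable_funM.
have mcons (e0 : RB) : measurable_fun setT (fun t : p.-tuple RB => cons_pt (e0, t)).
  exact: (measurableT_comp (@measurable_cons_pt R p) (pair1_measurable e0)).
have E := @ge0_integral_tuple_prodSC R p (fun=> lebesgue_measure) F F0 mF.
apply: (etrans _ (esym E)) => {E}.
pose pi_ (e0 : R) (t : p.-tuple RB) := (\prod_(i < p)
  normal_pdf (effect_mean y lt le e0 i) (effect_sd r lt le) (tnth t i))%R.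
have pi0 e0 t : (0 <= pi_ e0 t)%R.
  by apply: prodr_ge0 => i _; exact: normal_pdf_ge0.
have s0 := intercept_sd_gt0 r_gt0 lt0 le0.
have FE e0 t : F (cons_pt (e0, t)) = ((\1_A (cons_pt (e0, t)))%:E * (pi_ e0 t)%:E) *
    (normal_pdf (intercept_mean y) (intercept_sd r lt le) e0)%:E.
  rewrite /F /block_pdf /intercept tnth0 mulrC EFinM muleA; congr (_ * _%:E * _).
  by apply: eq_bigr => i _; rewrite /effect tnthS.
pose J (e0 : RB) := \int[tuple_leb R p]_t ((\1_A (cons_pt (e0, t)) : R)%:E * (pi_ e0 t)%:E).
have Jint0 e0 t : 0 <= (\1_A (cons_pt (e0, t)) : R)%:E * (pi_ e0 t)%:E.
  by rewrite mule_ge0// lee_fin.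
have J0 e0 : 0 <= J e0 by apply: integral_ge0 => t _; exact: Jint0.
have mJ2 : measurable_fun setT (fun z : RB * p.-tuple RB =>
    (\1_A (cons_pt z) : R)%:E * (pi_ z.1 z.2)%:E).
  apply: emeasurable_funM.
    exact: (measurableT_comp mi (@measurable_cons_pt R p)).
  apply/measurable_EFinP; apply: measurable_prod => i _.
  apply: measurable_normal_pdf_comp; first exact: effect_sd_gt0.
    have mg : measurable_fun setT (fun z : RB * p.-tuple RB => ((lt : RB, le : RB), z.1)).
      by apply: measurable_fun_pair => //; exact: measurable_fst.
    exact: (measurableT_comp (measurable_effect_mean y i) mg).
  by apply: (measurableT_comp (measurable_tnth i)); exact: measurable_snd.
have mJ : measurable_fun setT J.
  apply: (@measurable_fun_fubini_tonelli_F _ _ _ _ _ (tuple_leb R p) _ mJ2).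
  by move=> z; rewrite mule_ge0// lee_fin.
transitivity (\int[normal_prob (intercept_mean y) (intercept_sd r lt le)]_e0 J e0).
  apply: eq_integral => e0 _.
  have mS : measurable [set t : p.-tuple RB | A (cons_pt (e0, t))].
    by rewrite -[X in measurable X]setTI; exact: mcons.
  transitivity (\int[tuple_prod (fun i : 'I_p =>
      normal_prob (effect_mean y lt le e0 i) (effect_sd r lt le))]_t
      (\1_A (cons_pt (e0, t)))%:E).
    by rewrite -[LHS](integral_indic_setT _ mS).
  apply: ge0_integral_tuple_normal; first by move=> t; rewrite lee_fin.
  exact: (measurableT_comp mi (mcons e0)).
apply: (etrans (ge0_integral_normal_prob _ _ J0 mJ)).
apply: eq_integral => e0 _; rewrite /J.
transitivity (\int[tuple_leb R p]_t ((\1_A (cons_pt (e0, t)) : R)%:E * (pi_ e0 t)%:E *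
    (normal_pdf (intercept_mean y) (intercept_sd r lt le) e0)%:E)).
  apply/esym; apply: ge0_integralZr => //.
  - exact: (measurableT_comp mJ2 (pair1_measurable e0)).
  - by rewrite lee_fin normal_pdf_ge0.
by apply: eq_integral => t _; rewrite -FE.
Qed.

(** What remains of the posterior density once the conditional density of the
    state has been factored out, obtained by completing the squares. *)
Definition block_weight (lt le : R) : R :=
  (lt `^ (theta_shape - 1) * le `^ (e_shape - 1) *
   expR (- b1 * lt - b2 * le - le / 2 * within_sqr -
     between_sqr / (intercept_sd r lt le ^+ 2 *+ 2)) /
   (normal_peak (intercept_sd r lt le) * normal_peak (effect_sd r lt le) ^+ p))%R.

(** Squares are completed first in each effect, then in the intercept; the latter
    leaves [between_sqr]. *)
Lemma posterior_fun_block lt le eta : (0 < lt)%R -> (0 < le)%R ->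
  posterior_fun a1 a2 b1 b2 y (lt, (le, eta)) =
  (block_weight lt le * block_pdf lt le eta)%R.
Proof.
move=> lt0 le0.
have s0 := intercept_sd_gt0 r_gt0 lt0 le0; have s1 := effect_sd_gt0 r_gt0 lt0 le0.
have r0 : (0 < r%:R :> R)%R by rewrite ltr0n.
have D0 : (0 < lt + r%:R * le)%R by rewrite addr_gt0// mulr_gt0.
have s0E : (intercept_sd r lt le ^+ 2 = (lt + r%:R * le) / (r%:R * le * lt))%R.
  by rewrite sqr_sqrtr// divr_ge0// ltW// !mulr_gt0.
have s1E : (effect_sd r lt le ^+ 2 = 1 / (lt + r%:R * le))%R.
  by rewrite sqr_sqrtr// divr_ge0// ltW.
have k0 := normal_peak_gt0 (lt0r_neq0 s0); have k1 := normal_peak_gt0 (lt0r_neq0 s1).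
rewrite posterior_fun_gamma /gamma_fun lt0 le0 /block_weight /block_pdf.
rewrite !normal_pdfE ?gt_eqF//.
under eq_bigr do rewrite normal_pdfE ?gt_eqF//.
rewrite big_split/= prodr_const card_ord /normal_fun -expR_sum.
rewrite {}s0E {}s1E.
set k := normal_peak _ in k0 *; set k' := normal_peak _ in k1 *.
set e0 := intercept eta.
have kk0 : (k * k' ^+ p != 0)%R by rewrite mulf_neq0 ?expf_neq0 ?gt_eqF.
set E1 := (- theta_rate _ _ * lt)%R; set E2 := (- e_rate _ _ _ * le)%R.
set E3 := (_ - between_sqr / _)%R; set E4 := (- (e0 - _) ^+ 2 / _)%R.
set E5 := (\sum_(i < p) _)%R.
transitivity (lt `^ (theta_shape - 1) * le `^ (e_shape - 1) * expR (E1 + E2))%R.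
  by rewrite expRD; ring.
have EE : (E1 + E2 = E3 + E4 + E5)%R; last first.
  rewrite EE !expRD.
  have k20 : (k != 0)%R by rewrite gt_eqF.
  have q0 : (k' ^+ p != 0)%R by rewrite expf_neq0 ?gt_eqF.
  move: k20 q0; move: (lt `^ _)%R (le `^ _)%R (expR E3) (expR E4) (expR E5) => u v x1 x2 x3.
  move: (k' ^+ p)%R => q k20 q0.
  by field; rewrite k20 q0.
rewrite /E1 /E2 /E3 /E4 /E5 /theta_rate /e_rate residual_sqrE.
have E6 : (E5 = - (lt + r%:R * le) / 2 * \sum_(i < p)
    (effect eta i - effect_mean y lt le e0 i) ^+ 2)%R.
  rewrite /E5 mulr_sumr; apply: eq_bigr => i _.
  by field; rewrite gt_eqF.
have E7 : (\sum_(i < p) (r%:R * le / 2 * (row_mean y i - e0 / Num.sqrt p%:R - effect eta i) ^+ 2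
    + lt / 2 * effect eta i ^+ 2) =
  \sum_(i < p) ((lt + r%:R * le) / 2 * (effect eta i - effect_mean y lt le e0 i) ^+ 2
    + (r%:R * le * lt) / (2 * (lt + r%:R * le)) *
       (row_mean y i - e0 / Num.sqrt p%:R) ^+ 2))%R.
  apply: eq_bigr => i _; rewrite /effect_mean; set c := (_ - e0 / _)%R.
  set x := effect eta i.
  by clearbody c x; field; rewrite gt_eqF.
rewrite !big_split/= -!mulr_sumr sum_row_mean_sqr in E7.
rewrite -/E5 E6 /effect_sqr -/e0.
move: E7; set S1 := (\sum_(i < p) _)%R; set S2 := (\sum_(i < p) _)%R.
set S3 := (\sum_(i < p) _)%R; set m0 := intercept_mean y; set q := r%:R in r0 D0 * => E7.
have -> : (- (b1 + S2 / 2) * lt + - (b2 + (within_sqr + q * S1) / 2) * le =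
  - b1 * lt - b2 * le - le / 2 * within_sqr - (q * le / 2 * S1 + lt / 2 * S2))%R.
  by field.
rewrite E7; field.
by rewrite !gt_eqF.
Qed.

End posterior.

(** Bounds for properness: the density of the precisions carries negative powers
    from the normalization of the normal densities. *)
Section proper_bound.
Context (R : realType).

Lemma le_1Dsqr (s : R) : s <= 1 + s ^+ 2.
Proof. by have := sqr_ge0 (s - 2^-1); lra. Qed.

Lemma expr_le_expR (n : nat) (b x : R) : 0 < b -> 0 < x ->
  (1 + x) ^+ n <= ((2 * n%:R + b) / b) ^+ n * expR (b / 2 * x).
Proof.
move=> b0 x0; have n0 : 0 <= n%:R :> R by [].
pose k : R := 2 * n%:R + b.
have k0 : 0 < k by rewrite /k ltr_wpDl// mulr_ge0.
have kb : b <= k by rewrite /k lerDr mulr_ge0.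
have h1 : 1 + x <= k / b * expR (b / k * x).
  apply: (@le_trans _ _ (k / b * (1 + b / k * x))).
    have -> : k / b * (1 + b / k * x) = k / b + x by field; rewrite !gt_eqF.
    by rewrite lerD2r ler_pdivlMr// mul1r.
  by apply: ler_wpM2l; [rewrite divr_ge0 ?ltW//|exact: expR_ge1Dx].
apply: (@le_trans _ _ ((k / b * expR (b / k * x)) ^+ n)).
  have x1 : 0 <= 1 + x by rewrite addr_ge0// ltW.
  by apply: lerXn2r => //; rewrite nnegrE; exact: le_trans h1.
rewrite exprMn -expRM_natl; apply: ler_wpM2l; first by rewrite exprn_ge0// divr_ge0 ?ltW//.
rewrite ler_expR mulrA; apply: ler_wpM2r; first exact: ltW.
rewrite mulrA ler_pdivrMr// /k; have : 0 <= b * b by rewrite mulr_ge0// ltW.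
by move: n0; move: n%:R => m; clear; lra.
Qed.

(** Negative powers of the argument are traded against a smaller shape, and the
    positive powers that appear against a smaller rate. *)
Lemma gamma_fun_addV_le (n : nat) (a b x : R) : 0 < b -> 0 < x ->
  x `^ (a - 1) * expR (- b * x) * (1 + x^-1) ^+ n <=
  ((2 * n%:R + b) / b) ^+ n * gamma_fun (a - n%:R) (b / 2) x.
Proof.
move=> b0 x0; rewrite /gamma_fun x0.
have -> : 1 + x^-1 = (1 + x) / x by field; rewrite gt_eqF.
have -> : x `^ (a - n%:R - 1) = x `^ (a - 1) / x ^+ n.
  rewrite -powR_invn ?ltW// -powRD ?(gt_eqF x0) ?implybT//.
  by congr (_ `^ _); ring.
rewrite exprMn exprVn.
have -> : - b * x = - (b / 2) * x + - (b / 2 * x) by field.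
rewrite expRD expRN; have e0 := expR_gt0 (b / 2 * x).
have := expr_le_expR n b0 x0; set K := (_ / b) ^+ n; set q := (1 + x) ^+ n.
have : 0 < x ^+ n by rewrite exprn_gt0.
have : 0 <= x `^ (a - 1) * expR (- (b / 2) * x) by rewrite mulr_ge0 ?powR_ge0 ?expR_ge0.
move: e0; set e := expR _; move: (x `^ _) (expR _) (x ^+ n) => u v w.
move=> e0 uv0 w0 qK.
have -> : u * (v * e^-1) * (q / w) = (u * v / w) * (q / e).
  by field; rewrite !gt_eqF.
have -> : K * (u / w * v) = (u * v / w) * K by field; rewrite gt_eqF.
apply: ler_wpM2l; first by apply: divr_ge0 => //; exact: ltW.
by rewrite ler_pdivrMr.
Qed.

End proper_bound.

Section stationarity.
Context (R : realType) (a1 a2 b1 b2 : R) (p r : nat) (y : 'M[R]_(p, r)).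
Local Notation RB := (measurableTypeR R).
Local Notation T := (p.+1.-tuple RB).
Local Notation stateT := (RB * (RB * T))%type.
Local Notation mu := (@lebesgue_measure R).
Local Notation W := (posterior_weight a1 a2 b1 b2 y).
Local Notation theta_shape := (theta_shape a1 p).
Local Notation e_shape := (e_shape a2 p r).
Local Notation h := (posterior_fun a1 a2 b1 b2 y).
Local Open Scope ereal_scope.

Hypotheses (b1_gt0 : (0 < b1)%R) (b2_gt0 : (0 < b2)%R).
Hypotheses (p_gt0 : (0 < p)%N) (r_gt0 : (0 < r)%N).

Let mh : measurable_fun setT (fun z : stateT => (h z)%:E).
Proof. by apply/measurable_EFinP; exact: measurable_posterior_fun. Qed.

Let h0 (z : stateT) : 0 <= (h z)%:E.
Proof. by rewrite lee_fin posterior_fun_ge0. Qed.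

Let mheta (lt le : RB) : measurable_fun setT (fun eta => (h (lt, (le, eta)))%:E).
Proof.
have m1 := measurableT_comp mh (pair1_measurable lt).
exact: (measurableT_comp m1 (pair1_measurable le)).
Qed.

Lemma posterior_fun_le0 (lt le : RB) (eta : T) : ~~ ((0 < lt) && (0 < le))%R ->
  h (lt, (le, eta)) = 0%R.
Proof. by move=> n; rewrite /posterior_fun /= (negbTE n). Qed.

Lemma block_weight_gt0 lt le : (0 < lt)%R -> (0 < le)%R ->
  (0 < block_weight a1 a2 b1 b2 y lt le)%R.
Proof.
move=> lt0 le0.
have s0 := intercept_sd_gt0 r_gt0 lt0 le0; have s1 := effect_sd_gt0 r_gt0 lt0 le0.
rewrite /block_weight; apply: divr_gt0.
  by rewrite !mulr_gt0 ?powR_gt0 ?expR_gt0.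
apply: mulr_gt0; first exact: normal_peak_gt0 (lt0r_neq0 s0).
by apply: exprn_gt0; exact: normal_peak_gt0 (lt0r_neq0 s1).
Qed.

(** This is what makes the second half of the sampler preserve the posterior: it
    draws from the conditional law of the state given the precisions. *)
Lemma integral_posterior_fun_block (lt le : RB) A : (0 < lt)%R -> (0 < le)%R ->
  measurable A ->
  \int[tuple_leb R p.+1]_eta ((\1_A eta)%:E * (h (lt, (le, eta)))%:E) =
  (block_weight a1 a2 b1 b2 y lt le)%:E * block_law y lt le A.
Proof.
move=> lt0 le0 mA.
have w0 := block_weight_gt0 lt0 le0.
have mpdf : measurable_fun setT (fun t => (block_pdf y lt le t)%:E).
  by apply/measurable_EFinP; exact: measurable_block_pdf.
have mi : measurable_fun setT (fun t : T => (\1_A t : R)%:E).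
  by apply/measurable_EFinP; exact: measurable_indic.
rewrite (block_law_pdf y r_gt0 lt0 le0 mA).
transitivity (\int[tuple_leb R p.+1]_eta ((block_weight a1 a2 b1 b2 y lt le)%:E *
    ((\1_A eta)%:E * (block_pdf y lt le eta)%:E))).
  apply: eq_integral => eta _; rewrite muleCA -EFinM.
  by rewrite (posterior_fun_block _ _ _ _ _ p_gt0 r_gt0 _ lt0 le0).
apply: ge0_integralZl => //.
- exact: emeasurable_funM.
- by move=> t _; rewrite mule_ge0// lee_fin ?block_pdf_ge0.
- by rewrite lee_fin ltW.
Qed.

Let block_lawT lt le : block_law y lt le setT = 1.
Proof. by have [k ->] := block_law_pkernel y; exact: prob_kernel. Qed.

Lemma integral_posterior_fun (lt le : RB) : (0 < lt)%R -> (0 < le)%R ->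
  \int[tuple_leb R p.+1]_eta (h (lt, (le, eta)))%:E =
  (block_weight a1 a2 b1 b2 y lt le)%:E.
Proof.
move=> lt0 le0; have := integral_posterior_fun_block lt0 le0 measurableT.
rewrite block_lawT mule1 => <-; apply: eq_integral => eta _.
by rewrite indicT mul1e.
Qed.

(** Each standard deviation is at most [1] plus its square, hence is bounded by a
    polynomial in the inverses of the precisions. Their product has degree [1] in
    [lt^-1] and [p.+1] in [le^-1], and the shapes are lowered by as much. *)
Lemma block_weight_le : exists2 C : R, (0 <= C)%R & forall lt le : R,
  (0 < lt)%R -> (0 < le)%R -> (block_weight a1 a2 b1 b2 y lt le <=
    C * (gamma_fun (theta_shape - 1) (b1 / 2) lt *
         gamma_fun (e_shape - p.+1%:R) (b2 / 2) le))%R.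
Proof.
pose q : R := Num.sqrt (pi *+ 2).
have q0 : (0 <= q)%R by exact: sqrtr_ge0.
pose K1 : R := (((2 * 1%:R + b1) / b1) ^+ 1)%R.
pose K2 : R := (((2 * p.+1%:R + b2) / b2) ^+ p.+1)%R.
have K10 : (0 <= K1)%R by rewrite exprn_ge0// divr_ge0// ?ltW// addr_gt0.
have K20 : (0 <= K2)%R.
  by rewrite exprn_ge0// divr_ge0// ?ltW// ltr_wpDl// mulr_ge0.
exists (q ^+ p.+1 * (K1 * K2))%R.
  by apply: mulr_ge0; [exact: exprn_ge0|exact: mulr_ge0].
move=> lt le lt0 le0.
have s0 := intercept_sd_gt0 r_gt0 lt0 le0; have s1 := effect_sd_gt0 r_gt0 lt0 le0.
have r0 : (1 <= r%:R :> R)%R by rewrite ler1n.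
have rle0 : (0 < r%:R * le)%R by rewrite mulr_gt0// (lt_le_trans ltr01).
have ltV : (0 < lt^-1)%R by rewrite invr_gt0.
have leV : (0 < le^-1)%R by rewrite invr_gt0.
have D0 : (0 < lt + r%:R * le)%R by rewrite addr_gt0// mulr_gt0// (lt_le_trans ltr01).
have s0E : (intercept_sd r lt le ^+ 2 = lt^-1 + (r%:R * le)^-1)%R.
  rewrite sqr_sqrtr; last by rewrite divr_ge0 ?ltW// !mulr_gt0// (lt_le_trans ltr01).
  by field; rewrite !gt_eqF// (lt_le_trans ltr01).
have s1E : (effect_sd r lt le ^+ 2 = (lt + r%:R * le)^-1)%R.
  by rewrite /effect_sd div1r sqr_sqrtr// invr_ge0 ltW.
have rle : ((r%:R * le)^-1 <= le^-1)%R.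
  by rewrite lef_pV2 ?posrE//; apply: ler_peMl => //; exact: ltW.
have s0le : (intercept_sd r lt le <= (1 + lt^-1) * (1 + le^-1))%R.
  apply: (@le_trans _ _ (1 + intercept_sd r lt le ^+ 2))%R.
    exact: le_1Dsqr.
  rewrite s0E; have : (0 <= lt^-1 * le^-1)%R by rewrite mulr_ge0// ltW.
  by move: rle; set u := (lt^-1)%R; set v := (le^-1)%R; lra.
have s1le : (effect_sd r lt le <= 1 + le^-1)%R.
  apply: (@le_trans _ _ (1 + effect_sd r lt le ^+ 2))%R.
    exact: le_1Dsqr.
  rewrite s1E lerD2l; apply: le_trans rle.
  by rewrite lef_pV2 ?posrE// lerDr ltW.
have peakV s : (0 < s)%R -> ((normal_peak s)^-1 = s * q)%R.
  move=> sp; rewrite /normal_peak invrK -mulrnAr sqrtrM ?sqr_ge0//.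
  by rewrite sqrtr_sqr gtr0_norm.
rewrite /block_weight invfM -exprVn !peakV//.
set E := expR _.
have E_le : (E <= expR (- b1 * lt) * expR (- b2 * le))%R.
  rewrite -expRD ler_expR.
  have : (0 <= le / 2 * within_sqr y)%R.
    apply: mulr_ge0; first by apply: divr_ge0 => //; exact: ltW.
    by apply: sumr_ge0 => i _; apply: sumr_ge0 => j _; exact: sqr_ge0.
  have : (0 <= between_sqr y / (intercept_sd r lt le ^+ 2 *+ 2))%R.
    apply: divr_ge0; last by rewrite mulrn_wge0 ?sqr_ge0.
    by apply: sumr_ge0 => i _; exact: sqr_ge0.
  by lra.
have P_le : (intercept_sd r lt le * q * (effect_sd r lt le * q) ^+ p <=
    q ^+ p.+1 * ((1 + lt^-1) ^+ 1 * (1 + le^-1) ^+ p.+1))%R.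
  rewrite exprMn.
  have -> : (intercept_sd r lt le * q * (effect_sd r lt le ^+ p * q ^+ p) =
    q ^+ p.+1 * (intercept_sd r lt le * effect_sd r lt le ^+ p))%R.
    by rewrite exprS; ring.
  apply: ler_wpM2l; first exact: exprn_ge0.
  rewrite expr1 exprS mulrA; apply: ler_pM => //.
  - exact: ltW.
  - by rewrite exprn_ge0// ltW.
  - by rewrite lerXn2r// nnegrE ltW// addr_gt0.
have h1 := gamma_fun_addV_le 1 theta_shape b1_gt0 lt0.
have h2 := gamma_fun_addV_le p.+1 e_shape b2_gt0 le0.
rewrite -/K1 in h1; rewrite -/K2 in h2.
set u := (lt `^ _)%R in h1 *; set v := (le `^ _)%R in h2 *.
have u0 : (0 <= u)%R by exact: powR_ge0.
have v0 : (0 <= v)%R by exact: powR_ge0.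
apply: (@le_trans _ _ (u * v * (expR (- b1 * lt) * expR (- b2 * le)) *
  (q ^+ p.+1 * ((1 + lt^-1) ^+ 1 * (1 + le^-1) ^+ p.+1))))%R.
  apply: ler_pM => //.
  - by rewrite !mulr_ge0// expR_ge0.
  - by rewrite !mulr_ge0 ?exprn_ge0 ?mulr_ge0// ltW.
  - by apply: ler_wpM2l; rewrite ?mulr_ge0.
have -> : (u * v * (expR (- b1 * lt) * expR (- b2 * le)) *
    (q ^+ p.+1 * ((1 + lt^-1) ^+ 1 * (1 + le^-1) ^+ p.+1)) =
  q ^+ p.+1 * ((u * expR (- b1 * lt) * (1 + lt^-1) ^+ 1) *
    (v * expR (- b2 * le) * (1 + le^-1) ^+ p.+1)))%R by ring.
rewrite -[in leRHS]mulrA; apply: ler_wpM2l; first exact: exprn_ge0.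
have -> (g1 g2 : R) : (K1 * K2 * (g1 * g2) = (K1 * g1) * (K2 * g2))%R by ring.
apply: ler_pM => //.
- by rewrite !mulr_ge0 ?expR_ge0 ?exprn_ge0// addr_ge0// ltW.
- by rewrite !mulr_ge0 ?expR_ge0 ?exprn_ge0// addr_ge0// ltW.
Qed.

Let I (lt le : RB) : \bar R := \int[tuple_leb R p.+1]_eta (h (lt, (le, eta)))%:E.

Let I0 lt le : 0 <= I lt le.
Proof. by apply: integral_ge0 => eta _; exact: h0. Qed.

Let mhlt (lt : RB) : measurable_fun setT (fun z => (h (lt, z))%:E).
Proof. exact: (measurableT_comp mh (pair1_measurable lt)). Qed.

Let mI lt : measurable_fun setT (I lt).
Proof.
by apply: (@measurable_fun_fubini_tonelli_F _ _ _ _ _ (tuple_leb R p.+1) _ (mhlt lt)).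
Qed.

Let mII : measurable_fun setT (fun lt => \int[mu]_le I lt le).
Proof.
rewrite (_ : (fun lt => _) =
    fun lt => \int[product2 mu (tuple_leb R p.+1)]_z (h (lt, z))%:E); last first.
  apply/funext => lt; apply/esym.
  exact: (@ge0_integral_product2C _ _ _ _ R mu (tuple_leb R p.+1) (fun z => (h (lt, z))%:E)).
exact: (@measurable_fun_fubini_tonelli_F _ _ _ _ _
  (product2 mu (tuple_leb R p.+1)) _ mh h0).
Qed.

Let posterior_weight_setTE :
  W setT = \int[mu]_lt \int[mu]_le I lt le.
Proof.
transitivity (\int[W]_z (cst 1 z)); first by rewrite integral_cst// mul1e.
have E := @ge0_integral_posterior_weightC R a1 a2 b1 b2 p r y (cst 1)
  (fun=> lee01) (measurable_cst _).
apply: (etrans E); apply: eq_integral => lt _; apply: eq_integral => le _.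
by apply: eq_integral => eta _; rewrite mul1e.
Qed.

Lemma posterior_weight_gt0 : 0 < W setT.
Proof.
rewrite posterior_weight_setTE; apply: integral_gt0 => //.
  by move=> lt; apply: integral_ge0 => le _; exact: I0.
move=> lt lt0; apply: integral_gt0 ; [exact: I0|exact: mI|].
move=> le le0; rewrite /I integral_posterior_fun// lte_fin.
exact: block_weight_gt0.
Qed.

Lemma posterior_weight_lty : (2 <= theta_shape)%R ->
  (p.+1%:R + 1 <= e_shape)%R -> W setT < +oo.
Proof.
move=> th2 eh2.
have [C C0 CP] := block_weight_le.
have th1 : (1 <= theta_shape - 1)%R by rewrite lerBrDr; exact: th2.
have eh1 : (1 <= e_shape - p.+1%:R)%R by rewrite lerBrDl.
have b10 : (0 < b1 / 2)%R by rewrite divr_gt0.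
have b20 : (0 < b2 / 2)%R by rewrite divr_gt0.
pose f1 (lt : RB) : R := gamma_fun (theta_shape - 1) (b1 / 2) lt.
pose f2 (le : RB) : R := gamma_fun (e_shape - p.+1%:R) (b2 / 2) le.
have f10 lt : (0 <= f1 lt)%R by exact: gamma_fun_ge0.
have f20 le : (0 <= f2 le)%R by exact: gamma_fun_ge0.
have mf1 : measurable_fun setT (fun x => (f1 x)%:E) by exact: measurable_gamma_funE.
have mf2 : measurable_fun setT (fun x => (f2 x)%:E) by exact: measurable_gamma_funE.
have [M1 M10 M1E] : exists2 M1 : R, (0 <= M1)%R & \int[mu]_x (f1 x)%:E = M1%:E.
  exists ((b1 / 2) `^ (- (theta_shape - 1)) * Gamma (theta_shape - 1))%R.
    by rewrite mulr_ge0 ?powR_ge0// ltW// Gamma_gt0.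
  exact: gamma_weightE.
have [M2 M20 M2E] : exists2 M2 : R, (0 <= M2)%R & \int[mu]_x (f2 x)%:E = M2%:E.
  exists ((b2 / 2) `^ (- (e_shape - p.+1%:R)) * Gamma (e_shape - p.+1%:R))%R.
    by rewrite mulr_ge0 ?powR_ge0// ltW// Gamma_gt0.
  exact: gamma_weightE.
have I_le lt le : I lt le <= (C * f1 lt)%:E * (f2 le)%:E.
  have [/andP[lt0 le0]|n0] := boolP ((0 < lt) && (0 < le))%R.
    by rewrite /I integral_posterior_fun// -EFinM lee_fin -mulrA CP.
  rewrite /I integral0_eq; first by rewrite -EFinM lee_fin !mulr_ge0.
  by move=> eta _; rewrite posterior_fun_le0.
have II_le lt : \int[mu]_le I lt le <= (C * M2)%:E * (f1 lt)%:E.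
  apply: (@le_trans _ _ (\int[mu]_le ((C * f1 lt)%:E * (f2 le)%:E))).
    apply: ge0_le_integral => //.
    exact: measurable_funeM.
  rewrite ge0_integralZl//; last 2 first.
  - by move=> x _; rewrite lee_fin.
  - by rewrite lee_fin mulr_ge0.
  by rewrite M2E -!EFinM lee_fin mulrAC.
rewrite posterior_weight_setTE.
apply: (@le_lt_trans _ _ (\int[mu]_lt ((C * M2)%:E * (f1 lt)%:E))).
  apply: ge0_le_integral => //.
  - by move=> lt _; apply: integral_ge0 => le _; exact: I0.
  - exact: measurable_funeM.
rewrite ge0_integralZl//; last 2 first.
- by move=> x _; rewrite lee_fin.
- by rewrite lee_fin mulr_ge0.
by rewrite M1E -EFinM ltry.
Qed.

Hypotheses (theta_ge1 : (1 <= theta_shape)%R) (e_ge1 : (1 <= e_shape)%R).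

(** This is what makes the first half of the sampler preserve the posterior: for a
    fixed state, the density is a product of two gamma densities. *)
Lemma integral_posterior_fun_gibbs (eta : T) A : measurable A ->
  \int[mu]_le \int[mu]_lt
    (gibbs a1 a2 b1 b2 y eta A * (h (lt, (le, eta)))%:E) =
  \int[mu]_le \int[mu]_lt (block_law y lt le A * (h (lt, (le, eta)))%:E).
Proof.
move=> mA.
have th0 := theta_rate_gt0 b1_gt0 eta; have eh0 := e_rate_gt0 y b2_gt0 eta.
set th := theta_rate b1 eta in th0; set eh := e_rate b2 y eta in eh0.
pose f1 (lt : RB) : R := gamma_fun theta_shape th lt.
pose f2 (le : RB) : R := gamma_fun e_shape eh le.
have hE lt le : (h (lt, (le, eta)))%:E = (f1 lt)%:E * (f2 le)%:E.
  by rewrite posterior_fun_gamma EFinM.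
have f10 lt : 0 <= (f1 lt)%:E by rewrite lee_fin gamma_fun_ge0.
have f20 le : 0 <= (f2 le)%:E by rewrite lee_fin gamma_fun_ge0.
have mf1 : measurable_fun setT (fun x => (f1 x)%:E) by exact: measurable_gamma_funE.
have mf2 : measurable_fun setT (fun x => (f2 x)%:E) by exact: measurable_gamma_funE.
pose N1 : R := (th `^ (- theta_shape) * Gamma theta_shape)%R.
pose N2 : R := (eh `^ (- e_shape) * Gamma e_shape)%R.
have N10 : (0 < N1)%R by rewrite mulr_gt0 ?powR_gt0 ?Gamma_gt0.
have N20 : (0 < N2)%R by rewrite mulr_gt0 ?powR_gt0 ?Gamma_gt0.
have N1E : \int[mu]_x (f1 x)%:E = N1%:E by exact: gamma_weightE.
have N2E : \int[mu]_x (f2 x)%:E = N2%:E by exact: gamma_weightE.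
pose B (u : RB * RB) := block_law y u.1 u.2 A.
have mB : measurable_fun setT B by exact: measurable_block_law.
have B0 u : 0 <= B u by exact: block_law_ge0.
pose H (u : RB * RB) := B u * ((f1 u.1)%:E * (f2 u.2)%:E).
have H0 u : 0 <= H u by rewrite !mule_ge0.
have mH : measurable_fun setT H.
  apply: emeasurable_funM => //; apply: emeasurable_funM.
    exact: (measurableT_comp mf1 measurable_fst).
  exact: (measurableT_comp mf2 measurable_snd).
pose F lt := \int[gamma_prob e_shape eh]_le B (lt, le).
have mF : measurable_fun setT F by exact: (measurable_fun_fubini_tonelli_F B mB B0).
have F0 lt : 0 <= F lt by exact: integral_ge0.
have mBs lt : measurable_fun setT (fun le => B (lt, le)).
  exact: (measurableT_comp mB (pair1_measurable (lt : RB))).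
set G := gibbs a1 a2 b1 b2 y eta A.
have G0 : 0 <= G by exact: measure_ge0.
have GE : G = (N1^-1)%:E * \int[mu]_lt (F lt * (f1 lt)%:E).
  exact: (ge0_integral_gamma_prob theta_ge1 th0 F0 mF).
have FE lt : F lt = (N2^-1)%:E * \int[mu]_le (B (lt, le) * (f2 le)%:E).
  exact: (ge0_integral_gamma_prob e_ge1 eh0 (fun le => B0 _) (mBs lt)).
have BE lt le : block_law y lt le A = B (lt, le) by [].
have HE lt le : H (lt, le) = B (lt, le) * ((f1 lt)%:E * (f2 le)%:E) by [].
clearbody H B F G f1 f2 N1 N2.
transitivity (G * (N1%:E * N2%:E)).
  transitivity (\int[mu]_le (G * N1%:E * (f2 le)%:E)).
    apply: eq_integral => le _.
    transitivity (\int[mu]_lt (G * (f2 le)%:E * (f1 lt)%:E)).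
      by apply: eq_integral => lt _; rewrite hE -muleA; congr (_ * _); rewrite muleC.
    transitivity (G * (f2 le)%:E * \int[mu]_lt (f1 lt)%:E).
      by apply: ge0_integralZl => //; exact: mule_ge0.
    by rewrite N1E -!muleA; congr (_ * _); rewrite muleC.
  transitivity (G * N1%:E * \int[mu]_le (f2 le)%:E).
    by apply: ge0_integralZl => //; rewrite mule_ge0// lee_fin ltW.
  by rewrite N2E muleA.
transitivity (\int[mu]_le \int[mu]_lt H (lt, le)); last first.
  by apply: eq_integral => le _; apply: eq_integral => lt _; rewrite hE HE BE.
transitivity (\int[mu]_lt \int[mu]_le H (lt, le)); last first.
  exact: (@fubini_tonelli _ _ _ _ _ mu mu H mH H0).
transitivity (\int[mu]_lt (N2%:E * (F lt * (f1 lt)%:E))).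
  transitivity (N2%:E * \int[mu]_lt (F lt * (f1 lt)%:E)); last first.
    apply/esym; apply: ge0_integralZl => //.
    - exact: emeasurable_funM.
    - by move=> lt _; exact: mule_ge0.
    - by rewrite lee_fin ltW.
  rewrite GE muleC !muleA -EFinM; congr (_%:E * _).
  by field; rewrite gt_eqF.
apply: eq_integral => lt _; rewrite FE muleA muleA -EFinM mulfV ?gt_eqF// mul1e.
transitivity (\int[mu]_le (B (lt, le) * (f2 le)%:E * (f1 lt)%:E)).
  apply/esym; apply: ge0_integralZr => //.
  - exact: emeasurable_funM.
  - by move=> le _; exact: mule_ge0.
by apply: eq_integral => le _; rewrite HE -muleA; congr (_ * _); rewrite muleC.
Qed.

Let msnd2 : measurable_fun setT (fun z : stateT => z.2.2).
Proof. exact: (measurableT_comp measurable_snd measurable_snd). Qed.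

Let posterior_weight_stationary A : measurable A ->
  \int[W]_z gibbs a1 a2 b1 b2 y z.2.2 A = \int[W]_z (\1_A z.2.2)%:E.
Proof.
move=> mA.
have mg : measurable_fun setT (fun z : stateT => gibbs a1 a2 b1 b2 y z.2.2 A).
  exact: (measurableT_comp
    (measurable_kernel (gibbs_kernel a1 a2 b1 b2 y) _ mA) msnd2).
have mi : measurable_fun setT (fun z : stateT => (\1_A z.2.2 : R)%:E).
  by apply/measurable_EFinP; exact: (measurableT_comp (measurable_indic mA) msnd2).
have mb : measurable_fun setT (fun z : stateT => block_law y z.1 z.2.1 A).
  have mp : measurable_fun setT (fun z : stateT => (z.1, z.2.1)).
    apply: measurable_fun_pair => //.
    exact: (measurableT_comp measurable_fst measurable_snd).
  exact: (measurableT_comp (measurable_block_law y mA) mp).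
have g0 (z : stateT) : 0 <= gibbs a1 a2 b1 b2 y z.2.2 A by exact: measure_ge0.
have i0 (z : stateT) : 0 <= (\1_A z.2.2 : R)%:E by rewrite lee_fin.
have bl0 (z : stateT) : 0 <= block_law y z.1 z.2.1 A by exact: block_law_ge0.
have key (lt le : RB) :
    \int[tuple_leb R p.+1]_eta (block_law y lt le A * (h (lt, (le, eta)))%:E) =
    \int[tuple_leb R p.+1]_eta ((\1_A eta)%:E * (h (lt, (le, eta)))%:E).
  have [/andP[lt0 le0]|n0] := boolP ((0 < lt) && (0 < le))%R; last first.
    by apply: eq_integral => eta _; rewrite posterior_fun_le0// !mule0.
  rewrite (integral_posterior_fun_block lt0 le0 mA) muleC.
  rewrite -(integral_posterior_fun lt0 le0).
  apply: ge0_integralZl => //.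
  exact: block_law_ge0.
transitivity (\int[W]_z block_law y z.1 z.2.1 A).
  apply: (etrans (ge0_integral_posterior_weight _ _ _ _ _ g0 mg)).
  apply: (etrans _ (esym (ge0_integral_posterior_weight _ _ _ _ _ bl0 mb))).
  by apply: eq_integral => eta _; exact: integral_posterior_fun_gibbs.
apply: (etrans (ge0_integral_posterior_weightC _ _ _ _ _ bl0 mb)).
apply: (etrans _ (esym (ge0_integral_posterior_weightC _ _ _ _ _ i0 mi))).
apply: eq_integral => lt _; apply: eq_integral => le _; exact: key.
Qed.

Hypothesis proper : W setT < +oo.

Lemma ge0_integral_eta_posterior (f : T -> \bar R) :
  (forall eta, 0 <= f eta) -> measurable_fun setT f ->
  \int[eta_posterior a1 a2 b1 b2 y]_eta f eta =
  ((fine (W setT))^-1)%:E * \int[W]_z f z.2.2.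
Proof.
move=> f0 mf.
have Wfin : W setT = (fine (W setT))%:E.
  by rewrite fineK// ge0_fin_numE.
have W0 : (0 < fine (W setT))%R by rewrite -lte_fin -Wfin posterior_weight_gt0.
have k0 : (0 <= (fine (W setT))^-1)%R by rewrite invr_ge0 ltW.
have mf2 : measurable_fun setT (fun z : stateT => f z.2.2).
  exact: (measurableT_comp mf msnd2).
transitivity (\int[posterior a1 a2 b1 b2 y]_z f z.2.2).
  exact: (ge0_integral_pushforward msnd2 (posterior a1 a2 b1 b2 y) measurableT mf).
transitivity (\int[mscale (NngNum k0) W]_z f z.2.2).
  apply: eq_measure_integral => A mA _.
  exact: (mnormalizeE _ _ Wfin W0).
by apply: ge0_integral_mscale.
Qed.

Lemma eta_posterior_stationary A : measurable A ->
  \int[eta_posterior a1 a2 b1 b2 y]_eta gibbs a1 a2 b1 b2 y eta A =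
  eta_posterior a1 a2 b1 b2 y A.
Proof.
move=> mA.
have mg : measurable_fun setT (fun eta => gibbs a1 a2 b1 b2 y eta A).
  exact: (measurable_kernel (gibbs_kernel a1 a2 b1 b2 y) _ mA).
have mi : measurable_fun setT (fun eta : T => (\1_A eta : R)%:E).
  by apply/measurable_EFinP; exact: measurable_indic.
have i0 (eta : T) : 0 <= (\1_A eta : R)%:E by rewrite lee_fin.
apply: (etrans (ge0_integral_eta_posterior (fun eta => measure_ge0 _ _) mg)).
rewrite (posterior_weight_stationary mA).
apply: (etrans (esym (ge0_integral_eta_posterior i0 mi))).
exact: integral_indic_setT.
Qed.

End stationarity.

(** * Distance between two steps driven by the same noise *)

Section planar.
Context (R : realType).
Implicit Types x w k : R.

Lemma ler_sqrS (a b : R) : 0 <= a -> a <= b -> a ^+ 2 <= b ^+ 2.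
Proof. by move=> a0 ab; rewrite ler_sqr// nnegrE// (le_trans a0). Qed.

Lemma sqrrD_le2 (u v : R) : (u + v) ^+ 2 <= 2 * (u ^+ 2 + v ^+ 2).
Proof. by have := sqr_ge0 (u - v); lra. Qed.

Lemma sqrrD_le3 (u v t : R) : (u + v + t) ^+ 2 <= 3 * (u ^+ 2 + v ^+ 2 + t ^+ 2).
Proof.
by have := sqr_ge0 (u - v); have := sqr_ge0 (u - t); have := sqr_ge0 (v - t); lra.
Qed.

Lemma sqrrD_le4 (u v t q : R) :
  (u + v + t + q) ^+ 2 <= 4 * (u ^+ 2 + v ^+ 2 + t ^+ 2 + q ^+ 2).
Proof.
have := sqrrD_le2 (u + v) (t + q); rewrite addrA => h.
by have := sqrrD_le2 u v; have := sqrrD_le2 t q; lra.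
Qed.

(** The reverse triangle inequality in the plane. *)
Lemma sqrt_dist_le (X X' a a' : R) : 0 <= X -> 0 <= X' ->
  (Num.sqrt (X + a ^+ 2) - Num.sqrt (X' + a' ^+ 2)) ^+ 2 <=
  (Num.sqrt X - Num.sqrt X') ^+ 2 + (a - a') ^+ 2.
Proof.
move=> X0 X'0; have A0 := sqr_ge0 a; have A'0 := sqr_ge0 a'.
have [SX SX'] : Num.sqrt X ^+ 2 = X /\ Num.sqrt X' ^+ 2 = X' by rewrite !sqr_sqrtr.
set x := Num.sqrt X in SX *; set x' := Num.sqrt X' in SX' *.
have S : Num.sqrt (X + a ^+ 2) ^+ 2 = X + a ^+ 2 by rewrite sqr_sqrtr ?addr_ge0.
have S' : Num.sqrt (X' + a' ^+ 2) ^+ 2 = X' + a' ^+ 2 by rewrite sqr_sqrtr ?addr_ge0.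
have CS : x * x' + a * a' <= Num.sqrt (X + a ^+ 2) * Num.sqrt (X' + a' ^+ 2).
  apply: le_trans (ler_norm _) _; rewrite -ler_sqr ?nnegrE ?mulr_ge0 ?sqrtr_ge0//.
  rewrite real_normK ?num_real// [leRHS]exprMn S S' -SX -SX'.
  by have := sqr_ge0 (x * a' - x' * a); lra.
by move: S S' CS; set n := Num.sqrt _; set n' := Num.sqrt _; rewrite -SX -SX'; lra.
Qed.

(** The reverse triangle inequality again, one coordinate at a time. *)
Lemma sqrt_sum_dist_le (I : Type) (s : seq I) (b : R) (u v : I -> R) : 0 <= b ->
  (Num.sqrt (b + \sum_(i <- s) u i ^+ 2) - Num.sqrt (b + \sum_(i <- s) v i ^+ 2)) ^+ 2
  <= \sum_(i <- s) (u i - v i) ^+ 2.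
Proof.
move=> b0; elim: s => [|i s ih]; first by rewrite !big_nil subrr expr0n.
rewrite !big_cons ![_ + \sum_(_ <- _) _]addrC !addrA.
apply: le_trans (sqrt_dist_le _ _ _ _) _; last by rewrite lerD2r.
- by rewrite addr_ge0// sumr_ge0// => j _; exact: sqr_ge0.
- by rewrite addr_ge0// sumr_ge0// => j _; exact: sqr_ge0.
Qed.

(** [x] is the standard deviation of an effect and [w] that of a row mean given its
    effect. The sampler multiplies the centred row means by [x ^+ 2 / N ^+ 2] and
    draws effects with standard deviation [x * w / N]. The number [k] bounds the
    ratios [w / N]: when these are small, both quantities hardly depend on [x],
    and the powers of [k] keep track of this. *)
Section shrinkage.
Variables (x w x' w' N N' k : R).
Hypotheses (x0 : 0 < x) (w0 : 0 < w) (x'0 : 0 < x') (w'0 : 0 < w').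
Hypotheses (N0 : 0 < N) (N'0 : 0 < N').
Hypotheses (NE : N ^+ 2 = x ^+ 2 + w ^+ 2) (N'E : N' ^+ 2 = x' ^+ 2 + w' ^+ 2).
Hypotheses (k0 : 0 <= k) (k1 : k <= 1).
Hypotheses (wk : w <= k * N) (w'k : w' <= k * N').
Hypothesis mk : x * w' + x' * w <= k * (N * N').

Let cross_le : (x * w' - x' * w) ^+ 2 <= 2 * ((x - x') ^+ 2 * k ^+ 2 + (w - w') ^+ 2) * N' ^+ 2.
Proof.
have -> : x * w' - x' * w = (x - x') * w' + x' * (w' - w) by ring.
apply: le_trans (sqrrD_le2 _ _) _.
have h1 : ((x - x') * w') ^+ 2 <= (x - x') ^+ 2 * (k ^+ 2 * N' ^+ 2).
  rewrite exprMn; apply: ler_wpM2l; first exact: sqr_ge0.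
  by rewrite -exprMn; exact: ler_sqrS (ltW w'0) w'k.
have h2 : (x' * (w' - w)) ^+ 2 <= (w - w') ^+ 2 * N' ^+ 2.
  rewrite exprMn mulrC -(sqrrN (w' - w)) opprB; apply: ler_wpM2l; first exact: sqr_ge0.
  by rewrite N'E lerDl sqr_ge0.
by lra.
Qed.

Lemma shrink_dist_le :
  (x ^+ 2 / N ^+ 2 - x' ^+ 2 / N' ^+ 2) ^+ 2 * N ^+ 2 <=
  2 * ((x - x') ^+ 2 * k ^+ 4 + (w - w') ^+ 2).
Proof.
have NN : 0 < N * N' by rewrite mulr_gt0.
have -> : x ^+ 2 / N ^+ 2 - x' ^+ 2 / N' ^+ 2 =
    (x * w' - x' * w) * (x * w' + x' * w) / (N * N') ^+ 2.
  have -> : (x * w' - x' * w) * (x * w' + x' * w) = x ^+ 2 * N' ^+ 2 - x' ^+ 2 * N ^+ 2.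
    by rewrite NE N'E; ring.
  by field; rewrite !gt_eqF.
have m2 : (x * w' + x' * w) ^+ 2 <= k ^+ 2 * (N * N') ^+ 2.
  by rewrite -exprMn; apply: ler_sqrS mk; rewrite addr_ge0// mulr_ge0// ltW.
have -> : ((x * w' - x' * w) * (x * w' + x' * w) / (N * N') ^+ 2) ^+ 2 * N ^+ 2 =
    (x * w' - x' * w) ^+ 2 * (x * w' + x' * w) ^+ 2 / ((N * N') ^+ 2 * N' ^+ 2).
  by field; rewrite !gt_eqF.
rewrite ler_pdivrMr ?mulr_gt0 ?exprn_gt0//.
apply: (@le_trans _ _ (2 * ((x - x') ^+ 2 * k ^+ 2 + (w - w') ^+ 2) * N' ^+ 2 *
    (k ^+ 2 * (N * N') ^+ 2))).
  by apply: ler_pM; rewrite ?sqr_ge0.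
have -> : 2 * ((x - x') ^+ 2 * k ^+ 2 + (w - w') ^+ 2) * N' ^+ 2 *
    (k ^+ 2 * (N * N') ^+ 2) = 2 * ((x - x') ^+ 2 * k ^+ 4 + k ^+ 2 * (w - w') ^+ 2) *
    ((N * N') ^+ 2 * N' ^+ 2) by ring.
apply: ler_wpM2r; first by rewrite mulr_ge0 ?sqr_ge0.
rewrite ler_pM2l// lerD2l; apply: ler_piMl; first exact: sqr_ge0.
exact: exprn_ile1.
Qed.

Lemma shrink_sd_dist_le :
  (x * w / N - x' * w' / N') ^+ 2 <= 4 * (k ^+ 4 * (x - x') ^+ 2) + 6 * (w - w') ^+ 2.
Proof.
have NN : 0 < N * N' by rewrite mulr_gt0.
have S0 : 0 < x * N' + x' * N by rewrite addr_gt0// mulr_gt0.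
have -> : x * w / N - x' * w' / N' = (w - w') * (x / N) +
    w' * ((x * w' - x' * w) / (N * N')) * ((x * w' + x' * w) / (x * N' + x' * N)).
  (* The second term is [w' * (x / N - x' / N')], split so that the two small ratios
     [w' / N'] and [(x * w' + x' * w) / (x * N' + x' * N)] come out. *)
  have -> : (w - w') * (x / N) +
    w' * ((x * w' - x' * w) / (N * N')) * ((x * w' + x' * w) / (x * N' + x' * N)) =
    (w - w') * (x / N) + w' * (((x * w' - x' * w) * (x * w' + x' * w)) /
      ((x * N' + x' * N) * (N * N'))) by field; rewrite !gt_eqF.
  have -> : (x * w' - x' * w) * (x * w' + x' * w) = (x * N' - x' * N) * (x * N' + x' * N).
    transitivity (x ^+ 2 * N' ^+ 2 - x' ^+ 2 * N ^+ 2); last by ring.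
    by rewrite NE N'E; ring.
  by field; rewrite !gt_eqF.
apply: le_trans (sqrrD_le2 _ _) _.
have h1 : ((w - w') * (x / N)) ^+ 2 <= (w - w') ^+ 2.
  rewrite exprMn ler_piMr ?sqr_ge0// expr_div_n ler_pdivrMr ?exprn_gt0// mul1r NE.
  by rewrite lerDl sqr_ge0.
have h2 : (w' * ((x * w' - x' * w) / (N * N')) *
    ((x * w' + x' * w) / (x * N' + x' * N))) ^+ 2 <=
    k ^+ 4 * (2 * ((x - x') ^+ 2 + (w - w') ^+ 2)).
  rewrite exprMn.
  have m1 : ((x * w' + x' * w) / (x * N' + x' * N)) ^+ 2 <= k ^+ 2.
    apply: ler_sqrS.
      by apply: divr_ge0; last exact: ltW; rewrite addr_ge0// mulr_ge0// ltW.
    rewrite ler_pdivrMr// mulrDr mulrCA (mulrCA k x').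
    by apply: lerD; apply: ler_wpM2l => //; exact: ltW.
  have m2 : (w' * ((x * w' - x' * w) / (N * N'))) ^+ 2 <=
      k ^+ 2 * (2 * ((x - x') ^+ 2 + (w - w') ^+ 2)).
    have -> : w' * ((x * w' - x' * w) / (N * N')) =
      (w' / N') * (((x - x') * w + x * (w' - w)) / N) by field; rewrite !gt_eqF.
    rewrite exprMn; apply: ler_pM; rewrite ?sqr_ge0//.
      apply: ler_sqrS; first by apply: divr_ge0; exact: ltW.
      by rewrite ler_pdivrMr.
    rewrite expr_div_n ler_pdivrMr ?exprn_gt0//; apply: le_trans (sqrrD_le2 _ _) _.
    rewrite -mulrA ler_pM2l// [leRHS]mulrDl; apply: lerD.
      by rewrite exprMn; apply: ler_wpM2l; [exact: sqr_ge0|rewrite NE lerDr sqr_ge0].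
    rewrite exprMn mulrC -(sqrrN (w' - w)) opprB; apply: ler_wpM2l; first exact: sqr_ge0.
    by rewrite NE lerDl sqr_ge0.
  have -> : k ^+ 4 * (2 * ((x - x') ^+ 2 + (w - w') ^+ 2)) =
    k ^+ 2 * (2 * ((x - x') ^+ 2 + (w - w') ^+ 2)) * k ^+ 2 by ring.
  by apply: ler_pM; rewrite ?sqr_ge0.
have k4 : k ^+ 4 * (w - w') ^+ 2 <= (w - w') ^+ 2.
  by rewrite ler_piMl ?sqr_ge0// exprn_ile1.
by lra.
Qed.

End shrinkage.

(** The value used for [k]: the cap [1] serves states for which the other bound is
    not small. *)
Lemma min_ratio_ge (x w x' w' N N' : R) : 0 < x -> 0 < w -> 0 < x' -> 0 < w' ->
  0 < N -> 0 < N' -> N ^+ 2 = x ^+ 2 + w ^+ 2 -> N' ^+ 2 = x' ^+ 2 + w' ^+ 2 ->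
  let k := Num.min 1 (w / x + w' / x') in
  [/\ 0 <= k, k <= 1, w <= k * N, w' <= k * N' & x * w' + x' * w <= k * (N * N')].
Proof.
move=> x0 w0 x'0 w'0 N0 N'0 NE N'E k.
have t0 : 0 < w / x by rewrite divr_gt0.
have t'0 : 0 < w' / x' by rewrite divr_gt0.
have xN : x <= N by rewrite -ler_sqr ?nnegrE ?(ltW x0) ?(ltW N0)// NE lerDl sqr_ge0.
have wN : w <= N by rewrite -ler_sqr ?nnegrE ?(ltW w0) ?(ltW N0)// NE lerDr sqr_ge0.
have xN' : x' <= N' by rewrite -ler_sqr ?nnegrE ?(ltW x'0) ?(ltW N'0)// N'E lerDl sqr_ge0.
have wN' : w' <= N' by rewrite -ler_sqr ?nnegrE ?(ltW w'0) ?(ltW N'0)// N'E lerDr sqr_ge0.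
have min_ge (a M : R) : 0 < M -> a <= M -> a <= (w / x + w' / x') * M -> a <= k * M.
  by move=> M0 h1 h2; rewrite /k /Num.min; case: ifP => _; rewrite ?mul1r.
have wE : w = w / x * x by rewrite divfK// gt_eqF.
have w'E : w' = w' / x' * x' by rewrite divfK// gt_eqF.
split.
- by rewrite le_min ler01 addr_ge0// ltW.
- by rewrite ge_min lexx.
- apply: min_ge => //; rewrite [leLHS]wE; apply: ler_pM => //; try exact: ltW.
  by rewrite lerDl ltW.
- apply: min_ge => //; rewrite [leLHS]w'E; apply: ler_pM => //; try exact: ltW.
  by rewrite lerDr ltW.
- have NN : 0 < N * N' by rewrite mulr_gt0.
  apply: min_ge => //.
    rewrite -ler_sqr ?nnegrE; last 2 first.
    - by rewrite addr_ge0// mulr_ge0// ltW.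
    - exact: ltW.
    rewrite [leRHS]exprMn NE N'E.
    by have := sqr_ge0 (x * x' - w * w'); lra.
  rewrite addrC mulrDl; apply: lerD.
    rewrite [X in _ * X <= _]wE mulrCA; apply: ler_wpM2l; first exact: ltW.
    by rewrite mulrC; apply: ler_pM => //; exact: ltW.
  rewrite [X in _ * X <= _]w'E mulrCA; apply: ler_wpM2l; first exact: ltW.
  by apply: ler_pM => //; exact: ltW.
Qed.

End planar.

Section pointwise.
Context (R : realType) (p r : nat) (y : 'M[R]_(p, r)).
Local Notation RB := (measurableTypeR R).
Local Notation T := (p.+1.-tuple RB).

(** The squared distance to the least squares fit, whose intercept is
    [Num.sqrt p%:R * grand_mean y] and whose effects are the centred row means. *)
Definition lyapunov (eta : T) : R :=
  \sum_(i < p) (effect eta i + grand_mean y - row_mean y i) ^+ 2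
  + (intercept eta - Num.sqrt p%:R * grand_mean y) ^+ 2.

Definition sqr_dist (eta eta' : T) : R :=
  \sum_(i < p.+1) ((tnth eta i : R) - tnth eta' i) ^+ 2.

Lemma lyapunov_ge0 eta : 0 <= lyapunov eta.
Proof. by rewrite addr_ge0 ?sqr_ge0// sumr_ge0// => i _; exact: sqr_ge0. Qed.

Lemma sqr_dist_ge0 eta eta' : 0 <= sqr_dist eta eta'.
Proof. by apply: sumr_ge0 => i _; exact: sqr_ge0. Qed.

Lemma sqr_distE eta eta' : sqr_dist eta eta' =
  (intercept eta - intercept eta') ^+ 2 +
  \sum_(i < p) (effect eta i - effect eta' i) ^+ 2.
Proof. by rewrite /sqr_dist big_ord_recl. Qed.

Lemma sqr_dist_lyapunov eta eta' :
  sqr_dist eta eta' <= 2 * (lyapunov eta + lyapunov eta').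
Proof.
rewrite sqr_distE /lyapunov; set m := Num.sqrt _ * _.
have h0 : (intercept eta - intercept eta') ^+ 2 <=
    2 * ((intercept eta - m) ^+ 2 + (intercept eta' - m) ^+ 2).
  have -> : intercept eta - intercept eta' =
    (intercept eta - m) + - (intercept eta' - m) by ring.
  by apply: le_trans (sqrrD_le2 _ _) _; rewrite sqrrN.
have h1 : \sum_(i < p) (effect eta i - effect eta' i) ^+ 2 <=
    2 * (\sum_(i < p) (effect eta i + grand_mean y - row_mean y i) ^+ 2 +
         \sum_(i < p) (effect eta' i + grand_mean y - row_mean y i) ^+ 2).
  rewrite -big_split/= mulr_sumr; apply: ler_sum => i _.
  have -> : effect eta i - effect eta' i =
    (effect eta i + grand_mean y - row_mean y i) +
    - (effect eta' i + grand_mean y - row_mean y i) by ring.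
  by apply: le_trans (sqrrD_le2 _ _) _; rewrite sqrrN.
by lra.
Qed.

Hypotheses (p_gt0 : (0 < p)%N) (r_gt0 : (0 < r)%N).

Let sp0 : 0 < Num.sqrt p%:R :> R.
Proof. by rewrite sqrtr_gt0 ltr0n. Qed.

Let spE : Num.sqrt p%:R ^+ 2 = p%:R :> R.
Proof. by rewrite sqr_sqrtr. Qed.

Let pV : p%:R^-1 *+ p = 1 :> R.
Proof. by rewrite -[LHS]mulr_natl mulfV// pnatr_eq0 -lt0n. Qed.

Let r0 : 0 < r%:R :> R.
Proof. by rewrite ltr0n. Qed.

Lemma block_coefficients (lt le x w N : R) : 0 < lt -> 0 < le ->
  x = Num.sqrt lt^-1 -> w = Num.sqrt (r%:R * le)^-1 -> N = intercept_sd r lt le ->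
  [/\ [/\ 0 < x, 0 < w & 0 < N], x ^+ 2 = lt^-1, w ^+ 2 = (r%:R * le)^-1,
      N ^+ 2 = x ^+ 2 + w ^+ 2
    & (r%:R * le) / (lt + r%:R * le) = x ^+ 2 / N ^+ 2 /\
      effect_sd r lt le = x * w / N].
Proof.
move=> lt0 le0 -> -> ->.
have rle0 : 0 < r%:R * le by rewrite mulr_gt0.
have D0 : 0 < lt + r%:R * le by rewrite addr_gt0.
have N0 := intercept_sd_gt0 r_gt0 lt0 le0.
have xE : Num.sqrt lt^-1 ^+ 2 = lt^-1 by rewrite sqr_sqrtr// invr_ge0 ltW.
have wE : Num.sqrt (r%:R * le)^-1 ^+ 2 = (r%:R * le)^-1.
  by rewrite sqr_sqrtr// invr_ge0 ltW.
have x0 : 0 < Num.sqrt lt^-1 by rewrite sqrtr_gt0 invr_gt0.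
have w0 : 0 < Num.sqrt (r%:R * le)^-1 by rewrite sqrtr_gt0 invr_gt0.
have NE : intercept_sd r lt le ^+ 2 = lt^-1 + (r%:R * le)^-1.
  rewrite sqr_sqrtr; first by field; rewrite !gt_eqF.
  by apply: divr_ge0; [exact: ltW|apply: mulr_ge0; exact: ltW].
split => //; last split.
- by rewrite xE wE NE.
- by rewrite xE NE; field; rewrite !gt_eqF// addrC.
- rewrite /effect_sd.
  have <- : (Num.sqrt lt^-1 * Num.sqrt (r%:R * le)^-1 / intercept_sd r lt le) ^+ 2 =
      1 / (lt + r%:R * le).
    rewrite expr_div_n exprMn xE wE NE; field.
    by rewrite !gt_eqF// addrC.
  rewrite sqrtr_sqr ger0_norm// divr_ge0 ?(ltW N0)//.
Qed.

Lemma between_sqr_ge0 : 0 <= between_sqr y.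
Proof. by apply: sumr_ge0 => i _; exact: sqr_ge0. Qed.

Definition noise_sqr (z : RB * p.-tuple RB) : R := \sum_(i < p) (tnth z.2 i : R) ^+ 2.

Lemma noise_sqr_ge0 z : 0 <= noise_sqr z.
Proof. by apply: sumr_ge0 => i _; exact: sqr_ge0. Qed.

Let block_effectE (lt le x w N : R) z i : 0 < lt -> 0 < le ->
  x = Num.sqrt lt^-1 -> w = Num.sqrt (r%:R * le)^-1 -> N = intercept_sd r lt le ->
  effect (block_map y lt le z) i =
    x ^+ 2 / N ^+ 2 * (row_mean y i - grand_mean y - N * z.1 / Num.sqrt p%:R)
    + x * w / N * tnth z.2 i.
Proof.
move=> lt0 le0 xE wE NE.
have [_ _ _ _ [fE gE]] := block_coefficients lt0 le0 xE wE NE.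
rewrite effect_block_map intercept_block_map gE -NE; congr (_ + _).
rewrite /effect_mean mulrAC fE; congr (_ * _).
by rewrite /intercept_mean; field; rewrite gt_eqF.
Qed.

(** The intercepts differ by [(N - N') * z.1]; each effect is an affine function
    of the intercept and of its own normal variable, with the coefficients that
    [shrink_dist_le] and [shrink_sd_dist_le] compare. *)
Lemma block_map_dist_le (lt le lt' le' x w x' w' : R) z :
  0 < lt -> 0 < le -> 0 < lt' -> 0 < le' ->
  x = Num.sqrt lt^-1 -> w = Num.sqrt (r%:R * le)^-1 ->
  x' = Num.sqrt lt'^-1 -> w' = Num.sqrt (r%:R * le')^-1 ->
  let k := Num.min 1 (w / x + w' / x') in
  sqr_dist (block_map y lt le z) (block_map y lt' le' z) <=
  8 * ((x - x') ^+ 2 * k ^+ 4 + (w - w') ^+ 2) * lt * between_sqr y +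
  13 * ((x - x') ^+ 2 + (w - w') ^+ 2) * z.1 ^+ 2 +
  (16 * k ^+ 4 * (x - x') ^+ 2 + 24 * (w - w') ^+ 2) * noise_sqr z.
Proof.
move=> lt0 le0 lt'0 le'0 xE wE x'E w'E; cbv zeta; set k := Num.min _ _.
pose N := intercept_sd r lt le; pose N' := intercept_sd r lt' le'.
have [[x0 w0 N0] x2 w2 N2 [fE gE]] := block_coefficients lt0 le0 xE wE (erefl N).
have [[x'0 w'0 N'0] x'2 w'2 N'2 [f'E g'E]] := block_coefficients lt'0 le'0 x'E w'E (erefl N').
have [k0 k1 wk w'k mk] := min_ratio_ge x0 w0 x'0 w'0 N0 N'0 N2 N'2.
have A : (x ^+ 2 / N ^+ 2 - x' ^+ 2 / N' ^+ 2) ^+ 2 * N ^+ 2 <=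
    2 * ((x - x') ^+ 2 * k ^+ 4 + (w - w') ^+ 2) by exact: shrink_dist_le.
have B : (x * w / N - x' * w' / N') ^+ 2 <=
    4 * (k ^+ 4 * (x - x') ^+ 2) + 6 * (w - w') ^+ 2 by exact: shrink_sd_dist_le.
have C : (N - N') ^+ 2 <= (x - x') ^+ 2 + (w - w') ^+ 2.
  have := sqrt_dist_le w w' (sqr_ge0 x) (sqr_ge0 x').
  rewrite -N2 -N'2 !sqrtr_sqr !ger0_norm//; exact: ltW.
have k4 : k ^+ 4 <= 1 by exact: exprn_ile1.
have k40 : 0 <= k ^+ 4 by exact: exprn_ge0.
set dx := (x - x') ^+ 2 in A B C *; set dw := (w - w') ^+ 2 in A B C *.
have dx0 : 0 <= dx by exact: sqr_ge0.
have dw0 : 0 <= dw by exact: sqr_ge0.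
set f := x ^+ 2 / N ^+ 2 in A *; set f' := x' ^+ 2 / N' ^+ 2 in A *.
set g := x * w / N in B; set g' := x' * w' / N' in B.
have f'0 : 0 <= f' by rewrite divr_ge0// sqr_ge0.
have f'1 : f' ^+ 2 <= 1.
  rewrite exprn_ile1// ler_pdivrMr ?exprn_gt0// mul1r N'2 lerDl sqr_ge0.
  by [].
rewrite sqr_distE !intercept_block_map -/N -/N'.
have -> : intercept_mean y + N * z.1 - (intercept_mean y + N' * z.1) = (N - N') * z.1.
  by ring.
pose Q := between_sqr y; pose Z := noise_sqr z.
have Q0 : 0 <= Q by exact: between_sqr_ge0.
have Z0 : 0 <= Z by exact: noise_sqr_ge0.
have S : \sum_(i < p) (effect (block_map y lt le z) i -
    effect (block_map y lt' le' z) i) ^+ 2 <=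
  4 * ((f - f') ^+ 2 * Q + (f - f') ^+ 2 * N ^+ 2 * z.1 ^+ 2 +
       f' ^+ 2 * (N - N') ^+ 2 * z.1 ^+ 2 + (g - g') ^+ 2 * Z).
  have -> : 4 * ((f - f') ^+ 2 * Q + (f - f') ^+ 2 * N ^+ 2 * z.1 ^+ 2 +
       f' ^+ 2 * (N - N') ^+ 2 * z.1 ^+ 2 + (g - g') ^+ 2 * Z) =
    \sum_(i < p) 4 * ((f - f') ^+ 2 * (row_mean y i - grand_mean y) ^+ 2 +
       (f - f') ^+ 2 * N ^+ 2 * z.1 ^+ 2 / p%:R +
       f' ^+ 2 * (N - N') ^+ 2 * z.1 ^+ 2 / p%:R +
       (g - g') ^+ 2 * tnth z.2 i ^+ 2).
    rewrite -mulr_sumr !big_split/= -!mulr_sumr !sumr_const card_ord.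
    by rewrite pV !mulr1.
  apply: ler_sum => i _.
  rewrite (block_effectE z i lt0 le0 xE wE (erefl N)).
  rewrite (block_effectE z i lt'0 le'0 x'E w'E (erefl N')).
  rewrite -/f -/f' -/g -/g'.
  set a := row_mean y i - grand_mean y; set zi : R := tnth z.2 i.
  have -> : f * (a - N * z.1 / Num.sqrt p%:R) + g * zi -
      (f' * (a - N' * z.1 / Num.sqrt p%:R) + g' * zi) =
    (f - f') * a + - ((f - f') * N * z.1 / Num.sqrt p%:R) +
    - (f' * (N - N') * z.1 / Num.sqrt p%:R) + (g - g') * zi by ring.
  apply: le_trans (sqrrD_le4 _ _ _ _) _; rewrite ler_pM2l// le_eqVlt.
  apply/orP; left; apply/eqP; have := spE; have := sp0.
  by set s := Num.sqrt p%:R => s0 <-; field; rewrite gt_eqF.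
have E2 : (f - f') ^+ 2 <= 2 * (dx * k ^+ 4 + dw) * lt.
  have ltE : lt = (x ^+ 2)^-1 by rewrite x2 invrK.
  rewrite ltE ler_pdivlMr ?exprn_gt0//; apply: le_trans A.
  by apply: ler_wpM2l; [exact: sqr_ge0|rewrite N2 lerDl sqr_ge0].
have E3 : (f - f') ^+ 2 * Q <= 2 * (dx * k ^+ 4 + dw) * lt * Q by exact: ler_wpM2r.
have E4 : (f - f') ^+ 2 * N ^+ 2 * z.1 ^+ 2 <= 2 * (dx + dw) * z.1 ^+ 2.
  apply: ler_wpM2r; first exact: sqr_ge0.
  apply: le_trans A _; rewrite ler_pM2l// lerD2r.
  exact: ler_piMr.
have E5 : ((N - N') * z.1) ^+ 2 <= (dx + dw) * z.1 ^+ 2.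
  by rewrite exprMn; apply: ler_wpM2r => //; exact: sqr_ge0.
have E6 : f' ^+ 2 * (N - N') ^+ 2 * z.1 ^+ 2 <= (dx + dw) * z.1 ^+ 2.
  apply: (le_trans _ E5); rewrite [leRHS]exprMn; apply: ler_wpM2r; first exact: sqr_ge0.
  by apply: ler_piMl => //; exact: sqr_ge0.
have E7 : (g - g') ^+ 2 * Z <= (4 * (k ^+ 4 * dx) + 6 * dw) * Z by exact: ler_wpM2r.
rewrite -/Q -/Z; lra.
Qed.

Lemma block_map_lyapunov_le (lt le : R) z : 0 < lt -> 0 < le ->
  lyapunov (block_map y lt le z) <=
  3 * between_sqr y + 4 * (lt^-1 + (r%:R * le)^-1) * z.1 ^+ 2 +
  3 * (r%:R * le)^-1 * noise_sqr z.
Proof.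
move=> lt0 le0; pose x := Num.sqrt lt^-1; pose w := Num.sqrt (r%:R * le)^-1.
pose N := intercept_sd r lt le.
have [[x0 w0 N0] x2 w2 N2 [fE gE]] := block_coefficients lt0 le0 (erefl x) (erefl w) (erefl N).
rewrite /lyapunov -/(intercept_mean y) intercept_block_map -/N.
have -> : intercept_mean y + N * z.1 - intercept_mean y = N * z.1 by ring.
rewrite -x2 -w2 -N2.
set f := x ^+ 2 / N ^+ 2 in fE; set g := x * w / N in gE.
have f0 : 0 <= f by rewrite divr_ge0 ?sqr_ge0.
have f1 : f <= 1 by rewrite ler_pdivrMr ?exprn_gt0// mul1r N2 lerDl sqr_ge0.
have g2 : g ^+ 2 <= w ^+ 2.
  rewrite /g expr_div_n exprMn mulrAC ler_piMl ?sqr_ge0//.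
pose Q := between_sqr y; pose Z := noise_sqr z.
have S : \sum_(i < p) (effect (block_map y lt le z) i + grand_mean y - row_mean y i) ^+ 2
    <= 3 * (Q + N ^+ 2 * z.1 ^+ 2 + w ^+ 2 * Z).
  have -> : 3 * (Q + N ^+ 2 * z.1 ^+ 2 + w ^+ 2 * Z) =
    \sum_(i < p) 3 * ((row_mean y i - grand_mean y) ^+ 2 +
       N ^+ 2 * z.1 ^+ 2 / p%:R + w ^+ 2 * tnth z.2 i ^+ 2).
    rewrite -mulr_sumr !big_split/= -!mulr_sumr !sumr_const card_ord.
    by rewrite pV !mulr1.
  apply: ler_sum => i _.
  rewrite (block_effectE z i lt0 le0 (erefl x) (erefl w) (erefl N)) -/f -/g.
  set a := row_mean y i - grand_mean y; set zi : R := tnth z.2 i.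
  have -> : f * (a - N * z.1 / Num.sqrt p%:R) + g * zi + grand_mean y - row_mean y i =
    - ((1 - f) * a) + - (f * N * z.1 / Num.sqrt p%:R) + g * zi by rewrite /a; ring.
  clearbody f g; apply: le_trans (sqrrD_le3 _ _ _) _; rewrite ler_pM2l// !sqrrN.
  rewrite expr_div_n !exprMn spE; apply: lerD; first apply: lerD.
  - by apply: ler_piMl; [exact: sqr_ge0|rewrite exprn_ile1//; lra].
  - apply: ler_wpM2r; first by rewrite invr_ge0.
    apply: ler_wpM2r; first exact: sqr_ge0.
    by apply: ler_piMl; [exact: sqr_ge0|rewrite exprn_ile1].
  - by apply: ler_wpM2r => //; exact: sqr_ge0.
rewrite exprMn -/Q -/Z; lra.
Qed.

End pointwise.

Section state_bounds.
Context (R : realType) (b1 b2 : R) (p r : nat) (y : 'M[R]_(p, r)).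
Local Notation RB := (measurableTypeR R).
Local Notation T := (p.+1.-tuple RB).
Local Notation noiseT := (RB * (RB * (RB * p.-tuple RB)))%type.
Local Notation V := (lyapunov y).
Local Notation Q := (between_sqr y).

Hypotheses (b1_gt0 : 0 < b1) (b2_gt0 : 0 < b2).
Hypotheses (p_gt0 : (0 < p)%N) (r_gt0 : (0 < r)%N).

Let r0 : 0 < r%:R :> R.
Proof. by rewrite ltr0n. Qed.

Let r1 : 1 <= r%:R :> R.
Proof. by rewrite ler1n. Qed.

Let sp0 : 0 < Num.sqrt p%:R :> R.
Proof. by rewrite sqrtr_gt0 ltr0n. Qed.

Let spE : Num.sqrt p%:R ^+ 2 = p%:R :> R.
Proof. by rewrite sqr_sqrtr. Qed.

Let pV : p%:R^-1 *+ p = 1 :> R.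
Proof. by rewrite -[LHS]mulr_natl mulfV// pnatr_eq0 -lt0n. Qed.

Lemma within_sqr_ge0 : 0 <= within_sqr y.
Proof.
by apply: sumr_ge0 => i _; apply: sumr_ge0 => j _; exact: sqr_ge0.
Qed.

(** The square root of the rate is the norm of a vector that is an affine function
    of the state. *)
Lemma sqrt_theta_rate_dist_le (eta eta' : T) :
  (Num.sqrt (theta_rate b1 eta) - Num.sqrt (theta_rate b1 eta')) ^+ 2 <=
  sqr_dist eta eta'.
Proof.
have s2 : 0 < Num.sqrt 2 :> R by rewrite sqrtr_gt0.
have s2E : Num.sqrt 2 ^+ 2 = 2 :> R by rewrite sqr_sqrtr.
have rateE (t : T) : theta_rate b1 t =
    b1 + \sum_(i < p) (effect t i / Num.sqrt 2) ^+ 2.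
  rewrite /theta_rate /effect_sqr mulr_suml; congr (_ + _).
  by apply: eq_bigr => i _; rewrite expr_div_n s2E.
rewrite !rateE; apply: le_trans (sqrt_sum_dist_le _ _ _ (ltW b1_gt0)) _.
rewrite sqr_distE -[leLHS]add0r; apply: lerD; first exact: sqr_ge0.
apply: ler_sum => i _; rewrite -mulrBl expr_div_n s2E.
by rewrite ler_pdivrMr// ler_peMr ?sqr_ge0// ler1n.
Qed.

Lemma sqrt_e_rate_dist_le (eta eta' : T) :
  (Num.sqrt (e_rate b2 y eta) - Num.sqrt (e_rate b2 y eta')) ^+ 2 <=
  r%:R * sqr_dist eta eta'.
Proof.
pose s : R := Num.sqrt (r%:R / 2).
have sE : s ^+ 2 = r%:R / 2 by rewrite sqr_sqrtr// divr_ge0// ltW.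
pose b : R := b2 + within_sqr y / 2.
have b0 : 0 <= b.
  by apply: addr_ge0; [exact: ltW|apply: divr_ge0 => //; exact: within_sqr_ge0].
have rateE (t : T) : e_rate b2 y t = b + \sum_(i < p)
    (s * (row_mean y i - intercept t / Num.sqrt p%:R - effect t i)) ^+ 2.
  rewrite /e_rate residual_sqrE// /b mulrDl addrA; congr (_ + _).
  rewrite mulrAC mulr_sumr; apply: eq_bigr => i _.
  by rewrite exprMn sE.
rewrite !rateE; apply: le_trans (sqrt_sum_dist_le _ _ _ b0) _.
rewrite sqr_distE.
have -> : r%:R * ((intercept eta - intercept eta') ^+ 2 +
    \sum_(i < p) (effect eta i - effect eta' i) ^+ 2) =
  \sum_(i < p) r%:R * ((intercept eta - intercept eta') ^+ 2 / p%:R +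
    (effect eta i - effect eta' i) ^+ 2).
  by rewrite -mulr_sumr big_split/= -mulr_sumr sumr_const card_ord pV mulr1.
apply: ler_sum => i _.
have -> : s * (row_mean y i - intercept eta / Num.sqrt p%:R - effect eta i) -
    s * (row_mean y i - intercept eta' / Num.sqrt p%:R - effect eta' i) =
  s * (- ((intercept eta - intercept eta') / Num.sqrt p%:R) +
       - (effect eta i - effect eta' i)) by ring.
rewrite exprMn sE -mulrA ler_pM2l// ler_pdivrMl//.
by apply: le_trans (sqrrD_le2 _ _) _; rewrite !sqrrN expr_div_n spE.
Qed.

Lemma theta_rate_le (eta : T) : theta_rate b1 eta <= b1 + Q + V eta.
Proof.
rewrite /theta_rate -addrA lerD2l ler_pdivrMr// mulrC.
apply: (@le_trans _ _ (2 * (Q + \sum_(i < p) (effect eta i + grand_mean y - row_mean y i) ^+ 2))).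
  rewrite -big_split/= mulr_sumr; apply: ler_sum => i _.
  have {1}-> : effect eta i = (row_mean y i - grand_mean y) +
    (effect eta i + grand_mean y - row_mean y i) by ring.
  exact: sqrrD_le2.
by rewrite ler_pM2l// lerD2l /lyapunov lerDl sqr_ge0.
Qed.

(** A bound on [e_rate b2 y eta / r%:R], which is the variance of a row mean given
    its effect, up to the gamma noise. *)
Definition error_scale (eta : T) : R := b2 + within_sqr y / r%:R + V eta.

Lemma error_scale_ge0 eta : 0 <= error_scale eta.
Proof.
apply: addr_ge0; last exact: lyapunov_ge0.
apply: addr_ge0; first exact: ltW.
by apply: divr_ge0; [exact: within_sqr_ge0|exact: ltW].
Qed.

Lemma e_rate_le (eta : T) : e_rate b2 y eta / r%:R <= error_scale eta.
Proof.
have h : \sum_(i < p) (row_mean y i - intercept eta / Num.sqrt p%:R - effect eta i) ^+ 2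
    <= 2 * V eta.
  pose m := Num.sqrt p%:R * grand_mean y.
  have -> : 2 * V eta = \sum_(i < p) 2 *
     ((effect eta i + grand_mean y - row_mean y i) ^+ 2 + (intercept eta - m) ^+ 2 / p%:R).
    rewrite -mulr_sumr big_split/= -mulr_sumr sumr_const card_ord pV mulr1.
    by rewrite /lyapunov -/m.
  apply: ler_sum => i _.
  have -> : row_mean y i - intercept eta / Num.sqrt p%:R - effect eta i =
    - (effect eta i + grand_mean y - row_mean y i) +
    - ((intercept eta - m) / Num.sqrt p%:R).
    by rewrite /m; field; rewrite gt_eqF.
  by apply: le_trans (sqrrD_le2 _ _) _; rewrite !sqrrN expr_div_n spE.
rewrite ler_pdivrMr// /e_rate residual_sqrE// /error_scale.
have W0 := within_sqr_ge0.
have -> : (b2 + within_sqr y / r%:R + V eta) * r%:R =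
  b2 * r%:R + within_sqr y + r%:R * V eta by field; rewrite gt_eqF.
have h1 : b2 <= b2 * r%:R by rewrite ler_peMr// ltW.
have h2 : r%:R * \sum_(i < p) (row_mean y i - intercept eta / Num.sqrt p%:R
    - effect eta i) ^+ 2 <= r%:R * (2 * V eta) by rewrite ler_pM2l.
move: h1 h2; set S := \sum_(i < p) _; lra.
Qed.

(** The bound of [block_map_dist_le] once the squared differences of the standard
    deviations are replaced by the squared distance divided by [g1] and by [g2].
    Here [k] stands for the fourth power of the ratio of that lemma. *)
Definition dist_factor (k : R) (g1 g2 : R) (z : RB * p.-tuple RB) : R :=
  8 * Q / b1 * (k + g1 / g2) + 13 * (g1^-1 + g2^-1) * z.1 ^+ 2 +
  (16 * k / g1 + 24 / g2) * noise_sqr z.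

(** The second choice of [c] comes from the ratios of standard deviations, whose
    squares are at most [error_scale / b1 * (g1 / g2)]; the first one from the cap
    on their sum. *)
Lemma gibbs_map_dist_le (eta eta' : T) (w : noiseT) (c : R) :
  0 < w.1 -> 0 < w.2.1 ->
  c = 1 \/ c = 8 * ((error_scale eta + error_scale eta') / b1 * (w.1 / w.2.1)) ^+ 2 ->
  sqr_dist (gibbs_map b1 b2 y eta w) (gibbs_map b1 b2 y eta' w) <=
  sqr_dist eta eta' * dist_factor c w.1 w.2.1 w.2.2.
Proof.
case: w => g1 [g2 z] /= g10 g20 cE; rewrite /gibbs_map /=.
have th0 (t : T) : 0 < theta_rate b1 t by exact: theta_rate_gt0.
have eh0 (t : T) : 0 < e_rate b2 y t by exact: e_rate_gt0.
set th := theta_rate b1 eta; set th' := theta_rate b1 eta'.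
set eh := e_rate b2 y eta; set eh' := e_rate b2 y eta'.
have lt0 (t : T) : 0 < (theta_rate b1 t)^-1 * g1 by rewrite mulr_gt0// invr_gt0.
have le0 (t : T) : 0 < (e_rate b2 y t)^-1 * g2 by rewrite mulr_gt0// invr_gt0.
pose X (t : T) := Num.sqrt ((theta_rate b1 t)^-1 * g1)^-1.
pose W (t : T) := Num.sqrt (r%:R * ((e_rate b2 y t)^-1 * g2))^-1.
have XE t : X t = Num.sqrt (theta_rate b1 t) * Num.sqrt g1^-1.
  by rewrite /X invfM invrK sqrtrM// ltW.
have WE t : W t = Num.sqrt (e_rate b2 y t) * Num.sqrt (r%:R * g2)^-1.
  rewrite /W -sqrtrM ?(ltW (eh0 t))//; congr Num.sqrt.
  by field; rewrite !gt_eqF.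
have X2 t : X t ^+ 2 = theta_rate b1 t / g1.
  by rewrite XE exprMn !sqr_sqrtr// ?invr_ge0 ltW.
have W2 t : W t ^+ 2 = e_rate b2 y t / r%:R / g2.
  rewrite WE exprMn !sqr_sqrtr ?(ltW (eh0 t))//.
    by rewrite invfM mulrA.
  by rewrite invr_ge0 mulr_ge0// ltW.
have X0 t : 0 < X t by rewrite sqrtr_gt0 invr_gt0.
have W0 t : 0 < W t by rewrite sqrtr_gt0 invr_gt0 mulr_gt0.
pose D := sqr_dist eta eta'.
have D0 : 0 <= D by exact: sqr_dist_ge0.
have dX : (X eta - X eta') ^+ 2 <= D / g1.
  rewrite !XE -mulrBl exprMn sqr_sqrtr ?invr_ge0 ?(ltW g10)//.
  apply: ler_wpM2r; first by rewrite invr_ge0 ltW.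
  exact: sqrt_theta_rate_dist_le.
have dW : (W eta - W eta') ^+ 2 <= D / g2.
  rewrite !WE -mulrBl exprMn sqr_sqrtr; last by rewrite invr_ge0 mulr_ge0// ltW.
  have -> : D / g2 = r%:R * D * (r%:R * g2)^-1 by field; rewrite !gt_eqF.
  apply: ler_wpM2r; first by rewrite invr_ge0 mulr_ge0// ltW.
  exact: sqrt_e_rate_dist_le.
have M := block_map_dist_le y p_gt0 r_gt0 z (lt0 eta) (le0 eta) (lt0 eta') (le0 eta')
  (erefl (X eta)) (erefl (W eta)) (erefl (X eta')) (erefl (W eta')).
cbv zeta in M; set k := Num.min _ _ in M.
have tt0 t : 0 < W t / X t by rewrite divr_gt0.
have k0 : 0 <= k by rewrite le_min ler01/= addr_ge0// ltW.
have k1 : k <= 1 by rewrite ge_min lexx.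
have kt : k <= W eta / X eta + W eta' / X eta' by rewrite ge_min lexx orbT.
have t2 t : (W t / X t) ^+ 2 <= error_scale t / b1 * (g1 / g2).
  rewrite expr_div_n W2 X2.
  have -> : e_rate b2 y t / r%:R / g2 / (theta_rate b1 t / g1) =
    e_rate b2 y t / r%:R / theta_rate b1 t * (g1 / g2).
    by field; rewrite !gt_eqF.
  apply: ler_wpM2r; first by rewrite divr_ge0// ltW.
  apply: ler_pM.
  - by rewrite divr_ge0// ltW.
  - by rewrite invr_ge0 ltW.
  - exact: e_rate_le.
  - rewrite lef_pV2 ?posrE// /theta_rate lerDl divr_ge0//.
    by apply: sumr_ge0 => i _; exact: sqr_ge0.
have kc : k ^+ 4 <= c.
  case: cE => ->; first exact: exprn_ile1.
  set q := g1 / g2 in t2 *; have q0 : 0 < q by rewrite divr_gt0.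
  set u := W eta / X eta in kt; set u' := W eta' / X eta' in kt.
  set E := error_scale eta / b1 * q; set E' := error_scale eta' / b1 * q.
  have E0 : 0 <= E.
    apply: mulr_ge0; last exact: ltW.
    by apply: divr_ge0; [exact: error_scale_ge0|exact: ltW].
  have E'0 : 0 <= E'.
    apply: mulr_ge0; last exact: ltW.
    by apply: divr_ge0; [exact: error_scale_ge0|exact: ltW].
  have -> : (error_scale eta + error_scale eta') / b1 * q = E + E'.
    by rewrite /E /E'; ring.
  have h1 : k ^+ 2 <= 2 * (E + E').
    apply: (@le_trans _ _ ((u + u') ^+ 2)); first exact: ler_sqrS.
    apply: le_trans (sqrrD_le2 _ _) _; rewrite ler_pM2l//.
    by apply: lerD; exact: t2.
  have -> : k ^+ 4 = (k ^+ 2) ^+ 2 by rewrite -exprM.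
  apply: (@le_trans _ _ ((2 * (E + E')) ^+ 2)).
    by apply: ler_sqrS => //; exact: sqr_ge0.
  rewrite exprMn; apply: ler_wpM2r; first exact: sqr_ge0.
  by rewrite -natrX ler_nat.
have k40 : 0 <= k ^+ 4 by exact: exprn_ge0.
have c0 : 0 <= c by exact: le_trans kc.
have g1V : 0 <= g1^-1 by rewrite invr_ge0 ltW.
have g2V : 0 <= g2^-1 by rewrite invr_ge0 ltW.
have Q0 := between_sqr_ge0 y.
have Z0 := noise_sqr_ge0 z.
have dXk : (X eta - X eta') ^+ 2 * k ^+ 4 <= D * (c / g1).
  have -> : D * (c / g1) = D / g1 * c by ring.
  by apply: ler_pM => //; exact: sqr_ge0.
have lt_le : th^-1 * g1 <= g1 / b1.
  rewrite mulrC; apply: ler_wpM2l; first exact: ltW.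
  rewrite lef_pV2 ?posrE//; last exact: th0.
  rewrite /th /theta_rate lerDl divr_ge0//.
  by apply: sumr_ge0 => i _; exact: sqr_ge0.
apply: (le_trans M); rewrite -/th /dist_factor -/D.
have T1 : 8 * ((X eta - X eta') ^+ 2 * k ^+ 4 + (W eta - W eta') ^+ 2) *
    (th^-1 * g1) * Q <= D * (8 * Q / b1 * (c + g1 / g2)).
  have -> : D * (8 * Q / b1 * (c + g1 / g2)) =
    8 * (D * (c / g1) + D / g2) * (g1 / b1) * Q.
    by field; rewrite !gt_eqF.
  apply: ler_wpM2r => //; apply: ler_pM.
  - by rewrite mulr_ge0// addr_ge0 ?sqr_ge0// mulr_ge0// sqr_ge0.
  - exact: ltW (lt0 eta).
  - by rewrite ler_pM2l//; apply: lerD.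
  - exact: lt_le.
have T2 : 13 * ((X eta - X eta') ^+ 2 + (W eta - W eta') ^+ 2) * z.1 ^+ 2 <=
    D * (13 * (g1^-1 + g2^-1) * z.1 ^+ 2).
  have -> : D * (13 * (g1^-1 + g2^-1) * z.1 ^+ 2) =
    13 * (D / g1 + D / g2) * z.1 ^+ 2 by ring.
  by apply: ler_wpM2r; [exact: sqr_ge0|rewrite ler_pM2l//; apply: lerD].
have T3 : (16 * k ^+ 4 * (X eta - X eta') ^+ 2 + 24 * (W eta - W eta') ^+ 2) * noise_sqr z
    <= D * ((16 * c / g1 + 24 / g2) * noise_sqr z).
  have -> : D * ((16 * c / g1 + 24 / g2) * noise_sqr z) =
    (16 * (D * (c / g1)) + 24 * (D / g2)) * noise_sqr z by ring.
  apply: ler_wpM2r => //; apply: lerD; last by rewrite ler_pM2l.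
  by rewrite -mulrA ler_pM2l// mulrC.
by rewrite 2!(mulrDr D); exact: lerD (lerD T1 T2) T3.
Qed.

Definition lyapunov_bound (eta : T) (g1 g2 : R) (z : RB * p.-tuple RB) : R :=
  3 * Q + 4 * ((b1 + Q + V eta) / g1 + error_scale eta / g2) * z.1 ^+ 2 +
  3 * (error_scale eta / g2) * noise_sqr z.

Lemma gibbs_map_lyapunov_le (eta : T) (w : noiseT) : 0 < w.1 -> 0 < w.2.1 ->
  V (gibbs_map b1 b2 y eta w) <= lyapunov_bound eta w.1 w.2.1 w.2.2.
Proof.
case: w => g1 [g2 z] /= g10 g20; rewrite /gibbs_map /=.
have th0 : 0 < theta_rate b1 eta by exact: theta_rate_gt0.
have eh0 : 0 < e_rate b2 y eta by exact: e_rate_gt0.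
have lt0 : 0 < (theta_rate b1 eta)^-1 * g1 by rewrite mulr_gt0// invr_gt0.
have le0 : 0 < (e_rate b2 y eta)^-1 * g2 by rewrite mulr_gt0// invr_gt0.
apply: le_trans (block_map_lyapunov_le y p_gt0 r_gt0 z lt0 le0) _.
have h1 : ((theta_rate b1 eta)^-1 * g1)^-1 <= (b1 + Q + V eta) / g1.
  rewrite invfM invrK; apply: ler_wpM2r; last exact: theta_rate_le.
  by rewrite invr_ge0 ltW.
have h2 : (r%:R * ((e_rate b2 y eta)^-1 * g2))^-1 <= error_scale eta / g2.
  have -> : (r%:R * ((e_rate b2 y eta)^-1 * g2))^-1 = e_rate b2 y eta / r%:R / g2.
    by field; rewrite !gt_eqF.
  apply: ler_wpM2r; last exact: e_rate_le.
  by rewrite invr_ge0 ltW.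
rewrite /lyapunov_bound; apply: lerD; first (rewrite lerD2l).
  by apply: ler_wpM2r; [exact: sqr_ge0|rewrite ler_pM2l//; exact: lerD].
by apply: ler_wpM2r; [exact: noise_sqr_ge0|rewrite ler_pM2l].
Qed.

End state_bounds.

(** * Moments of a stationary law from a drift condition *)

Section stationary_moment.
Context d (T : measurableType d) (R : realType).
Variables (K : R.-pker T ~> T) (Pi : probability T R) (V : T -> R) (L : R).
Local Open Scope ereal_scope.

Hypothesis Pi_stationary : forall A, measurable A -> \int[Pi]_y K y A = Pi A.
Hypothesis mV : measurable_fun setT V.
Hypothesis V0 : forall x, (0 <= V x)%R.
Hypothesis L0 : (0 <= L)%R.
Hypothesis drift : forall x, \int[K x]_y (V y)%:E <= (V x / 2 + L)%:E.

Lemma stationary_integral (f : T -> \bar R) : (forall x, 0 <= f x) ->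
  measurable_fun setT f -> \int[Pi]_x \int[K x]_y f y = \int[Pi]_x f x.
Proof.
move=> f0 mf.
pose k0 : R.-pker unit ~> T := @kconst _ T R _ unit Pi.
have E := ge0_integral_kcomp_noparam k0 K tt f0 mf.
apply: (etrans (esym E)).
by apply: eq_measure_integral => A mA _; exact: Pi_stationary.
Qed.

(** The stationary mean of [V] may be infinite a priori, and cannot be subtracted
    from the drift inequality. That of [min V n] is finite; stationarity bounds it by
    the mean of [min (V / 2 + L) n], and comparing the two pointwise leaves
    [V / 2] wherever [V <= n]. *)
Let truncated_moment_le (n : nat) :
  \int[Pi]_x (if (V x <= n%:R)%R then V x / 2 else 0%R)%:E <= L%:E.
Proof.
pose Vn x := Num.min (V x) n%:R.
pose Wn x := Num.min (V x / 2 + L)%R n%:R.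
pose gn x := if (V x <= n%:R)%R then (V x / 2)%R else 0%R.
have n0 : (0 <= n%:R :> R)%R by [].
have VL0 x : (0 <= V x / 2 + L)%R by rewrite addr_ge0// divr_ge0.
have Vn0 x : (0 <= Vn x)%R by rewrite le_min V0 n0.
have Wn0 x : (0 <= Wn x)%R by rewrite le_min VL0 n0.
have gn0 x : (0 <= gn x)%R by rewrite /gn; case: ifP => // _; rewrite divr_ge0.
have mVn : measurable_fun setT (fun x => (Vn x)%:E).
  by apply/measurable_EFinP; apply: measurable_minr.
have mWn : measurable_fun setT (fun x => (Wn x)%:E).
  apply/measurable_EFinP; apply: measurable_minr => //.
  by apply: measurable_funD => //; exact: measurable_funM.
have mgn : measurable_fun setT (fun x => (gn x)%:E).
  apply/measurable_EFinP; apply: measurable_fun_ifT => //.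
    by apply: measurable_fun_ler.
  exact: measurable_funM.
have IV : \int[Pi]_x (Vn x)%:E <= \int[Pi]_x (Wn x)%:E.
  rewrite -stationary_integral//.
  apply: ge0_le_integral => //.
  - by move=> x _; apply: integral_ge0 => z _; rewrite lee_fin.
  - exact: (measurable_fun_integral_kernel (measurable_kernel K)).
  move=> x _; rewrite /Wn /Num.min; case: ifP => _.
    apply: le_trans (drift x); apply: ge0_le_integral => //.
    - by move=> z _; rewrite lee_fin.
    - exact/measurable_EFinP.
    - by move=> z _; rewrite lee_fin ge_min lexx.
  apply: (@le_trans _ _ (\int[K x]_y (cst n%:R%:E y))).
    apply: ge0_le_integral => //.
    - by move=> z _; rewrite lee_fin.
    - by move=> z _; rewrite lee_fin ge_min lexx orbT.
  by rewrite integral_cst// prob_kernel mule1.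
have IWfin : \int[Pi]_x (Wn x)%:E \is a fin_num.
  rewrite ge0_fin_numE; last by apply: integral_ge0 => x _; rewrite lee_fin.
  apply: (@le_lt_trans _ _ (\int[Pi]_x (cst n%:R%:E x))).
    apply: ge0_le_integral => //.
    - by move=> z _; rewrite lee_fin.
    - by move=> z _; rewrite lee_fin ge_min lexx orbT.
  by rewrite integral_cst// [X in _ * X](@probability_setT _ _ _ Pi) mule1 ltry.
rewrite -(leeD2lE _ _ IWfin).
apply: (@le_trans _ _ (\int[Pi]_x ((Vn x)%:E + L%:E))); last first.
  rewrite ge0_integralD//; last by move=> x _; rewrite lee_fin.
  by rewrite integral_cst// [X in _ + _ * X](@probability_setT _ _ _ Pi) mule1 leeD2r.
rewrite -ge0_integralD//; last 2 first.
- by move=> x _; rewrite lee_fin.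
- by move=> x _; rewrite lee_fin; exact: gn0.
apply: ge0_le_integral => //.
- by move=> x _; rewrite -EFinD lee_fin; apply: addr_ge0 => //; exact: gn0.
- exact: emeasurable_funD.
- by apply: emeasurable_funD => //; exact: measurable_cst.
move=> x _; rewrite -!EFinD lee_fin /Vn /Wn; case: (leP (V x) n%:R) => Vn_.
  rewrite (_ : V x + L = V x / 2 + L + V x / 2)%R; last by field.
  by rewrite lerD2r ge_min lexx.
by rewrite addr0; apply: (@le_trans _ _ n%:R); rewrite ?ge_min ?lexx ?orbT ?lerDl.
Qed.

Lemma stationary_moment_le : \int[Pi]_x (V x)%:E <= (2 * L)%:E.
Proof.
pose gn n x : \bar R := (if (V x <= n%:R)%R then V x / 2 else 0%R)%:E.
have gn0 n x : 0 <= gn n x.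
  by rewrite lee_fin; case: ifP => // _; rewrite divr_ge0.
have mgn n : measurable_fun setT (gn n).
  apply/measurable_EFinP; apply: measurable_fun_ifT => //.
    by apply: measurable_fun_ler.
  exact: measurable_funM.
have ndgn x : setT x -> {homo gn ^~ x : n m / (n <= m)%N >-> n <= m}.
  move=> _ n m nm; rewrite lee_fin; case: (leP (V x) n%:R) => [h|h].
    by rewrite (le_trans h)// ler_nat.
  by case: ifP => // _; rewrite divr_ge0.
have limE x : limn (gn ^~ x) = (V x / 2)%:E.
  apply/cvg_lim => //; apply: cvg_near_cst.
  exists (Num.truncn (V x)).+1 => // n /= hn; apply/eqP; rewrite /gn.
  by rewrite ifT// ltW// (lt_le_trans (truncnS_gt _))// ler_nat.
have h : \int[Pi]_x (V x / 2)%:E <= L%:E.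
  rewrite (eq_integral (fun x => limn (gn ^~ x))); last by move=> x _; rewrite limE.
  rewrite monotone_convergence//.
  apply: lime_le.
    apply: ereal_nondecreasing_is_cvgn => n m nm; apply: ge0_le_integral => //.
    by move=> x _; exact: ndgn.
  by apply: nearW => n; exact: truncated_moment_le.
have -> : \int[Pi]_x (V x)%:E = 2%:E * \int[Pi]_x (V x / 2)%:E.
  rewrite -ge0_integralZl//; last 2 first.
  - by apply/measurable_EFinP; exact: measurable_funM.
  - by move=> x _; rewrite lee_fin divr_ge0.
  by apply: eq_integral => x _; rewrite -EFinM; congr (_%:E); field.
by rewrite EFinM lee_wpmul2l.
Qed.

End stationary_moment.

(** * Mean bounds over the noise *)

Section mean_bound.
Context d (T : measurableType d) (R : realType) (P : probability T R).
Local Open Scope ereal_scope.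

(** Upper bounds for expectations of nonnegative functions, in a form that is
    closed under the operations by which the bounds below are assembled. *)
Definition mean_le (f : T -> R) (c : R) := [/\ measurable_fun setT f,
  forall x, (0 <= f x)%R & \int[P]_x (f x)%:E <= c%:E].

Lemma mean_leD f g a b : mean_le f a -> mean_le g b ->
  mean_le (fun x => f x + g x)%R (a + b).
Proof.
move=> [mf f0 fa] [mg g0 gb]; split; first exact: measurable_funD.
  by move=> x; exact: addr_ge0.
have E : \int[P]_x (f x + g x)%:E = \int[P]_x (f x)%:E + \int[P]_x (g x)%:E.
  transitivity (\int[P]_x ((f x)%:E + (g x)%:E)).
    by apply: eq_integral => x _; rewrite EFinD.
  apply: ge0_integralD => //.
  - by move=> x _; rewrite lee_fin.
  - exact/measurable_EFinP.
  - by move=> x _; rewrite lee_fin.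
  - exact/measurable_EFinP.
by rewrite E EFinD; exact: leeD.
Qed.

Lemma mean_leZ f a (k : R) : (0 <= k)%R -> mean_le f a ->
  mean_le (fun x => k * f x)%R (k * a).
Proof.
move=> k0 [mf f0 fa]; split; first exact: measurable_funM.
  by move=> x; exact: mulr_ge0.
have E : \int[P]_x (k * f x)%:E = k%:E * \int[P]_x (f x)%:E.
  transitivity (\int[P]_x (k%:E * (f x)%:E)).
    by apply: eq_integral => x _; rewrite EFinM.
  apply: ge0_integralZl => //.
  - exact/measurable_EFinP.
  - by move=> x _; rewrite lee_fin.
by rewrite E EFinM; apply: lee_wpmul2l => //; rewrite lee_fin.
Qed.

Lemma mean_le_cst (k : R) : (0 <= k)%R -> mean_le (fun=> k) k.
Proof.
move=> k0; split => //.
rewrite (integral_cst P measurableT k%:E) [X in _ * X](@probability_setT _ _ _ P).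
by rewrite mule1.
Qed.

Lemma mean_le_trans f a b : (a <= b)%R -> mean_le f a -> mean_le f b.
Proof.
by move=> ab [mf f0 fa]; split => //; apply: (le_trans fa); rewrite lee_fin.
Qed.

End mean_bound.

Section noise_means.
Context (R : realType) (a1 a2 b1 b2 : R) (p r : nat) (y : 'M[R]_(p, r)).
Local Notation RB := (measurableTypeR R).
Local Notation T := (p.+1.-tuple RB).
Local Notation noiseT := (RB * (RB * (RB * p.-tuple RB)))%type.
Local Notation Q := (between_sqr y).
Local Notation V := (lyapunov y).
Local Notation alpha1 := (theta_shape a1 p).
Local Notation alpha2 := (e_shape a2 p r).
Local Notation k0 := (gamma_cst R).
Local Notation nz := (@noise_sqr R p).

Hypotheses (b1_gt0 : 0 < b1) (b2_gt0 : 0 < b2).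
Hypotheses (p_gt0 : (0 < p)%N) (r_gt0 : (0 < r)%N).
Hypotheses (alpha1_ge4 : 4 <= alpha1) (alpha2_ge4 : 4 <= alpha2).

Lemma normal_noise_moment_intercept :
  mean_le (normal_noise R p) (fun z => (z.1 : R) ^+ 2) 8.
Proof.
have mf : measurable_fun setT (fun z : RB * p.-tuple RB => (z.1 : R) ^+ 2).
  by apply: measurable_funX; exact: measurable_fst.
split => //; first by move=> z; exact: sqr_ge0.
have mfE : measurable_fun setT (fun z : RB * p.-tuple RB => ((z.1 : R) ^+ 2)%:E).
  exact/measurable_EFinP.
have f0 (z : RB * p.-tuple RB) : (0 <= ((z.1 : R) ^+ 2)%:E)%E.
  by rewrite lee_fin sqr_ge0.
rewrite (ge0_integral_normal_noise f0 mfE).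
apply: le_trans (normal_prob_moment2 R); rewrite le_eqVlt; apply/orP; left.
apply/eqP; apply: eq_integral => z0 _.
apply: (etrans (integral_cst (std_normal R p) measurableT ((z0 : R) ^+ 2)%:E)).
by rewrite [X in (_ * X)%E](@probability_setT _ _ _ (std_normal R p)) mule1.
Qed.

Lemma measurable_noise_sqr : measurable_fun setT nz.
Proof.
apply: measurable_sum => i; apply: measurable_funX.
by apply: (measurableT_comp (measurable_tnth i)); exact: measurable_snd.
Qed.

Lemma normal_noise_moment_effects : mean_le (normal_noise R p) nz (8 * p%:R).
Proof.
have mf := measurable_noise_sqr.
split => //; first by move=> z; exact: noise_sqr_ge0.
have mfE : measurable_fun setT (fun z => (nz z)%:E) by exact/measurable_EFinP.
have f0 z : (0 <= (nz z)%:E)%E by rewrite lee_fin noise_sqr_ge0.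
rewrite (ge0_integral_normal_noise f0 mfE).
apply: le_trans (std_normal_moment2 R p); rewrite le_eqVlt; apply/orP; left.
apply/eqP; set c := (X in _ = X).
apply: (etrans (integral_cst (normal_prob 0 1) measurableT c)).
by rewrite [X in (_ * X)%E](@probability_setT _ _ _ (normal_prob 0 1)) mule1.
Qed.

Let theta_moments :
  [/\ mean_le (gamma_prob alpha1 1) (fun x => `|x|) (k0 * alpha1),
      mean_le (gamma_prob alpha1 1) (fun x => `|x| ^+ 2) (k0 * alpha1 ^+ 2)
    & mean_le (gamma_prob alpha1 1) (fun x => `|x|^-1) (k0 / alpha1)].
Proof.
have mn : measurable_fun setT (fun x : RB => `|x| : R) by exact: measurableT_comp.
split; split.
- exact: mn.
- by [].
- exact: gamma_prob_moment1.
- exact: measurable_funX.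
- by move=> x; exact: sqr_ge0.
- exact: gamma_prob_moment2.
- exact: measurable_normV.
- by move=> x; rewrite invr_ge0.
- exact: gamma_prob_momentV1.
Qed.

Let error_moments :
  mean_le (gamma_prob alpha2 1) (fun x => `|x|^-1) (k0 / alpha2) /\
  mean_le (gamma_prob alpha2 1) (fun x => `|x|^-1 ^+ 2) (k0 / alpha2 ^+ 2).
Proof.
split; split.
- exact: measurable_normV.
- by move=> x; rewrite invr_ge0.
- exact: gamma_prob_momentV1.
- by apply: measurable_funX; exact: measurable_normV.
- by move=> x; exact: sqr_ge0.
- exact: gamma_prob_momentV2.
Qed.

Let mean_le_prod u v h A B C : mean_le (gamma_prob alpha1 1) u A ->
  mean_le (gamma_prob alpha2 1) v B -> mean_le (normal_noise R p) h C ->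
  mean_le (gibbs_noise a1 a2 p r) (fun w => u w.1 * v w.2.1 * h w.2.2) (A * B * C).
Proof.
move=> [mu u0 uA] [mv v0 vB] [mh h0 hC]; split.
- apply: measurable_funM.
    apply: measurable_funM; first exact: (measurableT_comp mu measurable_fst).
    apply: (measurableT_comp mv).
    exact: (measurableT_comp measurable_fst measurable_snd).
  apply: (measurableT_comp mh).
  exact: (measurableT_comp measurable_snd measurable_snd).
- by move=> w; rewrite !mulr_ge0.
- exact: integral_noise_prod.
Qed.

Let one_le d (U : measurableType d) (P : probability U R) : mean_le P (fun=> 1) 1.
Proof. exact: mean_le_cst. Qed.

(** [k] and [l] are bounds on the means of the argument [k] of [dist_factor] and of
    its quotient by [g1]. *)
Definition dist_factor_mean (k l : R) : R :=
  8 * Q / b1 * (k + k0 * alpha1 * (k0 / alpha2)) +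
  13 * (k0 / alpha1 + k0 / alpha2) * 8 + (16 * l + 24 * (k0 / alpha2)) * (8 * p%:R).

Definition lyapunov_mean (eta : T) : R :=
  3 * Q + 4 * ((b1 + Q + V eta) * (k0 / alpha1) +
    error_scale b2 y eta * (k0 / alpha2)) * 8 +
  3 * (error_scale b2 y eta * (k0 / alpha2)) * (8 * p%:R).

Let QB0 : 0 <= 8 * Q / b1.
Proof.
apply: divr_ge0; last exact: ltW.
by apply: mulr_ge0 => //; exact: between_sqr_ge0.
Qed.

Lemma dist_factor1_mean : exists2 f : noiseT -> R,
  mean_le (gibbs_noise a1 a2 p r) f (dist_factor_mean 1 (k0 / alpha1)) &
  forall w, 0 < w.1 -> 0 < w.2.1 -> dist_factor b1 y 1 w.1 w.2.1 w.2.2 = f w.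
Proof.
have [M1 M2 N0] := theta_moments; have [N1 N2] := error_moments.
have Z := normal_noise_moment_intercept; have S := normal_noise_moment_effects.
have H1 := mean_leZ QB0 (mean_leD (one_le _) (mean_le_prod M1 N1 (one_le _))).
have H2 := mean_leZ (ler0n R 13)
  (mean_leD (mean_le_prod N0 (one_le _) Z) (mean_le_prod (one_le _) N1 Z)).
have H3 := mean_leD (mean_leZ (ler0n R 16) (mean_le_prod N0 (one_le _) S))
  (mean_leZ (ler0n R 24) (mean_le_prod (one_le _) N1 S)).
have H := mean_leD (mean_leD H1 H2) H3.
exists (fun w => 8 * Q / b1 * (1 + `|w.1| * `|w.2.1|^-1 * 1) +
  13 * (`|w.1|^-1 * 1 * w.2.2.1 ^+ 2 + 1 * `|w.2.1|^-1 * w.2.2.1 ^+ 2) +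
  (16 * (`|w.1|^-1 * 1 * nz w.2.2) + 24 * (1 * `|w.2.1|^-1 * nz w.2.2))).
  apply: mean_le_trans H; rewrite /dist_factor_mean.
  rewrite le_eqVlt; apply/orP; left; apply/eqP; ring.
move=> [g1 [g2 z]] /= g10 g20; rewrite /dist_factor !gtr0_norm//; ring.
Qed.

Lemma dist_factor2_mean (k : R) : 0 <= k -> exists2 f : noiseT -> R,
  mean_le (gibbs_noise a1 a2 p r) f
    (dist_factor_mean (k * (k0 * alpha1 ^+ 2 * (k0 / alpha2 ^+ 2)))
      (k * (k0 * alpha1 * (k0 / alpha2 ^+ 2)))) &
  forall w, 0 < w.1 -> 0 < w.2.1 ->
    dist_factor b1 y (k * (w.1 / w.2.1) ^+ 2) w.1 w.2.1 w.2.2 = f w.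
Proof.
move=> k_ge0.
have [M1 M2 N0] := theta_moments; have [N1 N2] := error_moments.
have Z := normal_noise_moment_intercept; have S := normal_noise_moment_effects.
have H1 := mean_leZ QB0 (mean_leD (mean_leZ k_ge0 (mean_le_prod M2 N2 (one_le _)))
  (mean_le_prod M1 N1 (one_le _))).
have H2 := mean_leZ (ler0n R 13)
  (mean_leD (mean_le_prod N0 (one_le _) Z) (mean_le_prod (one_le _) N1 Z)).
have H3 := mean_leD (mean_leZ (ler0n R 16) (mean_leZ k_ge0 (mean_le_prod M1 N2 S)))
  (mean_leZ (ler0n R 24) (mean_le_prod (one_le _) N1 S)).
have H := mean_leD (mean_leD H1 H2) H3.
exists (fun w => 8 * Q / b1 * (k * (`|w.1| ^+ 2 * `|w.2.1|^-1 ^+ 2 * 1) +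
    `|w.1| * `|w.2.1|^-1 * 1) +
  13 * (`|w.1|^-1 * 1 * w.2.2.1 ^+ 2 + 1 * `|w.2.1|^-1 * w.2.2.1 ^+ 2) +
  (16 * (k * (`|w.1| * `|w.2.1|^-1 ^+ 2 * nz w.2.2)) +
   24 * (1 * `|w.2.1|^-1 * nz w.2.2))).
  apply: mean_le_trans H; rewrite /dist_factor_mean.
  rewrite le_eqVlt; apply/orP; left; apply/eqP; ring.
move=> [g1 [g2 z]] /= g10 g20; rewrite /dist_factor !gtr0_norm//.
by field; rewrite !gt_eqF.
Qed.

Lemma lyapunov_bound_mean eta : exists2 f : noiseT -> R,
  mean_le (gibbs_noise a1 a2 p r) f (lyapunov_mean eta) &
  forall w, 0 < w.1 -> 0 < w.2.1 ->
    lyapunov_bound b1 b2 y eta w.1 w.2.1 w.2.2 = f w.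
Proof.
have [_ _ N0] := theta_moments; have [N1 _] := error_moments.
have Z := normal_noise_moment_intercept; have S := normal_noise_moment_effects.
have Q3 : 0 <= 3 * Q by rewrite mulr_ge0// between_sqr_ge0.
have R0 : 0 <= b1 + Q + V eta.
  apply: addr_ge0; last exact: lyapunov_ge0.
  by apply: addr_ge0; [exact: ltW|exact: between_sqr_ge0].
have G0 : 0 <= error_scale b2 y eta by exact: error_scale_ge0.
have H := mean_leD (mean_leD (mean_le_cst (gibbs_noise a1 a2 p r) Q3)
  (mean_leZ (ler0n R 4) (mean_leD (mean_leZ R0 (mean_le_prod N0 (one_le _) Z))
    (mean_leZ G0 (mean_le_prod (one_le _) N1 Z)))))
  (mean_leZ (ler0n R 3) (mean_leZ G0 (mean_le_prod (one_le _) N1 S))).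
exists (fun w => 3 * Q + 4 * ((b1 + Q + V eta) * (`|w.1|^-1 * 1 * w.2.2.1 ^+ 2) +
    error_scale b2 y eta * (1 * `|w.2.1|^-1 * w.2.2.1 ^+ 2)) +
  3 * (error_scale b2 y eta * (1 * `|w.2.1|^-1 * nz w.2.2))).
  apply: mean_le_trans H; rewrite /lyapunov_mean.
  rewrite le_eqVlt; apply/orP; left; apply/eqP; ring.
move=> [g1 [g2 z]] /= g10 g20; rewrite /lyapunov_bound !gtr0_norm//; ring.
Qed.

End noise_means.

(** * Contraction in fixed dimension *)

Section sqrt_contraction.
Context (R : realType).

Lemma sqrt_sqrt_le (a b : R) : 0 <= a -> 0 <= b ->
  Num.sqrt (Num.sqrt a * b) <= 4^-1 * a + (2^-1 * b + 4^-1).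
Proof.
move=> a0 b0.
set s := Num.sqrt a; have s0 : 0 <= s by exact: sqrtr_ge0.
have sE : s ^+ 2 = a by rewrite sqr_sqrtr.
set t := Num.sqrt (s * b); have t0 : 0 <= t by exact: sqrtr_ge0.
have tE : t ^+ 2 = s * b by rewrite sqr_sqrtr// mulr_ge0.
have t2 : t <= (s + b) / 2.
  rewrite -(@ler_pXn2r _ 2) ?nnegrE ?divr_ge0 ?addr_ge0// tE expr_div_n.
  rewrite ler_pdivlMr// -subr_ge0.
  by rewrite (_ : _ - _ = (s - b) ^+ 2) ?sqr_ge0//; ring.
have := sqr_ge0 (s - 1); rewrite -sE; move: t2; clear; lra.
Qed.

(** A form of the Hoelder inequality for [(f * g ^+ 2) ^ (1 / 4)]: after [f] and [g]
    are divided by [A] and [B], it is the inequality between the geometric and the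
    arithmetic mean. *)
Lemma mean_sqrt_sqrt_le d (T : measurableType d) (P : probability T R)
    (f g : T -> R) (s A B : R) : 0 <= s -> 0 < A -> 0 < B ->
  mean_le P f A -> mean_le P g B ->
  mean_le P (fun x => Num.sqrt (Num.sqrt (s * f x) * g x))
    (Num.sqrt (Num.sqrt (s * A) * B)).
Proof.
move=> s0 A0 B0 fA gB.
have sA0 : 0 <= s * A by rewrite mulr_ge0// ltW.
set c := Num.sqrt (_ * B); have c0 : 0 <= c by exact: sqrtr_ge0.
have AV : 0 <= 4^-1 * A^-1 by rewrite mulr_ge0// invr_ge0 ltW.
have BV : 0 <= 2^-1 * B^-1 by rewrite mulr_ge0// invr_ge0 ltW.
have four : 0 <= 4^-1 :> R by [].
have [mh h0 hc] := mean_leZ c0 (mean_leD (mean_leZ AV fA)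
  (mean_leD (mean_leZ BV gB) (mean_le_cst P four))).
have [mf f0 _] := fA; have [mg g0 _] := gB.
have mF : measurable_fun setT (fun x => Num.sqrt (Num.sqrt (s * f x) * g x)).
  apply: (measurableT_comp (@measurable_sqrtr R)); apply: measurable_funM => //.
  by apply: (measurableT_comp (@measurable_sqrtr R)); exact: measurable_funM.
split => //.
have -> : c = c * (4^-1 * A^-1 * A + (2^-1 * B^-1 * B + 4^-1)).
  by field; rewrite !gt_eqF.
apply: le_trans hc; apply: ge0_le_integral; first by [].
- by move=> x _; rewrite lee_fin; exact: sqrtr_ge0.
- exact/measurable_EFinP.
- exact/measurable_EFinP.
move=> x _; rewrite lee_fin.
have -> : Num.sqrt (Num.sqrt (s * f x) * g x) =
    c * Num.sqrt (Num.sqrt (A^-1 * f x) * (B^-1 * g x)).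
  have e0 : 0 <= A^-1 * f x by rewrite mulr_ge0// invr_ge0 ltW.
  have -> : s * f x = s * A * (A^-1 * f x) by field; rewrite gt_eqF.
  have c1 : 0 <= Num.sqrt (s * A) * B.
    by apply: mulr_ge0; [exact: sqrtr_ge0|exact: ltW].
  rewrite (sqrtrM _ sA0) /c -(sqrtrM _ c1).
  by congr Num.sqrt; field; rewrite gt_eqF.
apply: ler_wpM2l => //; rewrite -!mulrA.
by apply: sqrt_sqrt_le; rewrite mulr_ge0// invr_ge0 ltW.
Qed.

End sqrt_contraction.

Section fixed_dimension.
Context (R : realType) (a1 a2 b1 b2 : R) (p r : nat) (y : 'M[R]_(p, r)).
Local Notation RB := (measurableTypeR R).
Local Notation T := (p.+1.-tuple RB).
Local Notation noiseT := (RB * (RB * (RB * p.-tuple RB)))%type.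
Local Notation Q := (between_sqr y).
Local Notation V := (lyapunov y).
Local Notation G := (error_scale b2 y).
Local Notation alpha1 := (theta_shape a1 p).
Local Notation alpha2 := (e_shape a2 p r).
Local Notation k0 := (gamma_cst R).
Local Notation N := (gibbs_noise a1 a2 p r).
Local Notation phi := (gibbs_map b1 b2 y).
Local Notation dist_mean := (dist_factor_mean a1 a2 b1 y).
Local Notation V_mean := (lyapunov_mean a1 a2 b1 b2 y).

Hypotheses (b1_gt0 : 0 < b1) (b2_gt0 : 0 < b2).
Hypotheses (p_gt0 : (0 < p)%N) (r_gt0 : (0 < r)%N).
Hypotheses (alpha1_ge4 : 4 <= alpha1) (alpha2_ge4 : 4 <= alpha2).

(** The geometric mean of the distance and of a Lyapunov function. The distance
    alone contracts only for states that are not too far out, and the Lyapunov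
    function alone only for states that are. *)
Definition cost (eta eta' : T) : R :=
  Num.sqrt (Num.sqrt (sqr_dist eta eta') * (V eta + V eta' + p%:R)).

Let U0 (eta eta' : T) : 0 <= V eta + V eta' + p%:R.
Proof. by rewrite addr_ge0// addr_ge0// lyapunov_ge0. Qed.

Lemma measurable_lyapunov : measurable_fun setT V.
Proof.
apply: measurable_funD.
  apply: measurable_sum => i; apply: measurable_funX.
  by apply: measurable_funB => //; apply: measurable_funD => //; exact: measurable_effect.
apply: measurable_funX; apply: measurable_funB => //; exact: measurable_intercept.
Qed.

Lemma measurable_sqr_dist :
  measurable_fun setT (fun z : T * T => sqr_dist z.1 z.2).
Proof.
apply: measurable_sum => i; apply: measurable_funX; apply: measurable_funB.
  exact: (measurableT_comp (measurable_tnth i) measurable_fst).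
exact: (measurableT_comp (measurable_tnth i) measurable_snd).
Qed.

Lemma measurable_cost : measurable_fun setT (fun z : T * T => cost z.1 z.2).
Proof.
apply: (measurableT_comp (@measurable_sqrtr R)); apply: measurable_funM.
  exact: (measurableT_comp (@measurable_sqrtr R) measurable_sqr_dist).
apply: measurable_funD => //; apply: measurable_funD.
  exact: (measurableT_comp measurable_lyapunov measurable_fst).
exact: (measurableT_comp measurable_lyapunov measurable_snd).
Qed.

Let alpha1_ge1 : 1 <= alpha1.
Proof. by apply: le_trans alpha1_ge4; rewrite ler1n. Qed.

Let alpha2_ge1 : 1 <= alpha2.
Proof. by apply: le_trans alpha2_ge4; rewrite ler1n. Qed.

Lemma measurable_gibbs_map_pair eta eta' :
  measurable_fun setT (fun w : noiseT => (phi eta w, phi eta' w)).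
Proof. by apply: measurable_fun_pair; exact: measurable_gibbs_map1. Qed.

(** Two bounds on the mean contraction of the squared distance are available:
    one which is uniform in the states, and one which is better unless the
    states are far in the tail of the Lyapunov function. *)
Definition dist_mean_le (eta eta' : T) (A : R) : Prop :=
  dist_mean 1 (k0 / alpha1) <= A \/
  dist_mean (8 * ((G eta + G eta') / b1) ^+ 2 * (k0 * alpha1 ^+ 2 * (k0 / alpha2 ^+ 2)))
    (8 * ((G eta + G eta') / b1) ^+ 2 * (k0 * alpha1 * (k0 / alpha2 ^+ 2))) <= A.

Let dist_meanP (eta eta' : T) (A : R) : dist_mean_le eta eta' A ->
  exists2 f : noiseT -> R, mean_le N f A &
    forall w, 0 < w.1 -> 0 < w.2.1 ->
      sqr_dist (phi eta w) (phi eta' w) <= sqr_dist eta eta' * f w.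
Proof.
case=> hA.
  have [f mf fE] := dist_factor1_mean y b1_gt0 alpha1_ge4 alpha2_ge4.
  exists f; first exact: mean_le_trans mf.
  by move=> w w0 w20; rewrite -fE//; apply: gibbs_map_dist_le => //; left.
have k_ge0 : 0 <= 8 * ((G eta + G eta') / b1) ^+ 2 by rewrite mulr_ge0// sqr_ge0.
have [f mf fE] := dist_factor2_mean y b1_gt0 alpha1_ge4 alpha2_ge4 k_ge0.
exists f; first exact: mean_le_trans mf.
move=> w w0 w20; rewrite -fE//; apply: gibbs_map_dist_le => //; right.
by rewrite -mulrA -exprMn.
Qed.

Lemma lyapunov_mean_le eta : exists2 f : noiseT -> R, mean_le N f (V_mean eta) &
  forall w, 0 < w.1 -> 0 < w.2.1 -> V (phi eta w) <= f w.
Proof.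
have [f mf fE] := lyapunov_bound_mean y b1_gt0 b2_gt0 r_gt0 alpha1_ge4 alpha2_ge4 eta.
by exists f => // w w0 w20; rewrite -fE//; exact: gibbs_map_lyapunov_le.
Qed.

Lemma gibbs_map_cost_le eta eta' (A B rho4 : R) : 0 < A -> 0 < B ->
  dist_mean_le eta eta' A -> V_mean eta + V_mean eta' + p%:R <= B ->
  A * B ^+ 2 <= rho4 * (V eta + V eta' + p%:R) ^+ 2 ->
  (\int[N]_w (cost (phi eta w) (phi eta' w))%:E <=
   (Num.sqrt (Num.sqrt rho4) * cost eta eta')%:E)%E.
Proof.
move=> A0 B0 /dist_meanP[f mf fD] VB AB.
have [g mg gV] := lyapunov_mean_le eta; have [g' mg' gV'] := lyapunov_mean_le eta'.
have p0 : 0 <= p%:R :> R by [].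
have mG := mean_le_trans VB (mean_leD (mean_leD mg mg') (mean_le_cst N p0)).
have D0 := sqr_dist_ge0 eta eta'; set D := sqr_dist eta eta' in fD D0 *.
have [mF F0 hF] := mean_sqrt_sqrt_le D0 A0 B0 mf mG.
have mcost : measurable_fun setT (fun w => cost (phi eta w) (phi eta' w)).
  exact: (measurableT_comp measurable_cost (measurable_gibbs_map_pair eta eta')).
apply: (@le_trans _ _ (\int[N]_w (Num.sqrt (Num.sqrt (D * f w) * (g w + g' w + p%:R)))%:E)%E).
  apply: le_integral_noise => //.
  - by move=> w; rewrite lee_fin sqrtr_ge0.
  - exact/measurable_EFinP.
  - exact/measurable_EFinP.
  move=> w w0 w20; rewrite lee_fin /cost ler_sqrt ?mulr_ge0 ?sqrtr_ge0//; last first.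
    by case: mG => _ h _; exact: h.
  apply: ler_pM; [exact: sqrtr_ge0|exact: U0| |].
    by apply: ler_wsqrtr; exact: fD.
  by rewrite lerD2r; apply: lerD; [exact: gV|exact: gV'].
apply: (le_trans hF); rewrite lee_fin /cost.
set U := V eta + V eta' + p%:R in AB *.
have U0' : 0 <= U by exact: U0.
have s0 : 0 <= Num.sqrt D by exact: sqrtr_ge0.
rewrite -sqrtrM ?sqrtr_ge0// ler_wsqrtr//.
have -> : Num.sqrt rho4 * (Num.sqrt D * U) = Num.sqrt D * (Num.sqrt rho4 * U) by ring.
rewrite sqrtrM// -mulrA; apply: ler_wpM2l => //.
have -> : Num.sqrt A * B = Num.sqrt (A * B ^+ 2).
  by rewrite sqrtrM ?(ltW A0)// sqrtr_sqr gtr0_norm.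
have -> : Num.sqrt rho4 * U = Num.sqrt (rho4 * U ^+ 2).
  by rewrite [rho4 * _]mulrC sqrtrM ?sqr_ge0// sqrtr_sqr ger0_norm// mulrC.
exact: ler_wsqrtr.
Qed.

Lemma gibbs_pushforward eta A : measurable A ->
  gibbs a1 a2 b1 b2 y eta A = N [set w | A (phi eta w)].
Proof.
move=> mA; apply: (etrans (gibbs_noiseE _ _ _ _ _ _ _ mA)) => //.
apply: (integral_indic_setT N (A := [set w | A (phi eta w)])).
rewrite -[X in measurable X]setTI; exact: (measurable_gibbs_map1 b1 b2 y eta).
Qed.

Lemma gibbs_drift eta (L : R) : V_mean eta <= V eta / 2 + L ->
  (\int[gibbs_kernel a1 a2 b1 b2 y eta]_x (V x)%:E <= (V eta / 2 + L)%:E)%E.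
Proof.
move=> hV; have [g mg gV] := lyapunov_mean_le eta; have [mg' g0 hg] := mg.
have mV := measurable_lyapunov.
pose mphi := measurable_gibbs_map b1 b2 y.
pose K : R.-pker T ~> T := mkimage (@kconst _ noiseT R _ T N) mphi.
have -> : (\int[gibbs_kernel a1 a2 b1 b2 y eta]_x (V x)%:E = \int[K eta]_x (V x)%:E)%E.
  by apply: eq_measure_integral => A mA _; exact: gibbs_pushforward.
have V0 x : (0 <= (V x)%:E)%E by rewrite lee_fin lyapunov_ge0.
have mVE : measurable_fun setT (fun x => (V x)%:E) by exact/measurable_EFinP.
rewrite (ge0_integral_mkimage N mphi eta V0 mVE).
apply: (@le_trans _ _ (\int[N]_w (g w)%:E)%E); last first.
  by apply: (le_trans hg); rewrite lee_fin.
apply: le_integral_noise => //.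
- apply/measurable_EFinP; apply: (measurableT_comp mV).
  exact: measurable_gibbs_map1.
- exact/measurable_EFinP.
Qed.

Lemma sqrt_sqr_dist_le eta eta' :
  Num.sqrt (sqr_dist eta eta') <= V eta + V eta' + p%:R.
Proof.
have D0 := sqr_dist_ge0 eta eta'; have DV := sqr_dist_lyapunov y eta eta'.
have V0 := lyapunov_ge0 y eta; have V0' := lyapunov_ge0 y eta'.
have p1 : 1 <= p%:R :> R by rewrite ler1n.
have sE : Num.sqrt (sqr_dist eta eta') ^+ 2 = sqr_dist eta eta' by exact: sqr_sqrtr.
have := sqr_ge0 (Num.sqrt (sqr_dist eta eta') - 1).
by move: DV sE V0 V0' p1; set s := Num.sqrt _; nra.
Qed.

Lemma euclidean_dist_le_cost eta eta' : euclidean_dist eta eta' <= cost eta eta'.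
Proof.
have U1 := U0 eta eta'; have s0 : 0 <= euclidean_dist eta eta' by exact: sqrtr_ge0.
rewrite -[leLHS]ger0_norm// -sqrtr_sqr expr2 ler_wsqrtr//.
by apply: ler_wpM2l => //; exact: sqrt_sqr_dist_le.
Qed.

Lemma cost_le eta eta' : cost eta eta' <= V eta + V eta' + p%:R.
Proof.
have U1 := U0 eta eta'.
rewrite -[leRHS]ger0_norm// -sqrtr_sqr expr2 ler_wsqrtr//.
by apply: ler_wpM2r => //; exact: sqrt_sqr_dist_le.
Qed.

Hypothesis proper : (posterior_weight a1 a2 b1 b2 y setT < +oo)%E.

(** The coupling lets both states move with the same noise. The stationary mean of
    the cost from [eta] is at most [V eta + 2 * L + p], as the drift bounds that of
    [V] by [2 * L]. *)
Lemma wasserstein_gibbs_le (rho4 L : R) : 0 <= L ->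
  (forall eta eta', exists A B, [/\ 0 < A, 0 < B, dist_mean_le eta eta' A,
     V_mean eta + V_mean eta' + p%:R <= B &
     A * B ^+ 2 <= rho4 * (V eta + V eta' + p%:R) ^+ 2]) ->
  (forall eta, V_mean eta <= V eta / 2 + L) ->
  forall eta m,
  (wasserstein (@euclidean_dist R p.+1) (kiter (gibbs_kernel a1 a2 b1 b2 y) m eta)
    (eta_posterior a1 a2 b1 b2 y) <=
   ((V eta + 2 * L + p%:R) * Num.sqrt (Num.sqrt rho4) ^+ m)%:E)%E.
Proof.
move=> L0 contr drift eta m.
pose Pi : probability T R := eta_posterior a1 a2 b1 b2 y.
pose K : R.-pker T ~> T := gibbs_kernel a1 a2 b1 b2 y.
have stat A : measurable A -> (\int[Pi]_x K x A = Pi A)%E.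
  by move=> mA; exact: eta_posterior_stationary.
have mf : measurable_fun setT
    (fun z : (T * T) * noiseT => (phi z.1.1 z.2, phi z.1.2 z.2)).
  have m1 : measurable_fun setT (fun z : (T * T) * noiseT => (z.1.1, z.2)).
    apply: measurable_fun_pair; last exact: measurable_snd.
    exact: (measurableT_comp measurable_fst measurable_fst).
  have m2 : measurable_fun setT (fun z : (T * T) * noiseT => (z.1.2, z.2)).
    apply: measurable_fun_pair; last exact: measurable_snd.
    exact: (measurableT_comp measurable_snd measurable_fst).
  apply: measurable_fun_pair.
    exact: (measurableT_comp (measurable_gibbs_map b1 b2 y) m1).
  exact: (measurableT_comp (measurable_gibbs_map b1 b2 y) m2).
pose Q : R.-pker (T * T)%type ~> (T * T)%type :=
  mkimage (@kconst _ noiseT R _ (T * T)%type N) mf.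
have mpsi : measurable_fun setT (fun z : T * T => euclidean_dist z.1 z.2).
  exact: (measurableT_comp (@measurable_sqrtr R) measurable_sqr_dist).
have Q1 (z : T * T) A : measurable A -> Q z (fst @^-1` A) = K z.1 A.
  by move=> mA; apply/esym; exact: gibbs_pushforward.
have Q2 (z : T * T) A : measurable A -> Q z (snd @^-1` A) = K z.2 A.
  by move=> mA; apply/esym; exact: gibbs_pushforward.
have QC (z : T * T) : (\int[Q z]_z' (cost z'.1 z'.2)%:E <=
    (Num.sqrt (Num.sqrt rho4) * cost z.1 z.2)%:E)%E.
  have [A [B [A0 B0 DA VB AB]]] := contr z.1 z.2.
  have c0 (z' : T * T) : (0 <= (cost z'.1 z'.2)%:E)%E by rewrite lee_fin sqrtr_ge0.
  have mcE : measurable_fun setT (fun z' : T * T => (cost z'.1 z'.2)%:E).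
    by apply/measurable_EFinP; exact: measurable_cost.
  rewrite (ge0_integral_mkimage N mf z c0 mcE).
  exact: gibbs_map_cost_le A0 B0 DA VB AB.
have psi0 (x x' : T) : 0 <= euclidean_dist x x' by exact: sqrtr_ge0.
have W := @wasserstein_kiter_le _ T R K Q (@euclidean_dist R p.+1) cost
  (Num.sqrt (Num.sqrt rho4)) Pi mpsi measurable_cost psi0 euclidean_dist_le_cost
  (sqrtr_ge0 _) Q1 Q2 QC stat eta m.
apply: (le_trans W); rewrite [(_ + p%:R) * _]mulrC [leRHS]EFinM.
apply: lee_wpmul2l; first by rewrite lee_fin exprn_ge0// sqrtr_ge0.
have mom : (\int[Pi]_x (V x)%:E <= (2 * L)%:E)%E.
  apply: (stationary_moment_le stat measurable_lyapunov (lyapunov_ge0 y) L0).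
  by move=> x; exact: gibbs_drift.
have [mVm _ hm] : mean_le Pi (fun x => V x + (V eta + p%:R)) (2 * L + (V eta + p%:R)).
  apply: mean_leD; first by split => //; [exact: measurable_lyapunov|exact: lyapunov_ge0].
  by apply: mean_le_cst; rewrite addr_ge0// lyapunov_ge0.
rewrite (_ : V eta + 2 * L + p%:R = 2 * L + (V eta + p%:R)); last by ring.
apply: le_trans hm; apply: ge0_le_integral => //.
- by move=> x _; rewrite lee_fin sqrtr_ge0.
- apply/measurable_EFinP.
  exact: (measurableT_comp measurable_cost (pair1_measurable eta)).
- by apply/measurable_EFinP.
- move=> x _; rewrite lee_fin; apply: le_trans (cost_le _ _) _.
  by rewrite le_eqVlt; apply/orP; left; apply/eqP; ring.
Qed.

End fixed_dimension.

(** * Constants uniform in the dimension *)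

(** [M] dominates every constant of the model. As it is at least [10], it also
    absorbs numerical factors, so that the bounds keep track of powers of [M], of
    [p], of [r] and of the Lyapunov functions only. *)
Section uniform_constants.
Context (R : realType) (a1 a2 b1 b2 : R) (p r : nat) (y : 'M[R]_(p, r)).
Variable M : R.
Local Notation RB := (measurableTypeR R).
Local Notation T := (p.+1.-tuple RB).
Local Notation Q := (between_sqr y).
Local Notation V := (lyapunov y).
Local Notation G := (error_scale b2 y).
Local Notation alpha1 := (theta_shape a1 p).
Local Notation alpha2 := (e_shape a2 p r).
Local Notation k0 := (gamma_cst R).
Local Notation iP := (p%:R^-1 : R).
Local Notation iR := (r%:R^-1 : R).
Local Notation P := (p%:R : R).
Local Notation dist_mean := (dist_factor_mean a1 a2 b1 y).
Local Notation V_mean := (lyapunov_mean a1 a2 b1 b2 y).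

Hypotheses (b1_gt0 : 0 < b1) (b2_gt0 : 0 < b2).
Hypotheses (p_gt0 : (0 < p)%N) (p_le_r : (p <= r)%N).
Hypotheses (M_ge10 : 10 <= M) (b1_le : b1 <= M) (b1V_le : b1^-1 <= M).
Hypotheses (b2_le : b2 <= M) (k0_le : k0 <= M).
Hypotheses (alpha1_le : alpha1 <= M * P) (alpha1_ge : P / 2 <= alpha1).
Hypothesis alpha2_ge : (r * p)%:R / 2 <= alpha2.
Hypotheses (Q_le : Q <= M * P) (W_le : within_sqr y / r%:R <= M * P).

Let P1 : 1 <= P. Proof. by rewrite ler1n. Qed.
Let P0 : 0 < P. Proof. by rewrite ltr0n. Qed.
Let r_gt0 : (0 < r)%N. Proof. exact: leq_trans p_le_r. Qed.
Let R0 : 0 < r%:R :> R. Proof. by rewrite ltr0n. Qed.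
Let iP0 : 0 < iP. Proof. by rewrite invr_gt0. Qed.
Let iR0 : 0 < iR. Proof. by rewrite invr_gt0. Qed.
Let iRP : iR <= iP. Proof. by rewrite lef_pV2 ?posrE// ler_nat. Qed.
Let iP1 : iP <= 1. Proof. by rewrite invf_le1. Qed.
Let iR1 : iR <= 1. Proof. exact: le_trans iP1. Qed.
Let M0 : 0 < M. Proof. by apply: lt_le_trans M_ge10; rewrite ltr0n. Qed.
Let M1 : 1 <= M. Proof. by apply: le_trans M_ge10; rewrite ler1n. Qed.
Let k00 : 0 <= k0. Proof. exact/ltW/gamma_cst_gt0. Qed.
Let alpha10 : 0 < alpha1. Proof. by apply: lt_le_trans alpha1_ge; rewrite divr_gt0. Qed.
Let alpha20 : 0 < alpha2.
Proof. by apply: lt_le_trans alpha2_ge; rewrite divr_gt0// ltr0n muln_gt0 r_gt0. Qed.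
Let Q0 : 0 <= Q. Proof. exact: between_sqr_ge0. Qed.

Let alpha1V : alpha1^-1 <= 2 * iP.
Proof.
rewrite -[2]invrK -invfM lef_pV2 ?posrE ?mulr_gt0//.
by rewrite mulrC.
Qed.

Let alpha2V : alpha2^-1 <= 2 * (iR * iP).
Proof.
rewrite -[2]invrK -!invfM lef_pV2 ?posrE ?mulr_gt0//.
by rewrite mulrC -natrM.
Qed.

Let n0_le : k0 / alpha1 <= 2 * M * iP.
Proof.
rewrite [2 * M]mulrC -mulrA; apply: ler_pM => //.
by rewrite invr_ge0 ltW.
Qed.

Let n1_le : k0 / alpha2 <= 2 * M * (iR * iP).
Proof.
rewrite [2 * M]mulrC -mulrA; apply: ler_pM => //.
by rewrite invr_ge0 ltW.
Qed.

Let n2_le : k0 / alpha2 ^+ 2 <= 4 * M * (iR * iP) ^+ 2.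
Proof.
have -> : 4 * M * (iR * iP) ^+ 2 = M * (2 * (iR * iP)) ^+ 2 by ring.
rewrite -exprVn; apply: ler_pM => //; first exact: sqr_ge0.
by apply: ler_sqrS => //; rewrite invr_ge0 ltW.
Qed.

Let n0_ge0 : 0 <= k0 / alpha1. Proof. by apply: divr_ge0 => //; exact: ltW. Qed.
Let n1_ge0 : 0 <= k0 / alpha2. Proof. by apply: divr_ge0 => //; exact: ltW. Qed.
Let n2_ge0 : 0 <= k0 / alpha2 ^+ 2.
Proof. by apply: divr_ge0 => //; exact: sqr_ge0. Qed.

Let m1_le : k0 * alpha1 <= M ^+ 2 * P.
Proof. by rewrite expr2 -mulrA; apply: ler_pM => //; exact: ltW. Qed.

Let m2_le : k0 * alpha1 ^+ 2 <= M ^+ 3 * P ^+ 2.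
Proof.
have -> : M ^+ 3 * P ^+ 2 = M * (M * P) ^+ 2 by ring.
by apply: ler_pM => //; [exact: sqr_ge0|apply: ler_sqrS => //; exact: ltW].
Qed.

Let m1_ge0 : 0 <= k0 * alpha1. Proof. by apply: mulr_ge0 => //; exact: ltW. Qed.
Let m2_ge0 : 0 <= k0 * alpha1 ^+ 2.
Proof. by apply: mulr_ge0 => //; exact: sqr_ge0. Qed.

Let m1n1_le : k0 * alpha1 * (k0 / alpha2) <= 2 * M ^+ 3 * iR.
Proof.
have -> : 2 * M ^+ 3 * iR = M ^+ 2 * P * (2 * M * (iR * iP)).
  by field; rewrite !gt_eqF.
exact: ler_pM.
Qed.

Let m1n2_le : k0 * alpha1 * (k0 / alpha2 ^+ 2) <= 4 * M ^+ 3 * iR ^+ 2 * iP.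
Proof.
have -> : 4 * M ^+ 3 * iR ^+ 2 * iP = M ^+ 2 * P * (4 * M * (iR * iP) ^+ 2).
  by field; rewrite !gt_eqF.
exact: ler_pM.
Qed.

Let m2n2_le : k0 * alpha1 ^+ 2 * (k0 / alpha2 ^+ 2) <= 4 * M ^+ 4 * iR ^+ 2.
Proof.
have -> : 4 * M ^+ 4 * iR ^+ 2 = M ^+ 3 * P ^+ 2 * (4 * M * (iR * iP) ^+ 2).
  by field; rewrite !gt_eqF.
exact: ler_pM.
Qed.

Let q_le : 8 * Q / b1 <= 8 * M ^+ 2 * P.
Proof.
have -> : 8 * M ^+ 2 * P = 8 * (M * P) * M by ring.
apply: ler_pM => //; first exact: mulr_ge0.
  by rewrite invr_ge0 ltW.
by rewrite ler_pM2l.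
Qed.

Let q_ge0 : 0 <= 8 * Q / b1.
Proof. by apply: divr_ge0; [exact: mulr_ge0|exact: ltW]. Qed.

Let n0P : k0 / alpha1 * P <= 2 * M.
Proof.
by apply: le_trans (ler_wpM2r (ltW P0) n0_le) _; rewrite divfK ?gt_eqF.
Qed.

Let n1P : k0 / alpha2 * P <= 2 * M * iR.
Proof.
apply: le_trans (ler_wpM2r (ltW P0) n1_le) _.
by rewrite mulrA divfK ?gt_eqF.
Qed.

Let pow_le (i j : nat) : (i <= j)%N -> M ^+ i <= M ^+ j.
Proof. by move=> ij; rewrite ler_weXn2l. Qed.

Let pow_gt0 i : 0 < M ^+ i. Proof. exact: exprn_gt0. Qed.

Lemma dist_mean1_le : dist_mean 1 (k0 / alpha1) <= M ^+ 9 * P.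
Proof.
have X0 : M <= M ^+ 5 * P.
  rewrite -[leLHS]mulr1; apply: ler_pM => //; first exact: ltW.
  by rewrite -[leLHS]expr1; exact: pow_le.
have h1 : 8 * Q / b1 * (1 + k0 * alpha1 * (k0 / alpha2)) <= 24 * (M ^+ 5 * P).
  have -> : 24 * (M ^+ 5 * P) = 8 * M ^+ 2 * P * (3 * M ^+ 3) by ring.
  apply: ler_pM => //; first by rewrite addr_ge0// mulr_ge0.
  have e1 : 1 <= M ^+ 3 by rewrite exprn_ege1.
  have e2 : M ^+ 3 * iR <= M ^+ 3 by rewrite ler_piMr// ltW.
  by move: m1n1_le e1 e2; lra.
have h2 : k0 / alpha1 <= 2 * M.
  by apply: le_trans n0_le _; rewrite ler_piMr// mulr_ge0// ltW.
have h3 : k0 / alpha2 <= 2 * M.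
  apply: le_trans n1_le _; rewrite ler_piMr//; first by rewrite mulr_ge0// ltW.
  by rewrite mulr_ile1// ltW.
have h4 : k0 / alpha2 * P <= 2 * M.
  by apply: le_trans n1P _; rewrite ler_piMr// mulr_ge0// ltW.
have h5 : 1080 * (M ^+ 5 * P) <= M ^+ 9 * P.
  have -> : M ^+ 9 * P = M ^+ 4 * (M ^+ 5 * P) by ring.
  rewrite ler_pM2r ?mulr_gt0//; apply: (@le_trans _ _ (10 ^+ 4)).
    by rewrite -natrX ler_nat.
  by apply: lerXn2r; rewrite ?nnegrE// ltW.
apply: le_trans h5; rewrite /dist_factor_mean.
move: X0 h1 h2 h3 n0P h4; move: (8 * Q / b1 * _) => t.
move: (k0 / alpha1) (k0 / alpha2) => u v; lra.
Qed.

Section far_states.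
Variables (U : R) (eta eta' : T).
Hypothesis UE : U = V eta + V eta' + P.

Let PU : P <= U.
Proof. by rewrite UE lerDr addr_ge0// lyapunov_ge0. Qed.

Let U_gt0 : 0 < U. Proof. exact: lt_le_trans PU. Qed.

Let Gamma := G eta + G eta'.

Let Gamma_ge0 : 0 <= Gamma.
Proof. by apply: addr_ge0; exact: error_scale_ge0. Qed.

Let Gamma_le : Gamma <= 4 * M * U.
Proof.
have h1 : b2 <= M * P by apply: le_trans b2_le _; rewrite ler_peMr// ltW.
have V0 : 0 <= V eta + V eta' by rewrite addr_ge0// lyapunov_ge0.
have h2 : V eta + V eta' <= M * (V eta + V eta') by rewrite ler_peMl.
have h3 : 0 <= M * (V eta + V eta') by rewrite mulr_ge0// ltW.
rewrite /Gamma /error_scale UE; move: h1 W_le h2 h3.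
by move: (V eta) (V eta') (within_sqr y / _) => v v' w; lra.
Qed.

Let ratio_le : 8 * (Gamma / b1) ^+ 2 <= 128 * M ^+ 4 * U ^+ 2.
Proof.
have -> : 128 * M ^+ 4 * U ^+ 2 = 8 * (4 * M * U * M) ^+ 2 by ring.
rewrite ler_pM2l//; apply: ler_sqrS; first by apply: divr_ge0 => //; exact: ltW.
by apply: ler_pM => //; rewrite invr_ge0 ltW.
Qed.

Let ratio_ge0 : 0 <= 8 * (Gamma / b1) ^+ 2.
Proof. by apply: mulr_ge0 => //; exact: sqr_ge0. Qed.

Lemma dist_mean2_le :
  dist_mean (8 * (Gamma / b1) ^+ 2 * (k0 * alpha1 ^+ 2 * (k0 / alpha2 ^+ 2)))
    (8 * (Gamma / b1) ^+ 2 * (k0 * alpha1 * (k0 / alpha2 ^+ 2)))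
  <= M ^+ 16 * (P * U ^+ 2 * iR ^+ 2 + P * iR + iP).
Proof.
have rl := ratio_le; have rg := ratio_ge0.
set ratio := 8 * (Gamma / b1) ^+ 2 in rl rg *.
set S1 := P * U ^+ 2 * iR ^+ 2; set S2 := P * iR.
have S1_0 : 0 <= S1 by rewrite !mulr_ge0// ?sqr_ge0// ltW.
have S2_0 : 0 <= S2 by rewrite mulr_ge0// ltW.
pose X := M ^+ 10.
have X0 : 0 <= X by exact: exprn_ge0 (ltW M0).
have h1 : 8 * Q / b1 * (ratio * (k0 * alpha1 ^+ 2 * (k0 / alpha2 ^+ 2)) +
    k0 * alpha1 * (k0 / alpha2)) <= 4096 * M ^+ 10 * S1 + 16 * M ^+ 5 * S2.
  have -> : 4096 * M ^+ 10 * S1 + 16 * M ^+ 5 * S2 = 8 * M ^+ 2 * P *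
     (128 * M ^+ 4 * U ^+ 2 * (4 * M ^+ 4 * iR ^+ 2) + 2 * M ^+ 3 * iR).
    by rewrite /S1 /S2; ring.
  apply: ler_pM => //.
    by apply: addr_ge0; apply: mulr_ge0 => //; exact: mulr_ge0.
  by apply: lerD => //; apply: ler_pM => //; exact: mulr_ge0.
have h3 : ratio * (k0 * alpha1 * (k0 / alpha2 ^+ 2)) * P <= 512 * M ^+ 7 * S1.
  apply: (@le_trans _ _ (128 * M ^+ 4 * U ^+ 2 * (4 * M ^+ 3 * iR ^+ 2 * iP) * P)).
    by apply: ler_wpM2r; [exact: ltW|apply: ler_pM => //; exact: mulr_ge0].
  have -> : 128 * M ^+ 4 * U ^+ 2 * (4 * M ^+ 3 * iR ^+ 2 * iP) * P =
    512 * M ^+ 7 * (U ^+ 2 * iR ^+ 2) by field; rewrite !gt_eqF.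
  have c0 : 0 <= 512 * M ^+ 7 by apply: mulr_ge0; [exact: ler0n|exact: ltW].
  apply: (ler_wpM2l c0).
  by rewrite /S1 -mulrA ler_peMl// mulr_ge0 ?sqr_ge0.
have h4 : k0 / alpha2 * P <= 2 * M * S2.
  apply: le_trans n1P _; apply: ler_wpM2l; first by rewrite mulr_ge0// ltW.
  by rewrite ler_peMl// ltW.
have h5 : k0 / alpha2 <= 2 * M * iP.
  apply: le_trans n1_le _; apply: ler_wpM2l; first by rewrite mulr_ge0// ltW.
  by rewrite ler_piMl// ltW.
have t2 : 512 * M ^+ 7 * S1 <= X * S1.
  apply: ler_wpM2r => //; have -> : X = M ^+ 3 * M ^+ 7 by rewrite /X -exprD.
  rewrite ler_pM2r//; apply: (@le_trans _ _ (10 ^+ 3)); first by rewrite -natrX ler_nat.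
  by apply: lerXn2r; rewrite ?nnegrE// ltW.
have t3 : M ^+ 5 * S2 <= X * S2 by apply: ler_wpM2r => //; exact: pow_le.
have t4 : M * S2 <= X * S2.
  by apply: ler_wpM2r => //; rewrite -[leLHS]expr1; exact: pow_le.
have t5 : M * iP <= X * iP.
  by apply: ler_wpM2r; [exact: ltW|rewrite -[leLHS]expr1; exact: pow_le].
have t6 : 5000 * (X * (S1 + S2 + iP)) <= M ^+ 16 * (S1 + S2 + iP).
  rewrite mulrA; apply: ler_wpM2r; first by rewrite !addr_ge0// ltW.
  apply: (@le_trans _ _ (M ^+ 4 * X)).
    rewrite ler_pM2r ?exprn_gt0//; apply: (@le_trans _ _ (10 ^+ 4)).
      by rewrite -natrX ler_nat.
    by apply: lerXn2r; rewrite ?nnegrE// ltW.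
  by rewrite /X -exprD; exact: pow_le.
apply: le_trans t6; rewrite /dist_factor_mean.
have s1 := mulr_ge0 X0 S1_0; have s2 := mulr_ge0 X0 S2_0.
have s3 : 0 <= X * iP by apply: mulr_ge0 => //; exact: ltW.
have E : 16 * (ratio * (k0 * alpha1 * (k0 / alpha2 ^+ 2))) * (8 * P) =
  128 * (ratio * (k0 * alpha1 * (k0 / alpha2 ^+ 2)) * P) by ring.
rewrite [(16 * _ + _) * _]mulrDl E.
have E' : 24 * (k0 / alpha2) * (8 * P) = 192 * (k0 / alpha2 * P) by ring.
rewrite E' [X in 5000 * X]mulrDr [X in 5000 * (X + _)]mulrDr.
move: h1 h3 h4 h5 n0_le t2 t3 t4 t5 s1 s2 s3; rewrite -/X.
move: (8 * Q / b1 * _) => u1; move: (ratio * _ * P) => u2.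
move: (k0 / alpha2 * P) => u3; move: (k0 / alpha2) (k0 / alpha1) => u4 u5.
rewrite -![4096 * _ * _]mulrA -![16 * _ * _]mulrA -![2 * _ * _]mulrA -![512 * _ * _]mulrA.
move: (X * S1) (X * S2) (X * iP) (M ^+ 5 * S2) (M * S2) (M * iP) (M ^+ 7 * S1).
by move=> v1 v2 v3 v4 v5 v6 v7; lra.
Qed.

Let B : R := M ^+ 5 * (P + U * iP).

(** In the tail the sum [U] drops to [U / P]; elsewhere it is brought to order [P]. *)
Lemma lyapunov_mean_pair_le : V_mean eta + V_mean eta' + P <= B.
Proof.
have V0 : 0 <= V eta by exact: lyapunov_ge0.
have V'0 : 0 <= V eta' by exact: lyapunov_ge0.
have h1 : b1 <= M * P by apply: le_trans b1_le _; rewrite ler_peMr// ltW.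
have MU : M * P <= M * U by rewrite ler_pM2l.
have VU : V eta + V eta' <= M * U.
  by apply: (@le_trans _ _ U); [rewrite UE lerDl ltW|rewrite ler_peMl// ltW].
have GU := Gamma_le.
have c0 : 0 <= 5 * (M * U) by rewrite !mulr_ge0// ltW.
have g1 : (2 * b1 + 2 * Q + (V eta + V eta')) * (k0 / alpha1) <= 10 * (M ^+ 2 * (U * iP)).
  have -> : 10 * (M ^+ 2 * (U * iP)) = 5 * (M * U) * (2 * M * iP) by ring.
  apply: ler_pM => //; last first.
    by move: h1 Q_le MU VU; move: (V eta + V eta') (M * U) => v u; lra.
  apply: addr_ge0; last exact: addr_ge0.
  by apply: addr_ge0; apply: mulr_ge0 => //; exact: ltW.
have g2 : Gamma * (k0 / alpha2) <= 10 * (M ^+ 2 * (U * iP)).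
  have -> : 10 * (M ^+ 2 * (U * iP)) = 5 * (M * U) * (2 * M * iP) by ring.
  apply: ler_pM => //.
    apply: (le_trans GU); rewrite -mulrA; apply: ler_wpM2r; last by rewrite ler_nat.
    by rewrite mulr_ge0// ltW.
  apply: (le_trans n1_le); apply: ler_wpM2l; first by rewrite mulr_ge0// ltW.
  by rewrite ler_piMl// ltW.
have g3 : Gamma * (k0 / alpha2 * P) <= 10 * (M ^+ 2 * (U * iP)).
  have -> : 10 * (M ^+ 2 * (U * iP)) = 5 * (M * U) * (2 * M * iP) by ring.
  apply: ler_pM => //.
  - by apply: mulr_ge0 => //; exact: ltW.
  - apply: (le_trans GU); rewrite -mulrA; apply: ler_wpM2r; last by rewrite ler_nat.
    by rewrite mulr_ge0// ltW.
  - apply: (le_trans n1P); apply: ler_wpM2l => //.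
    by rewrite mulr_ge0// ltW.
have E : V_mean eta + V_mean eta' + P = 6 * Q +
   32 * ((2 * b1 + 2 * Q + (V eta + V eta')) * (k0 / alpha1) + Gamma * (k0 / alpha2)) +
   24 * (Gamma * (k0 / alpha2 * P)) + P.
  by rewrite /lyapunov_mean /Gamma; ring.
have M5 : M ^+ 5 = M ^+ 3 * M ^+ 2 by rewrite -exprD.
have M3 : 1000 <= M ^+ 3.
  apply: (@le_trans _ _ (10 ^+ 3)); first by rewrite -natrX ler_nat.
  by apply: lerXn2r; rewrite ?nnegrE// ltW.
have UP0 : 0 <= M ^+ 2 * (U * iP) by rewrite !mulr_ge0// ltW.
have MP0 : 0 <= M * P by rewrite mulr_ge0// ltW.
have h6 : 1000 * (M ^+ 2 * (U * iP)) <= M ^+ 5 * (U * iP).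
  by rewrite M5 -mulrA ler_wpM2r.
have h7 : 7 * (M * P) <= M ^+ 5 * P.
  have -> : M ^+ 5 * P = M ^+ 4 * (M * P) by ring.
  apply: ler_wpM2r => //; apply: (@le_trans _ _ M).
    by apply: le_trans M_ge10; rewrite ler_nat.
  by rewrite -[leLHS]expr1; exact: pow_le.
have h8 : P <= M * P by rewrite ler_peMl// ltW.
rewrite E /B [M ^+ 5 * (_ + _)]mulrDr; move: Q_le g1 g2 g3 h6 h7 h8 UP0.
move: (_ * (k0 / alpha1)) => u1; move: (Gamma * (k0 / alpha2 * P)) => u2.
move: (Gamma * (k0 / alpha2)) => u3.
move: (M ^+ 2 * (U * iP)) (M ^+ 5 * (U * iP)) (M ^+ 5 * P) (M * P).
by move=> v1 v2 v3 v4; lra.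
Qed.

(** In the tail [U >= P ^ 2] the Lyapunov function contracts by a factor of
    order [1 / P], which makes up for an expansion of the squared distance by [P].
    For [U < P ^ 2] it is only known to be brought to order [P], and the better
    bound on the distance is used. *)
Lemma contraction_constants : exists A B, [/\ 0 < A, 0 < B,
  dist_mean_le a1 a2 b1 b2 y eta eta' A, V_mean eta + V_mean eta' + P <= B &
  A * B ^+ 2 <= M ^+ 27 * (P ^+ 3 * iR ^+ 2 + P * iR + iP) * U ^+ 2].
Proof.
have U2 : 0 <= U ^+ 2 by exact: sqr_ge0.
have B0 : 0 < B by rewrite mulr_gt0// addr_gt0// mulr_gt0.
have S1_0 : 0 <= P ^+ 3 * iR ^+ 2 * U ^+ 2.
  by rewrite !mulr_ge0// ?exprn_ge0// ltW.
have S2_0 : 0 <= P * iR * U ^+ 2 by rewrite !mulr_ge0// ltW.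
have S3_0 : 0 <= iP * U ^+ 2 by rewrite mulr_ge0// ltW.
have M4 : 4 <= M by apply: le_trans M_ge10; rewrite ler_nat.
have [PU2|UP2] := leP (P ^+ 2) U.
- exists (M ^+ 9 * P), B; split => //.
  + exact: mulr_gt0.
  + by left; exact: dist_mean1_le.
  + exact: lyapunov_mean_pair_le.
  have h : P <= U * iP by rewrite ler_pdivlMr// -expr2.
  have hB : B ^+ 2 <= (M ^+ 5 * (2 * (U * iP))) ^+ 2.
    apply: ler_sqrS; first exact: ltW.
    by apply: ler_wpM2l; [exact: ltW|lra].
  apply: (@le_trans _ _ (M ^+ 9 * P * (M ^+ 5 * (2 * (U * iP))) ^+ 2)).
    by apply: ler_wpM2l => //; apply: mulr_ge0; exact: ltW.
  have -> : M ^+ 9 * P * (M ^+ 5 * (2 * (U * iP))) ^+ 2 =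
      4 * M ^+ 19 * (iP * U ^+ 2) by field; rewrite gt_eqF.
  apply: (@le_trans _ _ (M ^+ 27 * (iP * U ^+ 2))).
    apply: ler_wpM2r => //; apply: (@le_trans _ _ (M * M ^+ 19)).
      by rewrite ler_pM2r.
    by rewrite -exprS; exact: pow_le.
  rewrite -mulrA ler_pM2l//; rewrite !mulrDl; lra.
- exists (M ^+ 16 * (P * U ^+ 2 * iR ^+ 2 + P * iR + iP)), B; split => //.
  + apply: mulr_gt0 => //; apply: ltr_wpDl => //.
    by apply: addr_ge0; rewrite !mulr_ge0 ?sqr_ge0// ltW.
  + by right; exact: dist_mean2_le.
  + exact: lyapunov_mean_pair_le.
  have h : U * iP <= P by rewrite ler_pdivrMr// -expr2 ltW.
  have hB : B ^+ 2 <= (M ^+ 5 * (2 * P)) ^+ 2.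
    apply: ler_sqrS; first exact: ltW.
    by apply: ler_wpM2l; [exact: ltW|lra].
  have T0 : 0 <= P * U ^+ 2 * iR ^+ 2 + P * iR + iP.
    by rewrite !addr_ge0// ?mulr_ge0 ?sqr_ge0// ltW.
  apply: (@le_trans _ _ (M ^+ 16 * (P * U ^+ 2 * iR ^+ 2 + P * iR + iP) *
      (M ^+ 5 * (2 * P)) ^+ 2)).
    by apply: ler_wpM2l => //; apply: mulr_ge0 => //; exact: ltW.
  have -> : M ^+ 16 * (P * U ^+ 2 * iR ^+ 2 + P * iR + iP) * (M ^+ 5 * (2 * P)) ^+ 2 =
    4 * M ^+ 26 * (P ^+ 3 * iR ^+ 2 * U ^+ 2 + P * iR * P ^+ 2 + iP * P ^+ 2).
    by ring.
  apply: (@le_trans _ _ (M ^+ 27 *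
      (P ^+ 3 * iR ^+ 2 * U ^+ 2 + P * iR * P ^+ 2 + iP * P ^+ 2))).
    apply: ler_wpM2r.
      by rewrite !addr_ge0// !mulr_ge0 ?sqr_ge0// ltW.
    by rewrite [leRHS]exprS ler_pM2r.
  rewrite -[leRHS]mulrA ler_pM2l// !mulrDl.
  have PU' : P ^+ 2 <= U ^+ 2 by apply: ler_sqrS => //; exact: ltW.
  apply: lerD; first apply: lerD => //.
    by apply: ler_wpM2l => //; rewrite mulr_ge0// ltW.
  by apply: ler_wpM2l => //; exact: ltW.
Qed.

End far_states.

(* The coefficient of [V eta] in [lyapunov_mean] is at most [176 * M / P]. *)
Hypothesis M_le : 352 * M <= P.

Lemma lyapunov_mean_drift (eta : T) : V_mean eta <= V eta / 2 + M ^+ 5 * P.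
Proof.
have V0 : 0 <= V eta by exact: lyapunov_ge0.
have h1 : b1 <= M * P by apply: le_trans b1_le _; rewrite ler_peMr// ltW.
have h2 : b2 <= M * P by apply: le_trans b2_le _; rewrite ler_peMr// ltW.
pose H := 2 * (M * P) + V eta.
have MP0 : 0 <= M * P by rewrite mulr_ge0// ltW.
have H0 : 0 <= H by rewrite addr_ge0// mulr_ge0.
have Gle : error_scale b2 y eta <= H by rewrite /error_scale /H; move: h2 W_le; lra.
have G0 : 0 <= error_scale b2 y eta by exact: error_scale_ge0.
have g1 : (b1 + Q + V eta) * (k0 / alpha1) <= H * (2 * M * iP).
  apply: ler_pM => //; last by rewrite /H; move: h1 Q_le; lra.
  by apply: addr_ge0 => //; apply: addr_ge0 => //; exact: ltW.
have g2 : error_scale b2 y eta * (k0 / alpha2) <= H * (2 * M * iP).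
  apply: ler_pM => //; apply: (le_trans n1_le); apply: ler_wpM2l.
    by rewrite mulr_ge0// ltW.
  by rewrite ler_piMl// ltW.
have g3 : error_scale b2 y eta * (k0 / alpha2 * P) <= H * (2 * M * iP).
  apply: ler_pM => //.
    by apply: mulr_ge0 => //; exact: ltW.
  apply: (le_trans n1P); apply: ler_wpM2l => //.
  by rewrite mulr_ge0// ltW.
have E : V_mean eta = 3 * Q +
   32 * ((b1 + Q + V eta) * (k0 / alpha1) + error_scale b2 y eta * (k0 / alpha2)) +
   24 * (error_scale b2 y eta * (k0 / alpha2 * P)).
  by rewrite /lyapunov_mean; ring.
have HE : H * (2 * M * iP) = 4 * M ^+ 2 + 2 * (V eta * (M * iP)).
  by rewrite /H; field; rewrite gt_eqF.
have MiP : 352 * (M * iP) <= 1 by rewrite mulrA ler_pdivrMr// mul1r.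
have VM : 352 * (V eta * (M * iP)) <= V eta.
  have -> : 352 * (V eta * (M * iP)) = V eta * (352 * (M * iP)) by ring.
  by rewrite ler_piMr.
have M2 : M ^+ 2 <= M ^+ 2 * P by rewrite ler_peMr// ltW.
have MMP : M * P <= M ^+ 2 * P by rewrite ler_pM2r// -[leLHS]expr1; exact: pow_le.
have M5 : 1000 * (M ^+ 2 * P) <= M ^+ 5 * P.
  have -> : M ^+ 5 * P = M ^+ 3 * (M ^+ 2 * P) by ring.
  apply: ler_wpM2r; first by rewrite mulr_ge0// ltW.
  apply: (@le_trans _ _ (10 ^+ 3)); first by rewrite -natrX ler_nat.
  by apply: lerXn2r; rewrite ?nnegrE// ltW.
have M20 : 0 <= M ^+ 2 * P by rewrite mulr_ge0// ltW.
rewrite E; move: g1 g2 g3; rewrite HE; move: Q_le VM M2 MMP M5 M20.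
move: (_ * (k0 / alpha1)) => u1; move: (error_scale b2 y eta * (k0 / alpha2 * P)) => u2.
move: (error_scale b2 y eta * (k0 / alpha2)) (V eta * (M * iP)) => u3 u4.
move: (M ^+ 2 * P) (M ^+ 5 * P) (M * P) (M ^+ 2) => v1 v2 v3 v4; lra.
Qed.

End uniform_constants.

(** * The rate tends to zero *)

Section rate.
Context (R : realType) (r : nat -> nat).
Variable delta : R.
Hypothesis delta_gt0 : 0 < delta.
Hypothesis r_gt0 : forall p, (0 < p)%N -> (0 < r p)%N.
Hypothesis sample_size :
  (r p)%:R ^+ 2 / p%:R `^ (3 + delta) @[p --> \oo] --> +oo.

Let cube_le (e : R) : 0 < e ->
  \forall p \near \oo, p%:R ^+ 3 * (r p)%:R^-1 ^+ 2 <= e.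
Proof.
move=> e0; near=> p.
have p0 : (0 < p)%N by near: p; exact: nbhs_infty_gt.
have P1 : 1 <= p%:R :> R by rewrite ler1n.
have P0 : 0 < p%:R :> R by rewrite ltr0n.
have R0 : 0 < (r p)%:R :> R by rewrite ltr0n r_gt0.
have D0 : 0 < p%:R `^ (3 + delta) :> R by exact: powR_gt0.
have h : e^-1 <= (r p)%:R ^+ 2 / p%:R `^ (3 + delta).
  by near: p; exact: (cvgryPge _).1 sample_size e^-1.
have h3 : p%:R ^+ 3 <= p%:R `^ (3 + delta) :> R.
  by rewrite -powR_mulrn ?(ltW P0)// ler_powR// lerDl ltW.
rewrite exprVn ler_pdivrMr ?exprn_gt0//; apply: (le_trans h3).
by move: h; rewrite ler_pdivlMr// ler_pdivrMl.
Unshelve. all: by end_near. Qed.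

(** [p / r] is at most the square root of [p ^ 3 / r ^ 2]. *)
Let ratio_le (e : R) : 0 < e ->
  \forall p \near \oo, p%:R * (r p)%:R^-1 <= e.
Proof.
move=> e0; near=> p.
have p0 : (0 < p)%N by near: p; exact: nbhs_infty_gt.
have P1 : 1 <= p%:R :> R by rewrite ler1n.
have P0 : 0 <= p%:R :> R by [].
have h : p%:R ^+ 3 * (r p)%:R^-1 ^+ 2 <= e ^+ 2.
  by near: p; apply: cube_le; rewrite exprn_gt0.
have i0 : 0 <= (r p)%:R^-1 :> R by rewrite invr_ge0.
rewrite -(@ler_pXn2r _ 2) ?nnegrE ?mulr_ge0 ?(ltW e0)//.
apply: le_trans h; rewrite exprMn; apply: ler_wpM2r; first exact: sqr_ge0.
by rewrite ler_weXn2l.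
Unshelve. all: by end_near. Qed.

Lemma near_leq_sample_size : \forall p \near \oo, (p <= r p)%N.
Proof.
near=> p.
have p0 : (0 < p)%N by near: p; exact: nbhs_infty_gt.
have R0 : 0 < (r p)%:R :> R by rewrite ltr0n r_gt0.
have h : p%:R * (r p)%:R^-1 <= 1 :> R by near: p; exact: ratio_le.
by move: h; rewrite ler_pdivrMr// mul1r ler_nat.
Unshelve. all: by end_near. Qed.

Lemma rate_cvg0 (C : R) : 0 < C ->
  C * (p%:R ^+ 3 * (r p)%:R^-1 ^+ 2 + p%:R * (r p)%:R^-1 + p%:R^-1) @[p --> \oo] --> 0.
Proof.
move=> C0; apply/cvgr0Pnorm_le => e e0.
have e3 : 0 < e / (3 * C) by rewrite divr_gt0// mulr_gt0.
near=> p.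
have p0 : (0 < p)%N by near: p; exact: nbhs_infty_gt.
have P0 : 0 < p%:R :> R by rewrite ltr0n.
have i0 : 0 <= (r p)%:R^-1 :> R by rewrite invr_ge0.
have h1 : p%:R ^+ 3 * (r p)%:R^-1 ^+ 2 <= e / (3 * C) by near: p; exact: cube_le.
have h2 : p%:R * (r p)%:R^-1 <= e / (3 * C) by near: p; exact: ratio_le.
have h3 : p%:R^-1 <= e / (3 * C).
  have h : (e / (3 * C))^-1 <= p%:R by near: p; exact: nbhs_infty_ger.
  by rewrite -[leRHS]invrK lef_pV2 ?posrE// invr_gt0.
have S0 : 0 <= p%:R ^+ 3 * (r p)%:R^-1 ^+ 2 + p%:R * (r p)%:R^-1 + p%:R^-1 :> R.
  by rewrite !addr_ge0// ?mulr_ge0 ?exprn_ge0// invr_ge0.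
rewrite ger0_norm; last by rewrite mulr_ge0// ltW.
have -> : e = C * (e / (3 * C) + e / (3 * C) + e / (3 * C)).
  by field; rewrite gt_eqF.
by rewrite ler_pM2l//; apply: lerD => //; exact: lerD.
Unshelve. all: by end_near. Qed.

End rate.

Theorem proposition25 (R : realType) (a1 a2 b1 b2 : R)
    (a1_gt0 : 0 < a1) (a2_gt0 : 0 < a2) (b1_gt0 : 0 < b1) (b2_gt0 : 0 < b2)
    (r : nat -> nat) (r_gt0 : forall p, (0 < p)%N -> (0 < r p)%N)
    (y : forall p, 'M[R]_(p, r p))
    (E1 : exists2 delta : R, 0 < delta &
      (r p)%:R ^+ 2 / p%:R `^ (3 + delta) @[p --> \oo] --> +oo)
    (E2 : exists l1 l2 : R, [/\ 0 < l1, 0 < l2 &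
      \forall p \near \oo,
        p%:R^-1 * (\sum_(i < p) (row_mean (y p) i - grand_mean (y p)) ^+ 2) < l1
        /\
        (r p * p)%:R^-1 *
          (\sum_(i < p) \sum_(j < r p) (y p i j - row_mean (y p) i) ^+ 2) < l2]) :
  exists2 L0 : R, 0 < L0 &
  exists2 rho : nat -> R,
    \forall p \near \oo, rho p < 1 /\
      forall (eta : p.+1.-tuple (measurableTypeR R)) (m : nat),
      (wasserstein (@euclidean_dist R p.+1)
         (kiter (gibbs_kernel a1 a2 b1 b2 (y p)) m eta)
         (eta_posterior a1 a2 b1 b2 (y p))
       <= (4 * (\sum_(i < p)
                  (effect eta i + grand_mean (y p) - row_mean (y p) i) ^+ 2
                + (intercept eta - Num.sqrt p%:R * grand_mean (y p)) ^+ 2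
                + L0 * p%:R) * rho p ^+ m)%:E)%E
    & limn_esup (fun p => (rho p)%:E) = 0%E.
Proof.
have [delta delta0 E1'] := E1; have [l1 [l2 [l10 l20 E2']]] := E2.
have k0 := gamma_cst_gt0 R.
(* [theta_shape a1 p] is at most [2^-1 + a1] times [p]. *)
pose M : R := 10 + b1 + b1^-1 + b2 + gamma_cst R + l1 + l2 + (2^-1 + a1).
have b1V0 : 0 < b1^-1 by rewrite invr_gt0.
have ME : M = 10 + b1 + b1^-1 + b2 + gamma_cst R + l1 + l2 + (2^-1 + a1) by [].
have [M10 Mb1 Mb1V Mb2] : [/\ 10 <= M, b1 <= M, b1^-1 <= M & b2 <= M].
  by split; rewrite ME; lra.
have [Mk Ml1 Ml2 Ma1] : [/\ gamma_cst R <= M, l1 <= M, l2 <= M & 2^-1 + a1 <= M].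
  by split; rewrite ME; lra.
clearbody M; have M0 : 0 < M by apply: lt_le_trans M10; rewrite ltr0n.
(* The stationary mean of the Lyapunov function is at most [2 * (M ^+ 5 * p)], and
   the cost adds [p]. *)
exists (2 * M ^+ 5 + 1); first by rewrite addr_gt0// mulr_gt0// exprn_gt0.
pose rho4 p : R := M ^+ 27 *
  (p%:R ^+ 3 * (r p)%:R^-1 ^+ 2 + p%:R * (r p)%:R^-1 + p%:R^-1).
have rho4_0 : rho4 @ \oo --> 0 by apply: (rate_cvg0 delta0 r_gt0 E1'); exact: exprn_gt0.
have rho_0 : Num.sqrt (Num.sqrt (rho4 p)) @[p --> \oo] --> 0.
  rewrite -[X in _ --> X]sqrtr0 -[X in _ --> Num.sqrt X]sqrtr0.
  do 2 (apply: continuous_cvg; first exact: sqrt_continuous).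
  exact: rho4_0.
exists (fun p => Num.sqrt (Num.sqrt (rho4 p))); last first.
  by apply: (cvg_limn_einf_sup _).2; apply: cvg_EFin; [exact: nearW|exact: rho_0].
near=> p.
have p0 : (0 < p)%N by near: p; exact: nbhs_infty_gt.
have P0 : 0 < p%:R :> R by rewrite ltr0n.
have pr : (p <= r p)%N by near: p; exact: (near_leq_sample_size delta0 r_gt0 E1').
have P10 : 10 <= p%:R :> R by near: p; exact: nbhs_infty_ger.
have PM : 352 * M <= p%:R by near: p; exact: nbhs_infty_ger.
have rp := r_gt0 p p0; have R0 : 0 < (r p)%:R :> R by rewrite ltr0n.
have [Q_lt W_lt] : p%:R^-1 * between_sqr (y p) < l1 /\
    (r p * p)%:R^-1 * within_sqr (y p) < l2 by near: p.
have Q_le : between_sqr (y p) <= M * p%:R.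
  move: Q_lt; rewrite ltr_pdivrMl// => /ltW/le_trans; apply.
  by rewrite mulrC ler_pM2r.
have W_le : within_sqr (y p) / (r p)%:R <= M * p%:R.
  rewrite ler_pdivrMr//; move: W_lt; rewrite ltr_pdivrMl ?ltr0n ?muln_gt0 ?rp//.
  move=> /ltW/le_trans; apply.
  have -> : M * p%:R * (r p)%:R = (r p * p)%:R * M by rewrite natrM; ring.
  by rewrite ler_pM2l// natrM mulr_gt0.
have PR : p%:R <= (r p)%:R :> R by rewrite ler_nat.
have RP : p%:R * 10 <= (r p * p)%:R :> R.
  by rewrite natrM; apply: ler_pM => //; exact: le_trans PR.
have th_ge : p%:R / 2 <= theta_shape a1 p by rewrite /theta_shape lerDl ltW.
have e_ge : (r p * p)%:R / 2 <= e_shape a2 p (r p) by rewrite /e_shape lerDl ltW.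
have th_le : theta_shape a1 p <= M * p%:R.
  apply: (@le_trans _ _ ((2^-1 + a1) * p%:R)); last by rewrite ler_pM2r.
  rewrite /theta_shape mulrDl mulrC lerD2l ler_peMr ?(ltW a1_gt0)//; lra.
have th4 : 4 <= theta_shape a1 p by apply: le_trans th_ge; lra.
have e4 : 4 <= e_shape a2 p (r p) by apply: le_trans e_ge; lra.
have th2 : 2 <= theta_shape a1 p by apply: le_trans th4; rewrite ler_nat.
have e2 : p.+1%:R + 1 <= e_shape a2 p (r p).
  apply: le_trans e_ge; rewrite -[p.+1]addn1 natrD; lra.
have proper := posterior_weight_lty (y p) b1_gt0 b2_gt0 p0 rp th2 e2.
split.
  near: p; apply: (cvgr_lt _ rho_0); exact: ltr01.
move=> eta m.
have L0 : 0 <= M ^+ 5 * p%:R by rewrite mulr_ge0 ?exprn_ge0// ltW.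
apply: le_trans (wasserstein_gibbs_le b1_gt0 b2_gt0 p0 rp th4 e4 proper L0 _ _ eta m) _.
- move=> eta0 eta1.
  exact: (contraction_constants b1_gt0 b2_gt0 p0 pr M10 Mb1 Mb1V Mb2 Mk th_le th_ge e_ge
    Q_le W_le (erefl _)).
- move=> eta0.
  exact: lyapunov_mean_drift PM eta0.
rewrite lee_fin; apply: ler_wpM2r; first by rewrite exprn_ge0// sqrtr_ge0.
rewrite -/(lyapunov (y p) eta); have V0 := lyapunov_ge0 (y p) eta.
move: V0 L0 P0; move: (lyapunov _ _) (M ^+ 5) => v u; lra.
Unshelve. all: by end_near. Qed.
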